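(* Let $R$ be a Noetherian local UFD with maximal ideal $\mathfrak{m}$ and field of fractions $K$. Assume that $R$ is complete for the $\mathfrak{m}$-adic topology and that the characteristic of $R/\mathfrak{m}$ is not $2$. Let $V$ be a two-dimensional $K$-vector space and $\rho: G\to \mathrm{Aut}_K(V)$ a representation of a group $G$ such that: $\rho$ is irreducible; $V$ contains a $G$-stable free lattice; $\mathrm{tr}\,\rho \bmod \mathfrak{m}=\psi+\psi'$ for characters $\psi,\psi':G\to (R/\mathfrak{m})^\times$; and $\psi\neq\psi'$. Let $C^{\mathrm{fr}}(\rho)$ be the graph of homothety classes of stable free lattices. Then: (1) There exists an integer $r\ge 0$ such that the graph $C^{\mathrm{fr}}(\rho)$ is isomorphic to an $r$-dimensional rectangle. (2) More precisely, let $J=J(\rho)$ be the ideal of reducibility of $\rho$, with characters $\vartheta,\vartheta':G\to (R/J)^\times$ such that $\mathrm{tr}\,\rho \bmod J=\vartheta+\vartheta'$. Let $\mathcal{N}$ be the set of height-one primes $\mathfrak{p}$ of $R$ with $J_{\mathfrak{p}}\subsetneq R_{\mathfrak{p}}$. If $\mathcal{N}$ is empty, $C^{\mathrm{fr}}(\rho)$ consists of a unique element. If $\mathcal{N}$ is non-empty, write $\mathcal{N}=\{\mathfrak{p}_1,\dots,\mathfrak{p}_r\}$ and $n_i=\mathrm{ord}_{\mathfrak{p}_i}J_{\mathfrak{p}_i}$. Then there is an isomorphism of graphs $$\Phi_{\vartheta}: C^{\mathrm{fr}}(\rho)\stackrel{\sim}{\to}\mathrm{Rect}_{(0,\dots,0)}^{(n_1,\dots,n_r)}$$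 such that for points $(j_1,\dots,j_r)$ and $(j_1',\dots,j_r')$ of $\mathrm{Rect}_{(0,\dots,0)}^{(n_1,\dots,n_r)}$ the following are equivalent: (i) $(j_1,\dots,j_r)\le (j_1',\dots,j_r')$; (ii) there exist representatives $T$ and $T'$ of $\Phi_\vartheta^{-1}((j_1,\dots,j_r))$ and $\Phi_\vartheta^{-1}((j_1',\dots,j_r'))$ respectively such that $T\subset T'$ and $T'/T$ is a quotient of $R/J\,(\vartheta)$. Moreover, if these conditions are satisfied, $T'/T$ is isomorphic to $R/\mathfrak{p}_1^{j_1'-j_1}\cdots\mathfrak{p}_r^{j_r'-j_r}\,(\vartheta)$.
   Context: A lattice in $V$ is a finitely generated $R$-submodule of $V$ spanning $V$ over $K$; it is stable if it is $G$-stable, and free if it is free over $R$. The homothety class of $T$ is $[T]=\{xT: x\in K^\times\}$. For a finitely generated torsion $R$-module $M$, $\mathrm{char}_R(M)=\prod_{\mathfrak{p}}\mathfrak{p}^{\mathrm{length}_{R_\mathfrak{p}}(M_\mathfrak{p})}$, the product over height-one primes. Graph $C^{\mathrm{fr}}(\rho)$: the vertices are the homothety classes of stable free lattices; there is an edge from $x$ to $x'$ if there are representatives $T$ of $x$ and $T'$ of $x'$ with $T\subset T'$ and $\mathrm{char}_R(T'/T)=\mathfrak{p}$ for some height-one prime $\mathfrak{p}$ (this graph is undirected). Rectangle: for integers $a_i\ge 0$, $\mathrm{Rect}_{(0,\dots,0)}^{(a_1,\dots,a_n)}$ is the graph with vertex set $\{(j_1,\dots,j_n)\in\mathbb{Z}^n: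 0\le j_i\le a_i\}$, with an edge between $(j_i)$ and $(j_i')$ if there is $s$ with $|j_s'-j_s|=1$ and $j_i'=j_i$ for $i\ne s$; the $0$-dimensional rectangle is one point. An $n$-dimensional rectangle is a graph of this form. The order $\le$ on vertices is componentwise. Ideal of reducibility: $J(\rho)$ is the unique ideal of $R$ such that for every ideal $I$ of $R$, $J(\rho)\subset I$ if and only if there are characters $\theta,\theta':G\to (R/I)^\times$ with $\mathrm{tr}\,\rho\bmod I=\theta+\theta'$. It exists under the hypotheses, and for $I\subset\mathfrak{m}$ the set $\{\theta,\theta'\}$ is unique. Concretely, choose $g_0\in G$ with $\psi(g_0)\ne\psi'(g_0)$ and a $K$-basis of $V$ diagonalizing $\rho(g_0)$, and write $\rho(g)=\begin{pmatrix}a(g)&b(g)\\c(g)&d(g)\end{pmatrix}$; then $J(\rho)$ is generated by all $b(g)c(g')$, $g,g'\in G$. For an ideal $I\supset J$, $R/I\,(\vartheta)$ is $R/I$ with $G$ acting through $\vartheta \bmod I$; quotients and isomorphisms are of $R[G]$-modules. $\mathrm{ord}_{\mathfrak{p}}J_{\mathfrak{p}}=n$ means $J_\mathfrak{p}=\mathfrak{p}^nR_\mathfrak{p}$. *)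

(* Defs.v *)
From HB Require Import structures.
From mathcomp Require Import all_boot all_order all_algebra.
From mathcomp Require Import all_classical.
From mathcomp Require Import ring.

Set Implicit Arguments.
Unset Strict Implicit.
Unset Printing Implicit Defensive.

Import GRing.Theory.

Notation "x %:F" := (FracField.tofrac x) : ring_scope.
Local Open Scope classical_set_scope.
Local Open Scope quotient_scope.
Local Open Scope ring_scope.

Section Submodules.
Variables (A : pzRingType) (M : lmodType A).
Implicit Types S T : submodClosed M.

Definition set_pred (P : set M) : {pred M} := fun x => `[< P x >].

Fact set_pred_closed (P : set M) (P0 : P 0)
    (PL : forall a x y, P x -> P y -> P (a *: x + y)) : submod_closed (set_pred P).
Proof.
split=> [|a x y]; first exact/asboolP.
by rewrite !unfold_in => /asboolP Px /asboolP Py; apply/asboolP/PL.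
Qed.

Definition mk_submod (P : set M) (P0 : P 0)
    (PL : forall a x y, P x -> P y -> P (a *: x + y)) : submodClosed M :=
  HB.pack_for (submodClosed M) (set_pred P)
    (GRing.isSubmodClosed.Build A M (set_pred P) (set_pred_closed P0 PL)).

Lemma in_mk_submod (P : set M) P0 PL x : (x \in @mk_submod P P0 PL) <-> P x.
Proof.
have -> : (x \in mk_submod P0 PL) = `[< P x >] by [].
by split=> /asboolP.
Qed.

Lemma submodP S T : S =i T -> S = T.
Proof.
case: S T => [S [[a1] [a2]]] [T [[b1] [b2]]] /= eqST.
have {eqST} eST : S = T by apply/funext => x; exact: eqST.
case: T / eST b1 b2 => b1 b2.
by rewrite (Prop_irrelevance a1 b1) (Prop_irrelevance a2 b2).
Qed.

Definition psub S T : Prop := {subset S <= T} /\ ~ {subset T <= S}.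

Definition fingen S : Prop :=
  exists n (b : 'I_n -> M),
    forall x, x \in S <-> exists c : 'I_n -> A, x = \sum_i c i *: b i.

(* Bases are finite: this is only used for finitely generated modules. *)
Definition free_submod S : Prop :=
  exists n (b : 'I_n -> M),
    (forall x, x \in S <-> exists c : 'I_n -> A, x = \sum_i c i *: b i) /\
    (forall c : 'I_n -> A, \sum_i c i *: b i = 0 -> forall i, c i = 0).

Definition submod_chain n : Prop :=
  exists c : nat -> submodClosed M, forall i, (i < n)%N -> psub (c i) (c i.+1).

(* The supremum of the lengths of chains of submodules; the value is the
   dummy 0 when the length is infinite. *)
Definition mlength : nat :=
  xget 0%N [set n | submod_chain n /\ forall k, submod_chain k -> (k <= n)%N].

Definition submod_type S : Type := {x : M | x \in S}.
HB.instance Definition _ S := SubChoice.on (submod_type S).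
HB.instance Definition _ S :=
  GRing.SubChoice_isSubLmodule.Build A M (mem S) (submod_type S)
    (GRing.subsemimodClosedP S).

Definition zpred S : {pred M} := fun x => x \in S.
Fact zpred_closed S : zmod_closed (zpred S).
Proof. exact: GRing.subsemimod_closedB (GRing.subsemimodClosedP S). Qed.
HB.instance Definition _ S := GRing.isZmodClosed.Build M (zpred S) (zpred_closed S).

Definition mquot S : Type := Quotient.quot (zpred S : zmodClosed M).
HB.instance Definition _ S := EqQuotient.on (mquot S).
HB.instance Definition _ S := GRing.Zmodule.on (mquot S).

Section QuotientModule.
Variable S : submodClosed M.

Definition mqpi (x : M) : mquot S := \pi_(mquot S) x.

Lemma mqpi_eq x y : (mqpi x = mqpi y) <-> (x - y \in S).
Proof.
rewrite /mqpi; have := Quotient.idealrBE (zpred S : zmodClosed M) x y.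
by rewrite unfold_in => ->; split=> /eqP.
Qed.

Lemma mqpi_repr (q : mquot S) : mqpi (repr q) = q.
Proof. exact: reprK. Qed.

Lemma mqpiD x y : mqpi (x + y) = mqpi x + mqpi y.
Proof. exact: Quotient.pi_add. Qed.

Definition mquot_scale a (q : mquot S) : mquot S := mqpi (a *: repr q).

Lemma mquot_scaleE a x : mquot_scale a (mqpi x) = mqpi (a *: x).
Proof.
by apply/mqpi_eq; rewrite -scalerBr rpredZ //; apply/mqpi_eq; rewrite mqpi_repr.
Qed.

Fact mquot_scaleA a b q : mquot_scale a (mquot_scale b q) = mquot_scale (a * b) q.
Proof. by rewrite -[q]mqpi_repr !mquot_scaleE scalerA. Qed.
Fact mquot_scale1 : left_id 1 mquot_scale.
Proof. by move=> q; rewrite -[q]mqpi_repr mquot_scaleE scale1r. Qed.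
Fact mquot_scaleDr : right_distributive mquot_scale +%R.
Proof.
move=> a p q; rewrite -[p]mqpi_repr -[q]mqpi_repr -mqpiD !mquot_scaleE.
by rewrite scalerDr mqpiD.
Qed.
Fact mquot_scaleDl q : {morph mquot_scale^~ q : a b / a + b}.
Proof. by move=> a b; rewrite -[q]mqpi_repr !mquot_scaleE scalerDl mqpiD. Qed.

HB.instance Definition _ := GRing.Zmodule_isLmodule.Build A (mquot S)
  mquot_scaleA mquot_scale1 mquot_scaleDr mquot_scaleDl.

End QuotientModule.

End Submodules.

Section SubQuotient.
Variables (A : pzRingType) (M : lmodType A).
Implicit Types S T : submodClosed M.

Fact comap0 S T : val (0 : submod_type T) \in S.
Proof. by rewrite raddf0 rpred0. Qed.
Fact comapL S T a (x y : submod_type T) :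
  val x \in S -> val y \in S -> val (a *: x + y) \in S.
Proof. by move=> xS yS; rewrite linearP rpredD // rpredZ. Qed.

Definition comap S T : submodClosed (submod_type T) :=
  @mk_submod A (submod_type T) [set x | val x \in S] (@comap0 S T) (@comapL S T).

(* The quotient T / S; only meaningful when S is contained in T. *)
Definition subquot T S : lmodType A := mquot (comap S T).

End SubQuotient.

Notation ideal R := (submodClosed R^o).

Section Ideals.
Variable R : comNzRingType.
Implicit Types I J L : ideal R.

Definition ideal_top : ideal R :=
  @mk_submod R R^o setT Logic.I (fun _ _ _ _ _ => Logic.I).

Definition mul_set I J : set R := [set x | exists s : seq (R * R),
  (forall ab, ab \in s -> ab.1 \in I /\ ab.2 \in J) /\
  x = \sum_(ab <- s) ab.1 * ab.2].

Fact mul_set0 I J : mul_set I J 0.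
Proof. by exists [::]; split=> //; rewrite big_nil. Qed.

Fact mul_setL I J (a x y : R) :
  mul_set I J x -> mul_set I J y -> mul_set I J (a * x + y).
Proof.
move=> [s [sIJ ->]] [t [tIJ ->]].
exists ([seq (a * ab.1, ab.2) | ab <- s] ++ t); split.
  move=> ab; rewrite mem_cat => /orP[|/tIJ //].
  by case/mapP=> cd /sIJ[cI dJ] -> /=; split=> //; exact: (@rpredZ _ _ I).
rewrite big_cat big_map /= mulr_sumr; congr (_ + _).
by apply: eq_bigr => ab _; rewrite mulrA.
Qed.

Definition ideal_mul I J : ideal R :=
  @mk_submod R R^o (mul_set I J) (mul_set0 I J) (@mul_setL I J).

Lemma in_ideal_mul I J x : x \in ideal_mul I J <-> mul_set I J x.
Proof. exact: in_mk_submod. Qed.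

Definition ideal_exp I n : ideal R := iter n (ideal_mul I) ideal_top.

Lemma ideal_mulP I J L :
  {subset ideal_mul I J <= L} <->
  (forall a b : R, a \in I -> b \in J -> a * b \in L).
Proof.
split=> [sub a b aI bJ|sub x].
  apply: sub; apply/in_ideal_mul; exists [:: (a, b)]; rewrite big_seq1; split=> //.
  by move=> ab; rewrite inE => /eqP ->.
move/in_ideal_mul => [s [sIJ ->]].
rewrite big_seq; apply: (@rpred_sum _ L) => ab /sIJ[aI bJ]; exact: sub.
Qed.

Lemma mem_ideal_mul I J (a b : R) : a \in I -> b \in J -> a * b \in ideal_mul I J.
Proof. by move=> aI bJ; apply: (ideal_mulP I J (ideal_mul I J)).1. Qed.

Lemma ideal_mul_sub I J L : (forall a b : R, a \in I -> b \in J -> a * b \in L) ->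
  {subset ideal_mul I J <= L}.
Proof. by move/ideal_mulP. Qed.

Fact ideal_mulC : commutative ideal_mul.
Proof.
move=> I J; apply/submodP => x; apply/idP/idP; move: x; apply: ideal_mul_sub;
  by move=> a b aI bJ; rewrite mulrC; exact: mem_ideal_mul.
Qed.

Fact ideal_mulA : associative ideal_mul.
Proof.
have half I J L : {subset ideal_mul I (ideal_mul J L) <= ideal_mul (ideal_mul I J) L}.
  apply: ideal_mul_sub => a b aI /in_ideal_mul[s [sJL ->]].
  rewrite mulr_sumr big_seq; apply: (@rpred_sum _ (ideal_mul (ideal_mul I J) L)).
  by move=> ab /sJL[bJ cL]; rewrite mulrA; do 2![apply: mem_ideal_mul => //].
move=> I J L; apply/submodP => x; apply/idP/idP; first exact: half.
rewrite [ideal_mul I (ideal_mul J L)]ideal_mulC (ideal_mulC J).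
by rewrite (ideal_mulC _ L) (ideal_mulC I); exact: half.
Qed.

Fact ideal_mul1 : left_id ideal_top ideal_mul.
Proof.
move=> I; apply/submodP => x; apply/idP/idP.
  by move: x; apply: ideal_mul_sub => a b _ bI; exact: (@rpredZ _ _ I).
by move=> xI; rewrite -[x]mul1r; apply: mem_ideal_mul => //; apply/in_mk_submod.
Qed.

HB.instance Definition _ :=
  Monoid.isComLaw.Build (ideal R) ideal_top ideal_mul
    ideal_mulA ideal_mulC ideal_mul1.

(* The quotient ring R / I; it is the zero ring when I is the unit ideal. *)
Definition rquot I : Type := @mquot R R^o I.
HB.instance Definition _ I := EqQuotient.on (rquot I).
HB.instance Definition _ I := GRing.Lmodule.on (rquot I).

Section QuotientRing.
Variable I : ideal R.

Definition rpi (x : R) : rquot I := @mqpi R R^o I x.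

Lemma rpi_eq x y : rpi x = rpi y <-> x - y \in I.
Proof. exact: mqpi_eq. Qed.

Lemma rpi_repr (q : rquot I) : rpi (repr q) = q.
Proof. exact: mqpi_repr. Qed.

Lemma rpi_surj (q : rquot I) : exists x, q = rpi x.
Proof. by exists (repr q); rewrite rpi_repr. Qed.

Lemma rpiD x y : rpi (x + y) = rpi x + rpi y.
Proof. exact: mqpiD. Qed.

Definition rquot_mul (p q : rquot I) : rquot I := rpi (repr p * repr q).

Lemma rquot_mulE x y : rquot_mul (rpi x) (rpi y) = rpi (x * y).
Proof.
apply/rpi_eq; set x' := repr _; set y' := repr _.
have xI : x' - x \in I by apply/rpi_eq; rewrite rpi_repr.
have yI : y' - y \in I by apply/rpi_eq; rewrite rpi_repr.
have -> : x' * y' - x * y = y' * (x' - x) + x * (y' - y).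
  by rewrite !mulrBr [y' * x']mulrC [y' * x]mulrC addrA subrK.
by apply: (@rpredD _ I); exact: (@rpredZ _ _ I).
Qed.

Fact rquot_mulA : associative rquot_mul.
Proof.
move=> p q r.
have [[[x ->] [y ->]] [z ->]] := (rpi_surj p, rpi_surj q, rpi_surj r).
by rewrite !rquot_mulE mulrA.
Qed.
Fact rquot_mulC : commutative rquot_mul.
Proof.
move=> p q; have [[x ->] [y ->]] := (rpi_surj p, rpi_surj q).
by rewrite !rquot_mulE mulrC.
Qed.
Fact rquot_mul1 : left_id (rpi 1) rquot_mul.
Proof. by move=> p; have [x ->] := rpi_surj p; rewrite rquot_mulE mul1r. Qed.
Fact rquot_mulDl : left_distributive rquot_mul +%R.
Proof.
move=> p q r.
have [[[x ->] [y ->]] [z ->]] := (rpi_surj p, rpi_surj q, rpi_surj r).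
by rewrite -rpiD !rquot_mulE -rpiD mulrDl.
Qed.

HB.instance Definition _ := GRing.Zmodule_isComPzRing.Build (rquot I)
  rquot_mulA rquot_mulC rquot_mul1 rquot_mulDl.

End QuotientRing.

Definition noetherian : Prop := forall I, fingen I.

Definition maximal_ideal (m : ideal R) : Prop :=
  1 \notin m /\ forall I, {subset m <= I} -> 1 \notin I -> I =i m.

Definition local_ring (m : ideal R) : Prop :=
  maximal_ideal m /\ forall n, maximal_ideal n -> n =i m.

Definition adic_complete (m : ideal R) : Prop :=
  (forall x : R, (forall n, x \in ideal_exp m n) -> x = 0) /\
  forall u : nat -> R,
    (forall n, exists N, forall i j, (N <= i)%N -> (N <= j)%N ->
       u i - u j \in ideal_exp m n) ->
    exists l : R, forall n, exists N, forall i, (N <= i)%N ->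
       u i - l \in ideal_exp m n.

Record primeIdeal := PrimeIdeal {
  prime_ideal :> ideal R;
  _ : 1 \notin prime_ideal;
  _ : prime_idealr_closed prime_ideal
}.

Definition prime_chain (p : primeIdeal) n : Prop :=
  exists c : nat -> primeIdeal,
    c n = p /\ forall i, (i < n)%N -> @psub R R^o (c i) (c i.+1).

Definition height (p : primeIdeal) n : Prop :=
  prime_chain p n /\ forall k, prime_chain p k -> (k <= n)%N.

End Ideals.

Section UFD.
Variable R : idomainType.

Definition irreducible_elt (x : R) : Prop :=
  [/\ x != 0, x \isn't a GRing.unit &
      forall a b, x = a * b -> a \is a GRing.unit \/ b \is a GRing.unit].

Definition associated (x y : R) : Prop :=
  exists2 u, u \is a GRing.unit & y = u * x.

Definition ufd : Prop :=
  (forall x : R, x != 0 -> x \isn't a GRing.unit ->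
     exists2 s : seq R, (forall y, y \in s -> irreducible_elt y) &
       x = \prod_(y <- s) y) /\
  (forall s t : seq R,
     (forall y, y \in s -> irreducible_elt y) ->
     (forall y, y \in t -> irreducible_elt y) ->
     \prod_(y <- s) y = \prod_(y <- t) y ->
     size s = size t /\
     exists2 t', perm_eq t t' & forall i, (i < size s)%N -> associated s`_i t'`_i).

End UFD.

Section Localization.
Variables (R : idomainType) (p : primeIdeal R).

Fact prime_ideal1 : 1 \notin (p : ideal R).
Proof. by case: p. Qed.

Fact prime_idealM (s t : R) :
  s \notin (p : ideal R) -> t \notin (p : ideal R) -> s * t \notin (p : ideal R).
Proof.
case: p => q q1 qM /= sq tq; apply/negP => /qM.
by rewrite (negPf sq) (negPf tq).
Qed.

Fact prime_ideal_neq0 (s : R) : s \notin (p : ideal R) -> s != 0.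
Proof. by apply: contraNneq => ->; exact: (@rpred0 _ (p : ideal R)). Qed.

(* As R is a domain, R_p is taken inside the field of fractions. *)
Definition loc_set : set {fraction R} :=
  [set x | exists (a s : R), s \notin (p : ideal R) /\ x = a%:F / s%:F].
Definition loc_pred : {pred {fraction R}} := fun x => `[< loc_set x >].

Fact loc_pred_closed : subring_closed loc_pred.
Proof.
have F0 (s : R) : s \notin (p : ideal R) -> s%:F != 0.
  by move/prime_ideal_neq0; rewrite tofrac_eq0.
split.
- by apply/asboolP; exists 1, 1; rewrite prime_ideal1 tofrac1 divr1.
- move=> x y /asboolP[a [s [sp ->]]] /asboolP[b [t [tp ->]]]; apply/asboolP.
  exists (a * t - b * s), (s * t); split; first exact: prime_idealM.
  by rewrite tofracB !tofracM -mulNr addf_div ?F0 // mulNr.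
- move=> x y /asboolP[a [s [sp ->]]] /asboolP[b [t [tp ->]]]; apply/asboolP.
  exists (a * b), (s * t); split; first exact: prime_idealM.
  by rewrite !tofracM mulf_div.
Qed.
HB.instance Definition _ :=
  GRing.isSubringClosed.Build {fraction R} loc_pred loc_pred_closed.

Definition loc : Type := {x : {fraction R} | x \in loc_pred}.
HB.instance Definition _ := SubChoice.on loc.
HB.instance Definition _ :=
  GRing.SubChoice_isSubComNzRing.Build {fraction R} (mem loc_pred) loc loc_pred_closed.

(* I_p, the ideal of R_p generated by I *)
Definition loc_ideal (I : ideal R) : set loc :=
  [set x | exists a s : R,
     [/\ a \in I, s \notin (p : ideal R) & val x = a%:F / s%:F]].

(* ord_p J_p = n, that is J_p = p^n R_p *)
Definition ord_loc (J : ideal R) (n : nat) : Prop :=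
  loc_ideal J = loc_ideal (ideal_exp p n).

Section LocalizedModule.
Variable M : lmodType R.

Definition mfrac : Type := (M * {s : R | s \notin (p : ideal R)})%type.
HB.instance Definition _ := Choice.on mfrac.

Definition mfrac_eqv (x y : mfrac) : bool :=
  `[< exists2 u : R, u \notin (p : ideal R) &
        u *: (val y.2 *: x.1) = u *: (val x.2 *: y.1) >].

Fact mfrac_eqvP : equiv_class_of mfrac_eqv.
Proof.
split=> [x|x y|y x z].
- by apply/asboolP; exists 1; rewrite ?prime_ideal1.
- by apply/asboolP/asboolP => -[u up e]; exists u.
- move=> /asboolP[u up e] /asboolP[v vp f]; apply/asboolP.
  exists (u * v * val y.2).
    by do 2?[apply: prime_idealM => //]; exact: (valP y.2).
  rewrite !scalerA.
  have e' := congr1 ( *:%R (v * val z.2)) e.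
  have f' := congr1 ( *:%R (u * val x.2)) f.
  rewrite !scalerA in e' f'.
  transitivity ((v * val z.2 * u * val y.2) *: x.1); first by congr (_ *: _); ring.
  rewrite e'.
  transitivity ((u * val x.2 * v * val z.2) *: y.1); first by congr (_ *: _); ring.
  by rewrite f'; congr (_ *: _); ring.
Qed.
Canonical mfrac_equiv := EquivRelPack mfrac_eqvP.

Definition mloc : Type := {eq_quot mfrac_eqv}.
HB.instance Definition _ := EqQuotient.on mloc.
HB.instance Definition _ := Choice.on mloc.

Definition pcompl : Type := {s : R | s \notin (p : ideal R)}.
Definition pcompl_mul (s t : pcompl) : pcompl :=
  exist _ (val s * val t) (prime_idealM (valP s) (valP t)).
Definition pcompl1 : pcompl := exist _ 1 prime_ideal1.

Lemma pcompl_mulE s t : val (pcompl_mul s t) = val s * val t.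
Proof. by []. Qed.
Lemma pcompl1E : val pcompl1 = 1. Proof. by []. Qed.

Definition mk_mloc (x : M) (s : pcompl) : mloc := \pi_mloc ((x, s) : mfrac).

Lemma mk_mloc_eq x s y t :
  mk_mloc x s = mk_mloc y t <->
  exists2 u : R, u \notin (p : ideal R) & u *: (val t *: x) = u *: (val s *: y).
Proof.
rewrite /mk_mloc; split=> [/eqmodP/asboolP //|e].
by apply/eqmodP/asboolP.
Qed.

Lemma mlocP (q : mloc) : exists x s, q = mk_mloc x s.
Proof. by exists (repr q).1, (repr q).2; rewrite /mk_mloc -surjective_pairing reprK. Qed.

Definition mloc_add (q r : mloc) : mloc :=
  mk_mloc (val (repr r).2 *: (repr q).1 + val (repr q).2 *: (repr r).1)
          (pcompl_mul (repr q).2 (repr r).2).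
Definition mloc_opp (q : mloc) : mloc := mk_mloc (- (repr q).1) (repr q).2.
Definition mloc0 : mloc := mk_mloc 0 pcompl1.

Lemma mk_mloc_repr x s : exists2 u : R, u \notin (p : ideal R) &
  u *: (val s *: (repr (mk_mloc x s)).1) = u *: (val (repr (mk_mloc x s)).2 *: x).
Proof.
by apply/mk_mloc_eq; rewrite {1}/mk_mloc -surjective_pairing reprK.
Qed.

Lemma mloc_addE x s y t :
  mloc_add (mk_mloc x s) (mk_mloc y t) =
  mk_mloc (val t *: x + val s *: y) (pcompl_mul s t).
Proof.
have [u up e] := mk_mloc_repr x s; have [v vp f] := mk_mloc_repr y t.
rewrite /mloc_add; move: e f; set q := repr _; set r := repr _ => e f.
apply/mk_mloc_eq; exists (u * v); first exact: prime_idealM.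
rewrite !pcompl_mulE !scalerDr !scalerA; congr (_ + _).
  have := congr1 ( *:%R (v * val t * val r.2)) e; rewrite !scalerA => e'.
  by transitivity ((v * val t * val r.2 * u * val s) *: q.1);
    [|rewrite e']; congr (_ *: _); ring.
have := congr1 ( *:%R (u * val s * val q.2)) f; rewrite !scalerA => f'.
by transitivity ((u * val s * val q.2 * v * val t) *: r.1);
  [|rewrite f']; congr (_ *: _); ring.
Qed.

Lemma mloc_oppE x s : mloc_opp (mk_mloc x s) = mk_mloc (- x) s.
Proof.
have [u up e] := mk_mloc_repr x s; rewrite /mloc_opp.
by apply/mk_mloc_eq; exists u; rewrite // !scalerN e.
Qed.

Fact mloc_addA : associative mloc_add.
Proof.
move=> q r w.
have [[x [s ->]] [y [t ->]]] := (mlocP q, mlocP r); have [z [v ->]] := mlocP w.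
rewrite !mloc_addE; apply/mk_mloc_eq; exists 1; first exact: prime_ideal1.
rewrite !pcompl_mulE !scale1r !scalerDr !scalerA addrA.
by congr (_ *: _ + _ *: _ + _ *: _); ring.
Qed.
Fact mloc_addC : commutative mloc_add.
Proof.
move=> q r; have [[x [s ->]] [y [t ->]]] := (mlocP q, mlocP r).
rewrite !mloc_addE addrC; apply/mk_mloc_eq; exists 1; first exact: prime_ideal1.
by rewrite !pcompl_mulE mulrC.
Qed.
Fact mloc_add0 : left_id mloc0 mloc_add.
Proof.
move=> q; have [x [s ->]] := mlocP q.
rewrite mloc_addE; apply/mk_mloc_eq; exists 1; first exact: prime_ideal1.
by rewrite pcompl_mulE pcompl1E scaler0 add0r !scale1r mul1r.
Qed.
Fact mloc_addN : left_inverse mloc0 mloc_opp mloc_add.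
Proof.
move=> q; have [x [s ->]] := mlocP q.
rewrite mloc_oppE mloc_addE; apply/mk_mloc_eq; exists 1; first exact: prime_ideal1.
by rewrite scalerN addNr !scaler0.
Qed.

HB.instance Definition _ :=
  GRing.isZmodule.Build mloc mloc_addA mloc_addC mloc_add0 mloc_addN.

Fact loc_fracP (c : loc) : exists a : R * pcompl, val c = a.1%:F / (val a.2)%:F.
Proof.
case: c => c /= cp; have /asboolP[a [s [sp ->]]] := cp.
by exists (a, exist _ s sp).
Qed.
Definition loc_num (c : loc) : R := (sval (cid (loc_fracP c))).1.
Definition loc_den (c : loc) : pcompl := (sval (cid (loc_fracP c))).2.
Lemma loc_numden c : val c = (loc_num c)%:F / (val (loc_den c))%:F.
Proof. by rewrite /loc_num /loc_den; case: cid. Qed.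

Definition mloc_scale (c : loc) (q : mloc) : mloc :=
  mk_mloc (loc_num c *: (repr q).1) (pcompl_mul (loc_den c) (repr q).2).

Lemma mloc_scaleE (c : loc) (a : R) (s : pcompl) x t :
  val c = a%:F / (val s)%:F ->
  mloc_scale c (mk_mloc x t) = mk_mloc (a *: x) (pcompl_mul s t).
Proof.
move=> cE; have [u up e] := mk_mloc_repr x t; rewrite /mloc_scale.
move: e; set q := repr _ => e.
apply/mk_mloc_eq; exists u => //; rewrite !pcompl_mulE !scalerA.
have F0 (w : pcompl) : (val w)%:F != 0.
  by rewrite tofrac_eq0; exact: prime_ideal_neq0 (valP w).
have cross : loc_num c * val s = a * val (loc_den c).
  apply/eqP; rewrite -tofrac_eq !tofracM -eqr_div ?F0 //.
  by rewrite -loc_numden cE.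
have := congr1 ( *:%R (val s * loc_num c)) e; rewrite !scalerA => e'.
transitivity ((val s * loc_num c * u * val t) *: q.1); first by congr (_ *: _); ring.
rewrite e'; congr (_ *: _).
transitivity (u * val q.2 * (loc_num c * val s)); first by ring.
by rewrite cross; ring.
Qed.

Fact mloc_scaleA a b q : mloc_scale a (mloc_scale b q) = mloc_scale (a * b) q.
Proof.
have [x [t ->]] := mlocP q.
have [aE bE] := (loc_numden a, loc_numden b).
rewrite (mloc_scaleE _ _ bE) (mloc_scaleE _ _ aE).
have abE : val (a * b) = (loc_num a * loc_num b)%:F /
    (val (pcompl_mul (loc_den a) (loc_den b)))%:F.
  have -> : val (a * b) = val a * val b by [].
  by rewrite pcompl_mulE aE bE !tofracM mulf_div.
rewrite (mloc_scaleE _ _ abE) scalerA.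
by apply/mk_mloc_eq; exists 1; rewrite ?prime_ideal1 // !pcompl_mulE mulrA.
Qed.
Fact mloc_scale1 : left_id 1 mloc_scale.
Proof.
move=> q; have [x [t ->]] := mlocP q.
have E : val (1 : loc) = 1%:F / (val pcompl1)%:F by rewrite pcompl1E tofrac1 divr1; apply: erefl.
rewrite (mloc_scaleE _ _ E) scale1r.
by apply/mk_mloc_eq; exists 1; rewrite ?prime_ideal1 // pcompl_mulE pcompl1E mul1r.
Qed.
Fact mloc_scaleDr : right_distributive mloc_scale +%R.
Proof.
move=> c q r; have [[x [s ->]] [y [t ->]]] := (mlocP q, mlocP r).
have cE := loc_numden c.
rewrite [_ + _]mloc_addE !(mloc_scaleE _ _ cE) [RHS]mloc_addE.
apply/mk_mloc_eq; exists 1; rewrite ?prime_ideal1 // !pcompl_mulE !scale1r !scalerDr !scalerA.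
by congr (_ *: _ + _ *: _); ring.
Qed.
Fact mloc_scaleDl q : {morph mloc_scale^~ q : a b / a + b}.
Proof.
move=> a b; have [x [t ->]] := mlocP q.
have [aE bE] := (loc_numden a, loc_numden b).
have F0 (w : pcompl) : (val w)%:F != 0.
  by rewrite tofrac_eq0; exact: prime_ideal_neq0 (valP w).
have abE : val (a + b) =
    (loc_num a * val (loc_den b) + loc_num b * val (loc_den a))%:F /
    (val (pcompl_mul (loc_den a) (loc_den b)))%:F.
  have -> : val (a + b) = val a + val b by [].
  by rewrite pcompl_mulE aE bE tofracD !tofracM addf_div ?F0.
rewrite (mloc_scaleE _ _ abE) (mloc_scaleE _ _ aE) (mloc_scaleE _ _ bE).
rewrite [RHS]mloc_addE; apply/mk_mloc_eq; exists 1; first exact: prime_ideal1.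
rewrite !pcompl_mulE !scale1r !scalerDr !scalerA -scalerDl; congr (_ *: _); ring.
Qed.

HB.instance Definition _ := GRing.Zmodule_isLmodule.Build loc mloc
  mloc_scaleA mloc_scale1 mloc_scaleDr mloc_scaleDl.

End LocalizedModule.
End Localization.

Arguments loc_ideal {R} p I.

Definition enumerates (T : Type) (N : T -> Prop) r (p : 'I_r -> T) : Prop :=
  injective p /\ forall q, N q <-> exists i, p i = q.

(* I = char_R(M), for M finitely generated and torsion: the p_i are the
   height-one primes at which M has nonzero length. *)
Definition is_char_ideal (R : idomainType) (M : lmodType R) (I : ideal R) : Prop :=
  exists n (p : 'I_n -> primeIdeal R),
    enumerates (fun q => height q 1 /\ mlength (mloc q M) <> 0%N) p /\
    I = \big[@ideal_mul R/ideal_top R]_(i < n)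
          ideal_exp (p i) (mlength (mloc (p i) M)).

Definition ht1_support (R : idomainType) (J : ideal R) (p : primeIdeal R) : Prop :=
  height p 1 /\ loc_ideal p J <> setT.

Record graph := Graph { vertex : Type; adj : vertex -> vertex -> Prop }.

Record graph_iso (A B : graph) := GraphIso {
  iso_fun : vertex A -> vertex B;
  iso_inv : vertex B -> vertex A;
  iso_funK : cancel iso_fun iso_inv;
  iso_invK : cancel iso_inv iso_fun;
  iso_adj : forall x y, adj x y <-> adj (iso_fun x) (iso_fun y)
}.

Definition rect_vertex n (a : 'I_n -> nat) : Type :=
  {j : {ffun 'I_n -> nat} | [forall i, j i <= a i]%N}.

Definition rect n (a : 'I_n -> nat) : graph :=
  @Graph (rect_vertex a) (fun j j' => exists s : 'I_n,
    `|val j' s - val j s|%N = 1%N /\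
    forall i, i != s -> val j' i = val j i).

Definition rect_le n (a : 'I_n -> nat) (j j' : rect_vertex a) : Prop :=
  forall i, (val j i <= val j' i)%N.

(* A character with values in (R/I)^*: the values of a morphism of monoids from
   a group are automatically invertible. *)
Definition is_character (G : groupType) (S : comPzRingType) (chi : G -> S) : Prop :=
  chi 1%g = 1 /\ forall g h, chi (g * h)%g = chi g * chi h.

(* The axioms of a G-action are not recorded: only equivariant R-linear maps
   between these modules matter. *)
Record gmodule (R : pzRingType) (G : Type) := GModule {
  gmod_car :> lmodType R;
  gmod_act : G -> gmod_car -> gmod_car
}.

Definition ghom (R : pzRingType) (G : Type) (M N : gmodule R G) (f : M -> N) : Prop :=
  linear f /\ forall g x, f (gmod_act g x) = gmod_act g (f x).

(* N is isomorphic to a quotient of M *)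
Definition is_gquotient (R : pzRingType) (G : Type) (N M : gmodule R G) : Prop :=
  exists2 f : M -> N, ghom f & forall y, exists x, f x = y.

Definition gisomorphic (R : pzRingType) (G : Type) (M N : gmodule R G) : Prop :=
  exists2 f : M -> N, ghom f & bijective f.

(* R/I (theta): g acts as the image in R/I of a lift to R of theta g; this is
   independent of the lift when J is contained in I. *)
Definition char_module (R : comNzRingType) (G : Type) (J I : ideal R)
    (theta : G -> rquot J) : gmodule R G :=
  @GModule R G (rquot I) (fun g x => rpi I (repr (theta g)) * x).

(* Restriction of scalars from K to R *)
Definition rmod (R : idomainType) (V : lmodType {fraction R}) : Type := V.

Section RestrictScalars.
Variables (R : idomainType) (V : lmodType {fraction R}).
HB.instance Definition _ := GRing.Zmodule.on (rmod V).

Definition rmod_scale (a : R) (v : rmod V) : rmod V := (a%:F *: (v : V)).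
Fact rmod_scaleA a b v : rmod_scale a (rmod_scale b v) = rmod_scale (a * b) v.
Proof. by rewrite /rmod_scale scalerA tofracM. Qed.
Fact rmod_scale1 : left_id 1 rmod_scale.
Proof. by move=> v; rewrite /rmod_scale tofrac1 scale1r. Qed.
Fact rmod_scaleDr : right_distributive rmod_scale +%R.
Proof. by move=> a u v; rewrite /rmod_scale scalerDr. Qed.
Fact rmod_scaleDl v : {morph rmod_scale^~ v : a b / a + b}.
Proof. by move=> a b; rewrite /rmod_scale tofracD scalerDl. Qed.
HB.instance Definition _ := GRing.Zmodule_isLmodule.Build R (rmod V)
  rmod_scaleA rmod_scale1 rmod_scaleDr rmod_scaleDl.
End RestrictScalars.

Section Representation.
Variables (R : idomainType) (V : vectType {fraction R}) (G : groupType).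
Variable rho : G -> 'End(V).

Definition is_representation : Prop :=
  rho 1%g = \1%VF /\ forall g h, rho (g * h)%g = (rho g \o rho h)%VF.

Definition irreducible_rep : Prop :=
  (fullv : {vspace V}) <> 0%VS /\
  forall U : {vspace V}, (forall g, (rho g @: U <= U)%VS) -> U = 0%VS \/ U = fullv.

Definition trace_end (f : 'End(V)) : {fraction R} :=
  \tr (passmx.mxof (vbasis (fullv : {vspace V})) (vbasis (fullv : {vspace V})) f).

(* tr rho mod I = theta + theta'; this includes that tr rho has values in R *)
Definition trace_mod (I : ideal R) (theta theta' : G -> rquot I) : Prop :=
  forall g, exists2 t : R, t%:F = trace_end (rho g) & rpi I t = theta g + theta' g.

Definition reducible_mod (I : ideal R) : Prop :=
  exists theta theta' : G -> rquot I,
    [/\ is_character theta, is_character theta' & trace_mod theta theta'].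

Definition is_reducibility_ideal (J : ideal R) : Prop :=
  forall I : ideal R, {subset J <= I} <-> reducible_mod I.

Definition is_lattice (T : submodClosed (rmod V)) : Prop :=
  fingen T /\
  forall v : V, exists n (c : 'I_n -> {fraction R}) (t : 'I_n -> V),
    (forall i, (t i : rmod V) \in T) /\ v = \sum_i c i *: t i.

Definition is_stable (T : submodClosed (rmod V)) : Prop :=
  forall g (v : V), (v : rmod V) \in T -> (rho g v : rmod V) \in T.

Record sflattice := SFLattice {
  sfl_mod :> submodClosed (rmod V);
  sfl_lattice : is_lattice sfl_mod;
  sfl_stable : is_stable sfl_mod;
  sfl_free : free_submod sfl_mod
}.

Definition homothety_class (T : sflattice) : sflattice -> Prop :=
  fun S => exists2 x : {fraction R}, x != 0 &
    forall v : V, (v : rmod V) \in sfl_mod S <->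
      exists2 t : V, (t : rmod V) \in sfl_mod T & v = x *: t.

Definition Cfr_vertex : Type :=
  {X : sflattice -> Prop | exists T, X = homothety_class T}.

(* adj is only required in one direction, as in the definition in terms of
   T contained in T'; it is symmetric, since char (T'/T) = (pi) implies that
   pi T' is contained in T with char (T / pi T') = (pi). *)
Definition Cfr : graph :=
  @Graph Cfr_vertex (fun X X' => exists T T' : sflattice,
    [/\ sval X T, sval X' T', {subset sfl_mod T <= sfl_mod T'} &
      exists2 p : primeIdeal R, height p 1 &
        is_char_ideal (subquot T' T) p]).

Definition stable_act (T : sflattice) (g : G) (x : submod_type T) : submod_type T :=
  exist _ (rho g (val x) : rmod V) (sfl_stable g (valP x)).

(* T' / T as an R[G]-module *)
Definition lattice_quotient (T' T : sflattice) : gmodule R G :=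
  @GModule R G (subquot T' T) (fun g x => mqpi _ (stable_act g (repr x))).

End Representation.

(* Main.v *)
Require Import Defs.
From mathcomp Require Import all_boot all_order all_algebra.
From mathcomp Require Import all_classical.
From mathcomp Require Import ring.

(** The residual characters differ at some g0, so the characteristic polynomial
    of rho(g0) has distinct roots modulo the maximal ideal; a square root of its
    discriminant lifts by Newton iteration, and rho(g0) has two eigenvalues in R
    whose difference is a unit ([residual_eigenframe]). The projectors onto the
    eigenlines are then polynomials in rho(g0) with coefficients in R, so a
    stable free lattice splits as R x e1 + R y e2 in an eigenbasis
    ([box_of_eigenframe]).

    Write a, b, c, d for the matrix entries of rho in this basis. Scaling e1 by
    means of some stable lattice brings the entries into R, and scaling e2 by the
    content of c makes c primitive; let h be the content of b
    ([normal_form_exists]). As R is factorial, R e1 + w^-1 R e2 is stable exactly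
    when w lies in R and divides h, and up to homothety this exhausts the stable
    free lattices ([lat_at_exists], [lat_at_build], [lat_at_homothety]): the
    vertices of the graph are the divisors of h up to units, that is the points
    of the rectangle whose sides are the exponents in the factorization of h.

    For T = x (R e1 + w^-1 R e2) inside T' = x' (R e1 + w'^-1 R e2), write
    x = r x' and x / w = s (x' / w'). Then T'/T is R/r + R/s, and its
    characteristic ideal is (r s): the length at each height-one prime is
    computed by an explicit filtration ([mlength_two_generators],
    [char_ideal_two_generators]). It is prime exactly when one of r, s is a unit
    and the other is irreducible, which moves w by one irreducible factor: these
    are the edges of the rectangle ([lat_adj], [rect_iso]).

    The ideal J generated by the products b(g) c(g') is the ideal of
    reducibility: characters theta, theta' with sum the trace modulo I are
    forced, by their values at g0, to be the diagonal entries, and these are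
    multiplicative modulo I only if b(g) c(g') lies in I ([nf_split],
    [nf_reducibility]). By primitivity J and h generate the same ideal at every
    height-one prime ([nf_ord_loc]). Ordering the eigenvectors so that
    theta = d modulo J, a quotient T'/T of R/J(theta) contains no eigenvector of
    g0 for the other eigenvalue, so x'/x is a unit ([gquotient_fdvd]); then w
    divides w', and the e2-coordinate identifies T'/T with R/(w'/w)(theta)
    ([lat_quotient_iso]). *)

Set Implicit Arguments.
Unset Strict Implicit.
Unset Printing Implicit Defensive.

Import GRing.Theory.
Local Open Scope ring_scope.

(** * Divisibility in a unique factorization domain *)

Section Divisibility.
Variable R : idomainType.
Implicit Types (x y z p q : R).

Definition dvd x y : Prop := exists c, y = c * x.

Lemma dvd_refl x : dvd x x.
Proof. by exists 1; rewrite mul1r. Qed.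

Lemma dvd_trans x y z : dvd x y -> dvd y z -> dvd x z.
Proof. by move=> [c ->] [d ->]; exists (d * c); rewrite mulrA. Qed.

Lemma dvd_mull x y z : dvd x y -> dvd x (z * y).
Proof. by move=> [c ->]; exists (z * c); rewrite mulrA. Qed.

Lemma dvd0 x : dvd x 0.
Proof. by exists 0; rewrite mul0r. Qed.

Lemma dvd_add x y z : dvd x y -> dvd x z -> dvd x (y + z).
Proof. by move=> [c ->] [d ->]; exists (c + d); rewrite mulrDl. Qed.

Lemma dvd_neq0 x y : dvd x y -> y != 0 -> x != 0.
Proof. by move=> [c ->]; rewrite mulf_eq0 negb_or => /andP[]. Qed.

Lemma dvd_mul2l z x y : z != 0 -> dvd (z * x) (z * y) <-> dvd x y.
Proof.
move=> z0; split=> -[c e]; exists c; last by rewrite e mulrCA.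
by apply: (mulfI z0); rewrite e mulrCA.
Qed.

Lemma unit_dvd u x : u \is a GRing.unit -> dvd u x.
Proof. by move=> uU; exists (x / u); rewrite divrK. Qed.

Lemma dvd_unit x u : u \is a GRing.unit -> dvd x u -> x \is a GRing.unit.
Proof. by move=> uU [c e]; move: uU; rewrite e unitrM => /andP[]. Qed.

Lemma assoc_dvd x y : associated x y -> dvd x y.
Proof. by move=> [u _ ->]; exists u. Qed.

Lemma assoc_sym x y : associated x y -> associated y x.
Proof.
by move=> [u uU ->]; exists u^-1; rewrite ?unitrV // mulrA mulVr // mul1r.
Qed.

Lemma assoc_refl x : associated x x.
Proof. by exists 1; rewrite ?unitr1 ?mul1r. Qed.

Lemma assoc_trans x y z : associated x y -> associated y z -> associated x z.
Proof.
move=> [u uU ->] [v vU ->]; exists (v * u); rewrite ?mulrA //.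
by rewrite unitrM vU.
Qed.

Lemma dvd_assoc x y : dvd x y -> dvd y x -> associated x y.
Proof.
move=> [c ->] [d e]; have [x0|x0] := eqVneq x 0.
  by rewrite x0 mulr0; exact: assoc_refl.
exists c => //; have dc : d * c = 1 by apply: (mulIf x0); rewrite -mulrA -e mul1r.
by apply/unitrP; exists d; split=> //; rewrite mulrC.
Qed.

Lemma irr_neq0 p : irreducible_elt p -> p != 0.
Proof. by case. Qed.

Lemma irr_nunit p : irreducible_elt p -> p \isn't a GRing.unit.
Proof. by case. Qed.

Lemma irr_dvd_irr p q :
  irreducible_elt p -> irreducible_elt q -> dvd p q -> associated p q.
Proof.
move=> [_ pU _] [_ _ qI] [c e]; case: (qI _ _ e) => [cU|]; last by rewrite (negPf pU).
by exists c.
Qed.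

Lemma irr_assoc p q : irreducible_elt p -> associated p q -> irreducible_elt q.
Proof.
move=> [p0 pU pI] pq; have [v vU e] := assoc_sym pq; have [u uU qE] := pq; split.
- by rewrite qE mulf_neq0 //; apply: contraTneq uU => ->; rewrite unitr0.
- by rewrite qE unitrM uU.
- move=> a b qab; have: p = (v * a) * b by rewrite e qab mulrA.
  by case/pI; [rewrite unitrM vU; left | right].
Qed.

Hypothesis ufdR : ufd R.

(** Existence of factorizations, in the form in which it is used below: most
    facts about divisors of x follow by splitting off one irreducible factor. *)
Lemma ufd_ind (P : R -> Prop) :
  (forall u, u \is a GRing.unit -> P u) ->
  (forall p x, irreducible_elt p -> x != 0 -> P x -> P (p * x)) ->
  forall x, x != 0 -> P x.
Proof.
move=> Pu Pp x x0; have [/Pu //|xU] := boolP (x \is a GRing.unit).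
have [s sI ->] := ufdR.1 x x0 xU.
suff: \prod_(y <- s) y != 0 /\ P (\prod_(y <- s) y) by case.
elim: s sI => [|p s IH] sI; first by rewrite big_nil oner_neq0; split=> //; apply: Pu; rewrite unitr1.
have pI : irreducible_elt p by apply: sI; rewrite mem_head.
have [|s0 Ps] := IH; first by move=> y ys; apply: sI; rewrite in_cons ys orbT.
by rewrite big_cons mulf_neq0 ?(irr_neq0 pI) //; split=> //; exact: Pp.
Qed.

(** Uniqueness of factorizations enters only here: p occurs, up to a unit, in
    the concatenation of factorizations of x and y. *)
Lemma irr_prime p x y : irreducible_elt p -> dvd p (x * y) -> dvd p x \/ dvd p y.
Proof.
move=> pI [z e].
have [->|x0] := eqVneq x 0; first by left; exact: dvd0.
have [->|y0] := eqVneq y 0; first by right; exact: dvd0.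
have p0 := irr_neq0 pI.
have z0 : z != 0.
  by apply: contraNneq (mulf_neq0 x0 y0) => z0; rewrite e z0 mul0r.
have [xU|xU] := boolP (x \is a GRing.unit).
  by right; exists (x^-1 * z); rewrite -mulrA -e mulKr.
have [yU|yU] := boolP (y \is a GRing.unit).
  by left; exists (y^-1 * z); rewrite -mulrA -e mulrC mulrK.
have [s sI xE] := ufdR.1 x x0 xU; have [t tI yE] := ufdR.1 y y0 yU.
have [u uI [uE]] : exists2 u : seq R, (forall w, w \in u -> irreducible_elt w)
    & p * z = \prod_(w <- u) w /\ exists2 w, w \in u & dvd p w.
  have [zU|zU] := boolP (z \is a GRing.unit).
    exists [:: z * p]; last first.
      rewrite big_seq1 mulrC; split=> //; exists (z * p); first by rewrite mem_head.
      by exists z.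
    move=> w; rewrite inE => /eqP ->.
    by apply: irr_assoc pI _; exists z.
  have [u uI zE] := ufdR.1 z z0 zU; exists (p :: u).
    by move=> w; rewrite in_cons => /orP[/eqP -> //|/uI].
  rewrite big_cons zE; split=> //; exists p; first by rewrite mem_head.
  exact: dvd_refl.
move=> [w wu pw].
have stI v : v \in s ++ t -> irreducible_elt v.
  by rewrite mem_cat => /orP[/sI|/tI].
have [|sz [v' pv' va]] := ufdR.2 u (s ++ t) uI stI.
  by rewrite -uE big_cat /= -xE -yE e mulrC.
have wi : (index w u < size u)%N by rewrite index_mem.
have := va _ wi; rewrite nth_index // => wv.
have vst : v'`_(index w u) \in s ++ t.
  by rewrite (perm_mem pv') mem_nth // -(perm_size pv') -sz.
have pv : dvd p v'`_(index w u) by apply: dvd_trans pw (assoc_dvd wv).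
have dvdP (r : seq R) v : v \in r -> dvd v (\prod_(w <- r) w).
  move=> vr; rewrite (big_rem _ vr) /=; exists (\prod_(w <- rem v r) w).
  by rewrite mulrC.
move: vst; rewrite mem_cat => /orP[] /dvdP.
  by rewrite -xE => vx; left; exact: dvd_trans pv vx.
by rewrite -yE => vy; right; exact: dvd_trans pv vy.
Qed.

(** * Valuations at irreducible elements *)

(** The multiplicity of p in x when p is irreducible and x != 0. *)
Definition vp p x : nat := xget 0%N (fun n => dvd (p ^+ n) x /\ ~ dvd (p ^+ n.+1) x).

Lemma irr_exp_dvd_mul p n x y :
  irreducible_elt p -> ~ dvd p x -> dvd (p ^+ n) (x * y) -> dvd (p ^+ n) y.
Proof.
move=> pI px; elim: n y => [|n IH] y; first by rewrite expr0 => _; apply: unit_dvd; rewrite unitr1.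
move=> [c e]; have: dvd p (x * y) by exists (c * p ^+ n); rewrite e exprSr mulrA.
case/(irr_prime pI) => [/px //|[y' yE]].
have p0 := irr_neq0 pI.
have [] : dvd (p ^+ n) y'.
  apply: IH; exists c; apply: (mulIf p0).
  by rewrite -mulrA -yE e exprSr mulrA.
by move=> d y'E; exists d; rewrite yE y'E exprSr mulrA.
Qed.

Lemma irr_exp_bound p x :
  irreducible_elt p -> x != 0 -> exists N, forall n, dvd (p ^+ n) x -> (n <= N)%N.
Proof.
move=> pI; have p0 := irr_neq0 pI.
move: x; apply: ufd_ind => [u uU|q x qI x0 [N NP]].
  exists 0%N => -[//|n] [c e]; move: uU; rewrite e exprS !unitrM.
  by rewrite (negPf (irr_nunit pI)) andbF.
exists N.+1 => -[//|n] pn; rewrite ltnS.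
have [pq|npq] := pselect (dvd p q); last first.
  by apply: ltnW; apply: NP; apply: irr_exp_dvd_mul npq pn.
have [u uU qE] := irr_dvd_irr pI qI pq.
apply: NP; case: pn => c; rewrite qE exprS => e.
exists (u^-1 * c); apply: (mulfI p0).
apply: (mulrI uU); rewrite [LHS]mulrA e.
transitivity (u / u * (c * (p * p ^+ n))); first by rewrite mulrV // mul1r.
by ring.
Qed.

Lemma vpP p x : irreducible_elt p -> x != 0 ->
  dvd (p ^+ vp p x) x /\ ~ dvd (p ^+ (vp p x).+1) x.
Proof.
move=> pI x0; have [N NP] := irr_exp_bound pI x0.
rewrite /vp; case: xgetP => [n _ //|none]; exfalso.
have all n : dvd (p ^+ n) x.
  elim: n => [|n IH]; first by apply: unit_dvd; rewrite expr0 unitr1.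
  by apply: contrapT => h; exact: (none n).
by have := NP _ (all N.+1); rewrite ltnn.
Qed.

Lemma dvd_exp_le p n k x : (n <= k)%N -> dvd (p ^+ k) x -> dvd (p ^+ n) x.
Proof.
move=> nk; apply: dvd_trans; exists (p ^+ (k - n)).
by rewrite -exprD subnK.
Qed.

Lemma vp_geP p n x : irreducible_elt p -> x != 0 -> dvd (p ^+ n) x <-> (n <= vp p x)%N.
Proof.
move=> pI x0; have [h1 h2] := vpP pI x0; split=> [h|/dvd_exp_le]; last by apply.
by rewrite leqNgt; apply/negP => /dvd_exp_le /(_ h).
Qed.

Lemma vp_gt0P p x : irreducible_elt p -> x != 0 -> dvd p x <-> (0 < vp p x)%N.
Proof. by move=> pI x0; rewrite -(vp_geP 1 pI x0) expr1. Qed.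

Lemma vp_eq p n y : irreducible_elt p -> ~ dvd p y -> vp p (p ^+ n * y) = n.
Proof.
move=> pI py; have p0 := irr_neq0 pI.
have y0 : y != 0 by apply/eqP => y0; apply: py; rewrite y0; exact: dvd0.
have x0 : p ^+ n * y != 0 by rewrite mulf_neq0 ?expf_neq0.
apply/eqP; rewrite eqn_leq; apply/andP; split; last first.
  by apply/(vp_geP _ pI x0); exists y; rewrite mulrC.
rewrite leqNgt; apply/negP => /(vp_geP _ pI x0).
by rewrite exprSr dvd_mul2l ?expf_neq0.
Qed.

Lemma vp_split p x : irreducible_elt p -> x != 0 ->
  exists2 y, x = p ^+ vp p x * y & ~ dvd p y.
Proof.
move=> pI x0; have [[y xE] npx] := vpP pI x0.
exists y; first by rewrite {1}xE mulrC.
move=> [c yE]; apply: npx; exists c.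
by rewrite {1}xE {1}yE exprS mulrA.
Qed.

Lemma vpM p x y : irreducible_elt p -> x != 0 -> y != 0 ->
  vp p (x * y) = (vp p x + vp p y)%N.
Proof.
move=> pI x0 y0; have [x' xE px'] := vp_split pI x0; have [y' yE py'] := vp_split pI y0.
rewrite {1}xE {1}yE mulrACA -exprD vp_eq // => /(irr_prime pI).
by case.
Qed.

Lemma vp_unit p u : irreducible_elt p -> u \is a GRing.unit -> vp p u = 0%N.
Proof.
move=> pI uU; rewrite -[u]mul1r -(expr0 p) vp_eq // => /dvd_unit - /(_ uU).
exact/negP/irr_nunit.
Qed.

Lemma vp_irr p q : irreducible_elt p -> irreducible_elt q ->
  vp p q = `[< associated p q >] :> nat.
Proof.
move=> pI qI; case: asboolP => [[u uU ->]|npq].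
  rewrite mulrC -{2}(expr1 p) vp_eq //= => /dvd_unit - /(_ uU).
  exact/negP/irr_nunit.
apply/eqP; rewrite -leqn0 leqNgt; apply/negP => /(vp_gt0P pI (irr_neq0 qI)).
by move/(irr_dvd_irr pI qI).
Qed.

Lemma vpX p x n : irreducible_elt p -> x != 0 -> vp p (x ^+ n) = (n * vp p x)%N.
Proof.
move=> pI x0; elim: n => [|n IH]; first by rewrite expr0 vp_unit ?unitr1.
by rewrite exprS vpM ?expf_neq0 // IH mulSn.
Qed.

Lemma vp_dvd p x y : irreducible_elt p -> y != 0 -> dvd x y -> (vp p x <= vp p y)%N.
Proof.
move=> pI y0 xy; have x0 := dvd_neq0 xy y0; case: xy => c e.
have c0 : c != 0 by apply: contraNneq y0 => c0; rewrite e c0 mul0r.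
by rewrite e vpM // leq_addl.
Qed.

Lemma vp_assoc p x y : irreducible_elt p -> x != 0 -> associated x y -> vp p x = vp p y.
Proof.
move=> pI x0 [u uU ->].
have u0 : u != 0 by apply: contraTneq uU => ->; rewrite unitr0.
by rewrite vpM // (vp_unit pI uU).
Qed.

(** Divisibility can be tested one irreducible at a time, by induction on the
    factorization of the divisor. *)
Lemma vp_dvdP x y : x != 0 -> y != 0 ->
  (forall p, irreducible_elt p -> (vp p x <= vp p y)%N) -> dvd x y.
Proof.
move=> x0; move: x x0 y; apply: ufd_ind => [u uU y _ _|p x pI x0 IH y y0 le_xy].
  exact: unit_dvd.
have p0 := irr_neq0 pI.
have : dvd p y.
  apply/(vp_gt0P pI y0); apply: leq_trans (le_xy p pI).
  by apply/(vp_gt0P pI); [rewrite mulf_neq0 | exists x; rewrite mulrC].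
move=> [y' yE]; rewrite mulrC in yE.
have y'0 : y' != 0 by apply: contraNneq y0 => h; rewrite yE h mulr0.
rewrite yE; apply/(dvd_mul2l _ _ p0)/IH => // q qI.
by have := le_xy q qI; rewrite yE !vpM // leq_add2l.
Qed.

Lemma vp_assocP x y : x != 0 -> y != 0 ->
  (forall p, irreducible_elt p -> vp p x = vp p y) -> associated x y.
Proof. by move=> x0 y0 e; apply: dvd_assoc; apply: vp_dvdP => // p /e ->. Qed.

(** * Products of powers of pairwise non-associated irreducibles *)

Definition pprod r (p : 'I_r -> R) (j : 'I_r -> nat) : R := \prod_i p i ^+ j i.

Section PrimePowers.
Variables (r : nat) (p : 'I_r -> R).
Hypothesis pI : forall i, irreducible_elt (p i).
Hypothesis pN : forall i k, associated (p i) (p k) -> i = k.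

Lemma pprod_neq0 j : pprod p j != 0.
Proof. by apply/prodf_neq0 => i _; rewrite expf_neq0 ?irr_neq0. Qed.

Lemma vp_pprod q j : irreducible_elt q ->
  vp q (pprod p j) = (\sum_i j i * `[< associated q (p i) >])%N.
Proof.
move=> qI; rewrite /pprod.
have: \prod_i p i ^+ j i != 0 /\
    vp q (\prod_i p i ^+ j i) = (\sum_i j i * `[< associated q (p i) >])%N.
  apply: (big_rec2 (fun x n => x != 0 /\ vp q x = n)).
    by rewrite oner_neq0 vp_unit ?unitr1.
  move=> i n x _ [x0 e].
  have p0 : p i ^+ j i != 0 by rewrite expf_neq0 ?irr_neq0.
  by rewrite mulf_neq0 // vpM // vpX ?irr_neq0 // vp_irr // e.
by case.
Qed.

Lemma vp_pprod_at i j : vp (p i) (pprod p j) = j i.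
Proof.
rewrite vp_pprod // (bigD1 i) //= big1 ?addn0.
  by rewrite asboolT ?muln1 //; exact: assoc_refl.
move=> k ki; rewrite asboolF ?muln0 // => /pN e.
by rewrite e eqxx in ki.
Qed.

Lemma vp_pprod_out q j : irreducible_elt q -> (forall i, ~ associated q (p i)) ->
  vp q (pprod p j) = 0%N.
Proof. by move=> qI qN; rewrite vp_pprod // big1 // => i _; rewrite asboolF ?muln0. Qed.

(** Both sides have the same valuation at every irreducible. *)
Lemma pprod_factor x : x != 0 ->
  (forall q, irreducible_elt q -> dvd q x -> exists i, associated q (p i)) ->
  associated (pprod p (fun i => vp (p i) x)) x.
Proof.
move=> x0 xp; apply: vp_assocP => [||q qI] //; first exact: pprod_neq0.
have [[i qi]|nq] := pselect (exists i, associated q (p i)).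
  have vpqE y : y != 0 -> vp q y = vp (p i) y.
    move=> y0; have [qE piq] := (qi, assoc_sym qi).
    apply/eqP; rewrite eqn_leq; apply/andP; split.
      apply/vp_geP => //; apply: dvd_trans ((vpP qI y0).1).
      have [u uU ->] := piq; rewrite exprMn; exact: dvd_mull (dvd_refl _).
    apply/vp_geP => //; apply: dvd_trans ((vpP (pI i) y0).1).
    have [u uU ->] := qE; rewrite exprMn; exact: dvd_mull (dvd_refl _).
  by rewrite !vpqE ?pprod_neq0 // vp_pprod_at.
rewrite vp_pprod_out // => [|i qi]; last by apply: nq; exists i.
apply/esym/eqP; rewrite -leqn0 leqNgt; apply/negP => /(vp_gt0P qI x0).
by move/(xp q qI).
Qed.

Lemma pprod_split j j' : (forall i, j i <= j' i)%N ->
  pprod p j' = pprod p (fun i => j' i - j i)%N * pprod p j.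
Proof.
by move=> le_jj'; rewrite /pprod -big_split /=; apply: eq_bigr => i _; rewrite -exprD subnK.
Qed.

Lemma dvd_pprod j j' : dvd (pprod p j) (pprod p j') <-> (forall i, j i <= j' i)%N.
Proof.
split=> [d i|/pprod_split ->]; last by exists (pprod p (fun i => j' i - j i)%N).
by have := vp_dvd (pI i) (pprod_neq0 j') d; rewrite !vp_pprod_at.
Qed.

Lemma pprod_inj j j' : associated (pprod p j) (pprod p j') -> j =1 j'.
Proof.
by move=> a i; rewrite -(vp_pprod_at i j) (vp_assoc (pI i) (pprod_neq0 j) a) vp_pprod_at.
Qed.

Lemma pprodS s j j' : j' s = (j s).+1 -> (forall i, i != s -> j' i = j i) ->
  pprod p j' = p s * pprod p j.
Proof.
move=> e1 e2; rewrite /pprod (bigD1 s) // [X in _ = _ * X](bigD1 s) //= e1 exprS -mulrA.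
by congr (_ * (_ * _)); apply: eq_bigr => i /e2 ->.
Qed.

End PrimePowers.

(** * Content of a family of elements *)

Definition primitive (G : Type) (c : G -> R) : Prop :=
  forall p, irreducible_elt p -> exists g, ~ dvd p (c g).

(** A nonzero family is a multiple of a primitive one. The induction is on an
    element divisible by all common divisors of the family: an irreducible
    factor of it either divides the family, and is then taken out, or is
    irrelevant to the common divisors. *)
Lemma content (G : Type) (c : G -> R) g0 : c g0 != 0 ->
  exists h c', [/\ h != 0, forall g, c g = h * c' g & primitive c'].
Proof.
move=> c0.
suff key x : x != 0 -> forall c : G -> R, (forall d, (forall g, dvd d (c g)) -> dvd d x) ->
    exists h c', [/\ h != 0, forall g, c g = h * c' g & primitive c'].
  by apply: (key (c g0)).
move: x {c c0}; apply: ufd_ind => [u uU c cu|q x qI x0 IH c cqx].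
  exists 1, c; split=> [|g|p pI]; rewrite ?oner_neq0 ?mul1r //.
  apply: contrapT => npc; have/dvd_unit : dvd p u.
    by apply: cu => g; apply: contrapT => ndv; apply: npc; exists g.
  by move/(_ uU); rewrite (negPf (irr_nunit pI)).
have q0 := irr_neq0 qI.
have [qc|/existsNP[g1 nqc]] := pselect (forall g, dvd q (c g)).
  have [c1 c1E] : exists c1, forall g, c g = q * c1 g.
    have [c1 c1P] := choice qc; exists c1 => g; rewrite mulrC; exact: c1P.
  have [|h [c' [h0 e pr]]] := IH c1.
    move=> d dc1; apply/(dvd_mul2l _ _ q0)/cqx => g.
    by rewrite c1E dvd_mul2l.
  exists (q * h), c'; split=> //; first by rewrite mulf_neq0.
  by move=> g; rewrite c1E e mulrA.
apply: IH => d dc; have [e qxE] := cqx d dc.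
have nqd : ~ dvd q d by move=> qd; apply: nqc; exact: dvd_trans qd (dc g1).
have: dvd q (e * d) by exists x; rewrite -qxE mulrC.
case/(irr_prime qI) => [[e' eE]|//]; exists e'.
by apply: (mulfI q0); rewrite qxE eE mulrA [q * e']mulrC.
Qed.

(** An irreducible factor of y divides x * c g for all g, and by primitivity of
    c it divides x; cancel it and repeat. *)
Lemma primitive_dvd (G : Type) (c : G -> R) x y : primitive c -> y != 0 ->
  (forall g, dvd y (x * c g)) -> dvd y x.
Proof.
move=> cP y0; move: y y0 x; apply: ufd_ind => [u uU x _|p y pI y0 IH x yxc].
  exact: unit_dvd.
have [g npc] := cP p pI; have p0 := irr_neq0 pI.
have: dvd p (x * c g) by apply: dvd_trans (yxc g); exists y; rewrite mulrC.
case/(irr_prime pI) => // -[x' xE]; rewrite mulrC in xE.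
rewrite xE; apply/(dvd_mul2l _ _ p0)/IH => g'.
by apply/(dvd_mul2l _ _ p0); rewrite mulrA -xE.
Qed.

End Divisibility.

(** * Ideals and congruences *)

Section IdealFacts.
Variable R : comNzRingType.
Implicit Types (I J : ideal R) (x y z : R).

Lemma ideal0 I : (0 : R) \in I. Proof. exact: (@rpred0 _ I). Qed.

Lemma idealD I x y : x \in I -> y \in I -> x + y \in I.
Proof. exact: (@rpredD _ I). Qed.

Lemma idealN I x : x \in I -> - x \in I.
Proof. by move=> xI; rewrite -mulN1r; exact: (@rpredZ _ _ I). Qed.

Lemma idealB I x y : x \in I -> y \in I -> x - y \in I.
Proof. by move=> xI yI; apply: idealD => //; exact: idealN. Qed.

Lemma idealMl I x y : y \in I -> x * y \in I.
Proof. exact: (@rpredZ _ _ I). Qed.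

Lemma idealMr I x y : x \in I -> x * y \in I.
Proof. by rewrite mulrC; exact: idealMl. Qed.

Lemma ideal1_top I x : (1 : R) \in I -> x \in I.
Proof. by move=> I1; rewrite -[x]mulr1; exact: idealMl. Qed.

Lemma in_ideal_top x : x \in ideal_top R.
Proof. exact: (@in_mk_submod R R^o setT Logic.I _ x).2 Logic.I. Qed.

Lemma rpiM I x y : rpi I x * rpi I y = rpi I (x * y).
Proof. exact: rquot_mulE. Qed.

Lemma rpi_rel I (q : rquot I) x : q = rpi I x <-> repr q - x \in I.
Proof. by rewrite -rpi_eq rpi_repr. Qed.

Lemma repr_rpi I x : repr (rpi I x) - x \in I.
Proof. exact/rpi_rel. Qed.

(** The smallest ideal containing a family, as an intersection of ideals. *)
Definition family_ideal_set (T : Type) (f : T -> R) : set R :=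
  fun x => forall I, (forall t, f t \in I) -> x \in I.

Fact family_ideal0 T (f : T -> R) : family_ideal_set f 0.
Proof. by move=> I _; exact: ideal0. Qed.

Fact family_idealL T (f : T -> R) (a x y : R) :
  family_ideal_set f x -> family_ideal_set f y -> family_ideal_set f (a * x + y).
Proof. by move=> hx hy I fI; apply: idealD (hy _ fI); exact/idealMl/hx. Qed.

Definition family_ideal T (f : T -> R) : ideal R :=
  @mk_submod R R^o (family_ideal_set f) (@family_ideal0 T f) (@family_idealL T f).

Lemma in_family_ideal T (f : T -> R) x : x \in family_ideal f <-> family_ideal_set f x.
Proof. exact (@in_mk_submod R R^o (family_ideal_set f) _ _ x). Qed.

Lemma mem_family_ideal T (f : T -> R) t : f t \in family_ideal f.
Proof. by have [_ h] := in_family_ideal f (f t); apply: h => I. Qed.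

Lemma family_ideal_sub T (f : T -> R) I :
  {subset family_ideal f <= I} <-> forall t, f t \in I.
Proof.
split=> [sub t|fI x xf]; first exact/sub/mem_family_ideal.
by have [h _] := in_family_ideal f x; exact: h xf I fI.
Qed.

End IdealFacts.

Section PrincipalIdeals.
Variable R : idomainType.
Implicit Types (x y z : R).

Fact pideal0 x : dvd x 0. Proof. exact: dvd0. Qed.
Fact pidealL x (a y z : R) : dvd x y -> dvd x z -> dvd x (a * y + z).
Proof. by move=> xy xz; apply: dvd_add xz; exact: dvd_mull. Qed.

Definition pideal x : ideal R := @mk_submod R R^o (dvd x) (pideal0 x) (@pidealL x).

Lemma in_pideal x y : y \in pideal x <-> dvd x y.
Proof. exact (@in_mk_submod R R^o (dvd x) _ _ y). Qed.

Lemma pideal_sub x y : {subset pideal x <= pideal y} <-> dvd y x.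
Proof.
split=> [sub|yx z /in_pideal xz]; last exact/in_pideal/(dvd_trans yx).
by apply/in_pideal/sub/in_pideal; exact: dvd_refl.
Qed.

Lemma pideal_eq x y : pideal x = pideal y <-> associated x y.
Proof.
split=> [e|xy]; first by apply: dvd_assoc; apply/pideal_sub => z; rewrite e.
apply: submodP => z; apply/idP/idP; move: z; apply/pideal_sub; apply: assoc_dvd => //.
exact: assoc_sym.
Qed.

Lemma ideal_mul_pideal x y : ideal_mul (pideal x) (pideal y) = pideal (x * y).
Proof.
apply: submodP => z; apply/idP/idP.
  move: z; apply: ideal_mul_sub => a b /in_pideal[c ->] /in_pideal[d ->].
  by apply/in_pideal; exists (c * d); ring.
move=> /in_pideal[c ->]; rewrite mulrA.
by apply: mem_ideal_mul; apply/in_pideal; [exists c | exact: dvd_refl].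
Qed.

Lemma ideal_topE : ideal_top R = pideal 1.
Proof.
apply: submodP => z; rewrite in_ideal_top; apply/esym/in_pideal.
by apply: unit_dvd; rewrite unitr1.
Qed.

Lemma ideal_exp_pideal x n : ideal_exp (pideal x) n = pideal (x ^+ n).
Proof.
elim: n => [|n IH]; first by rewrite /ideal_exp /= ideal_topE.
by rewrite /ideal_exp iterS -/(ideal_exp _ _) IH ideal_mul_pideal exprS.
Qed.

Lemma ideal_prod_pideal r (p : 'I_r -> R) (P : 'I_r -> ideal R) (e : 'I_r -> nat) :
  (forall i, P i = pideal (p i)) ->
  \big[@ideal_mul R/ideal_top R]_(i < r) ideal_exp (P i) (e i) = pideal (pprod p e).
Proof.
move=> PE; rewrite /pprod; apply: (big_rec2 (fun I x => I = pideal x)).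
  exact: ideal_topE.
by move=> i x I _ ->; rewrite PE ideal_exp_pideal ideal_mul_pideal.
Qed.

(** * Height-one primes *)

Lemma primeIdeal_eq (p q : primeIdeal R) : p = q :> ideal R -> p = q.
Proof.
case: p q => [p p1 pM] [q q1 qM] /= e; case: q / e q1 qM => q1 qM.
by rewrite (Prop_irrelevance p1 q1) (Prop_irrelevance pM qM).
Qed.

Hypothesis ufdR : ufd R.

Fact irr_pideal1 pi : irreducible_elt pi -> (1 : R) \notin pideal pi.
Proof.
move=> piI; apply/negP => /in_pideal /dvd_unit; rewrite unitr1 => /(_ isT).
exact/negP/irr_nunit.
Qed.

Fact irr_pideal_prime pi : irreducible_elt pi -> prime_idealr_closed (pideal pi).
Proof.
move=> piI x y /in_pideal /(irr_prime ufdR piI)[] /in_pideal -> //.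
by rewrite orbT.
Qed.

Definition irr_primeIdeal pi (piI : irreducible_elt pi) : primeIdeal R :=
  PrimeIdeal (irr_pideal1 piI) (irr_pideal_prime piI).

Lemma prime_irr_mem (p : primeIdeal R) x : x != 0 -> x \in (p : ideal R) ->
  exists2 pi, irreducible_elt pi & pi \in (p : ideal R).
Proof.
move: x; apply: (ufd_ind ufdR) => [u uU|pi x piI x0 IH] xp.
  by case/negP: (prime_ideal1 p); rewrite -(mulVr uU); exact: idealMl.
have [pip|pip] := boolP (pi \in (p : ideal R)); first by exists pi.
apply: IH; apply: contraLR xp => xp; exact: prime_idealM.
Qed.

Fact zero_prime : prime_idealr_closed (pideal 0).
Proof.
move=> x y /in_pideal[c]; rewrite mulr0 => /eqP; rewrite mulf_eq0.
by case/orP => /eqP ->; rewrite ideal0 ?orbT.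
Qed.

Fact zero_prime1 : (1 : R) \notin pideal 0.
Proof. by apply/negP => /in_pideal[c]; rewrite mulr0 => /eqP; rewrite oner_eq0. Qed.

Definition zero_primeIdeal : primeIdeal R := PrimeIdeal zero_prime1 zero_prime.

Lemma irr_prime_height pi (piI : irreducible_elt pi) : height (irr_primeIdeal piI) 1.
Proof.
split=> [|k [c [ck cS]]].
  exists (fun i => if i is 0%N then zero_primeIdeal else irr_primeIdeal piI); split=> //.
  move=> [|//] _; split=> [x /in_pideal[d ->]|sub]; first by rewrite mulr0 ideal0.
  have /in_pideal[d] : pi \in pideal 0 by apply/sub/in_pideal; exact: dvd_refl.
  by rewrite mulr0 => /eqP; rewrite (negPf (irr_neq0 piI)).
rewrite leqNgt; apply/negP; case: k ck cS => [//|[//|k]] ck cS _.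
have [sub1 nsub1] := cS k.+1 (ltnSn _); rewrite ck in sub1 nsub1.
have [sub0 nsub0] := cS k (leqnSn _).
have npi : pi \notin (c k.+1 : ideal R).
  apply/negP => pic; apply: nsub1 => x /in_pideal[d ->]; exact: idealMl.
have [x [xc xk]] : exists x, x \in (c k.+1 : ideal R) /\ x \notin (c k : ideal R).
  apply: contrapT => h; apply: nsub0 => x xc; apply: contrapT => /negP xk.
  by apply: h; exists x.
have x0 : x != 0 by apply: contraNneq xk => ->; exact: ideal0.
have [y xE npy] := vp_split ufdR piI x0.
have: pi ^+ vp pi x * y \in (c k.+1 : ideal R) by rewrite -xE.
apply/negP/prime_idealM; last by apply/negP => /sub1 /in_pideal.
elim: (vp pi x) => [|n IH]; first by rewrite expr0; exact: prime_ideal1.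
by rewrite exprS; exact: prime_idealM.
Qed.

(** A height-one prime contains an irreducible factor pi of each of its nonzero
    elements, and cannot be larger than the nonzero prime (pi). Conversely, a
    nonzero element of a prime inside (pi) is a power of pi times an element
    outside (pi), so this prime contains pi. *)
Lemma height1P (p : primeIdeal R) : height p 1 <->
  exists2 pi, irreducible_elt pi & p = pideal pi :> ideal R.
Proof.
split=> [[[c [c1 cS]] pmax]|[pi piI pE]]; last first.
  have -> : p = irr_primeIdeal piI by exact: primeIdeal_eq.
  exact: irr_prime_height.
have [sub nsub] := cS 0%N isT; rewrite c1 in sub nsub.
have [x [xp xc]] : exists x, x \in (p : ideal R) /\ x \notin (c 0%N : ideal R).
  apply: contrapT => h; apply: nsub => x xp; apply: contrapT => /negP xk.
  by apply: h; exists x.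
have x0 : x != 0 by apply: contraNneq xc => ->; exact: ideal0.
have [pi piI pip] := prime_irr_mem x0 xp; exists pi => //.
apply: submodP => z; apply/idP/idP; last by move/in_pideal=> [d ->]; exact: idealMl.
move: z; apply: contrapT => nsub2.
suff: (2 <= 1)%N by [].
apply: pmax; exists (fun i => if i is 0%N then zero_primeIdeal else
                     if i is 1%N then irr_primeIdeal piI else p); split=> //.
move=> [|[|//]] _; split=> [z /in_pideal[d ->]|s01] //; first by rewrite mulr0 ideal0.
  have /in_pideal[d] : pi \in pideal 0 by apply/s01/in_pideal; exact: dvd_refl.
  by rewrite mulr0 => /eqP; rewrite (negPf (irr_neq0 piI)).
exact: idealMl.
Qed.

(** * Localization of an ideal at a height-one prime *)

Section LocalizedIdeal.
Variables (p : primeIdeal R) (pi : R).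
Hypotheses (piI : irreducible_elt pi) (pE : p = pideal pi :> ideal R).

Lemma mem_prime x : x \in (p : ideal R) <-> dvd pi x.
Proof. by rewrite pE; exact: in_pideal. Qed.

Lemma notin_prime x : x \notin (p : ideal R) <-> ~ dvd pi x.
Proof. by split=> [/negP h /mem_prime//|h]; apply/negP => /mem_prime. Qed.

Lemma loc_frac_subproof (a s : R) : s \notin (p : ideal R) -> a%:F / s%:F \in loc_pred p.
Proof. by move=> sp; apply/asboolP; exists a, s. Qed.

Definition loc_frac (a s : R) (sp : s \notin (p : ideal R)) : loc p :=
  exist _ (a%:F / s%:F) (loc_frac_subproof a sp).

Lemma frac_eq (a s b t : R) : s != 0 -> t != 0 ->
  a%:F / s%:F = b%:F / t%:F -> a * t = b * s.
Proof.
move=> s0 t0 /eqP; rewrite eqr_div ?tofrac_eq0 //.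
by rewrite -!tofracM tofrac_eq => /eqP.
Qed.

(** An element of J outside p becomes a unit of R_p. *)
Lemma ht1_supportP (J : ideal R) : ht1_support J p <-> {subset J <= p}.
Proof.
split=> [[_ JT] x xJ|sub].
  apply: contrapT => /negP xp; apply: JT; apply/seteqP; split=> // c _.
  have /asboolP[a [s [sp cE]]] := valP c.
  exists (a * x), (s * x); split; [exact: idealMl | exact: prime_idealM |].
  by rewrite !tofracM -mulf_div divff ?mulr1 // tofrac_eq0; exact: prime_ideal_neq0 xp.
split=> [|JT]; first by apply/height1P; exists pi.
have : loc_ideal p J (loc_frac 1 (prime_ideal1 p)) by rewrite JT.
case=> a [s [aJ sp /= e]].
have := frac_eq (oner_neq0 R) (prime_ideal_neq0 sp) e; rewrite mul1r mulr1 => sa.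
by move: sp; rewrite sa => /negP; apply; exact: sub.
Qed.

Lemma loc_ideal_exp n (c : loc p) : loc_ideal p (ideal_exp p n) c <->
  exists a s : R, [/\ dvd (pi ^+ n) a, s \notin (p : ideal R) & val c = a%:F / s%:F].
Proof.
split=> -[a [s [aP sp cE]]]; exists a, s; split=> //; move: aP;
  by rewrite pE ideal_exp_pideal => /in_pideal.
Qed.

(** The hypotheses give J_p = h R_p. *)
Lemma ord_locP (J : ideal R) (h u : R) n : h != 0 ->
  {subset J <= pideal h} -> h * u \in J -> ~ dvd pi u ->
  ord_loc p J n <-> n = vp pi h.
Proof.
move=> h0 Jh huJ npu.
have [h' hE nph'] := vp_split ufdR piI h0.
have p0 := irr_neq0 piI.
have key : loc_ideal p J = loc_ideal p (ideal_exp p (vp pi h)).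
  apply/seteqP; split=> c.
    case=> a [s [/Jh/in_pideal ha sp cE]]; apply/loc_ideal_exp; exists a, s; split=> //.
    by apply: dvd_trans ha; exists h'; rewrite {1}hE mulrC.
  case/loc_ideal_exp=> a [s [[a' aE] sp cE]]; exists (a' * (h * u)), (s * (h' * u)).
  have h'u : h' * u \notin (p : ideal R) by apply: prime_idealM; exact/notin_prime.
  split; [exact: idealMl | exact: prime_idealM |].
  have s0 := prime_ideal_neq0 sp; have t0 := prime_ideal_neq0 (prime_idealM sp h'u).
  rewrite cE aE; apply/eqP; rewrite eqr_div ?tofrac_eq0 //.
  by rewrite -!tofracM tofrac_eq {2}hE; apply/eqP; ring.
rewrite /ord_loc key; split=> [|-> //].
have half i j : loc_ideal p (ideal_exp p i) = loc_ideal p (ideal_exp p j) -> (j <= i)%N.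
  move=> e.
  have : loc_ideal p (ideal_exp p i) (loc_frac (pi ^+ i) (prime_ideal1 p)).
    by apply/loc_ideal_exp; exists (pi ^+ i), 1; rewrite prime_ideal1; split=> //; exact: dvd_refl.
  rewrite e => /loc_ideal_exp[a [s [pa sp /= e2]]].
  have := frac_eq (oner_neq0 R) (prime_ideal_neq0 sp) e2; rewrite mulr1 => aE.
  have nps : ~ dvd pi s by apply/notin_prime.
  have := pa; rewrite -aE => /(vp_geP ufdR _ piI); rewrite vp_eq //; apply.
  by rewrite mulf_neq0 ?expf_neq0 // (prime_ideal_neq0 sp).
by move=> e; apply/eqP; rewrite eqn_leq half ?half.
Qed.

End LocalizedIdeal.

(** * Finite enumerations of height-one primes *)

Lemma enumerates_add (T : Type) (N : T -> Prop) r (p : 'I_r -> T) a :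
  enumerates N p -> exists r' (p' : 'I_r' -> T), enumerates (fun q => q = a \/ N q) p'.
Proof.
move=> [pinj pN]; have [Na|Na] := pselect (N a).
  by exists r, p; split=> // q; rewrite -pN; split=> [[->|//]|]; [|right].
have pa i : p i <> a by move=> e; apply: Na; apply/pN; exists i.
exists r.+1, (fun i => if unlift ord0 i is Some k then p k else a); split.
  move=> i k; case: unliftP => [i' ->|->]; case: unliftP => [k' ->|->] //.
  - by move=> /pinj ->.
  - by move/pa.
  - by move/esym/pa.
move=> q; rewrite pN; split=> [[->|[i <-]]|[i <-]].
- by exists ord0; rewrite unlift_none.
- by exists (lift ord0 i); rewrite liftK.
- by case: unliftP => [k _|_]; [right; exists k | left].
Qed.

Lemma enumerates_ext (T : Type) (N N' : T -> Prop) r (p : 'I_r -> T) :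
  (forall q, N q <-> N' q) -> enumerates N p -> enumerates N' p.
Proof. by move=> NN' [pinj pN]; split=> // q; rewrite -NN'. Qed.

(** The height-one primes containing x are those generated by the irreducible
    factors of x. *)
Lemma enumerate_prime_divisors x : x != 0 -> exists r (p : 'I_r -> primeIdeal R),
  enumerates (fun q => height q 1 /\ x \in (q : ideal R)) p.
Proof.
move: x; apply: (ufd_ind ufdR) => [u uU|pi x piI x0 [r [p pP]]].
  exists 0%N, (fun i : 'I_0 => False_rect _ (notF (ltn_ord i))); split=> [[]//|q].
  split=> [[_ uq]|[[]//]]; case/negP: (prime_ideal1 q).
  by rewrite -(mulVr uU); exact: idealMl.
have [r' [p' p'P]] := enumerates_add (irr_primeIdeal piI) pP.
exists r', p'; apply: enumerates_ext p'P => q.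
split=> [[->|[q1 xq]]|[q1 xq]].
- split; first exact: irr_prime_height.
  by apply/in_pideal; exists x; rewrite mulrC.
- by split=> //; exact: idealMl.
have [xq'|xq'] := boolP (x \in (q : ideal R)); first by right.
have piq : pi \in (q : ideal R) by apply: contraLR xq => h; exact: prime_idealM.
left; apply/primeIdeal_eq => /=.
have [w wI qE] := (height1P q).1 q1; rewrite qE; apply/pideal_eq.
by apply: irr_dvd_irr => //; apply/in_pideal; rewrite -qE.
Qed.

Lemma enumerate_generators (N : primeIdeal R -> Prop) r (P : 'I_r -> primeIdeal R) :
  (forall q, N q -> height q 1) -> enumerates N P ->
  exists p : 'I_r -> R, [/\ forall i, irreducible_elt (p i),
    forall i k, associated (p i) (p k) -> i = k &
    forall i, P i = pideal (p i) :> ideal R].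
Proof.
move=> N1 [Pinj PN].
have /choice[p pP] : forall i, exists x, irreducible_elt x /\ P i = pideal x :> ideal R.
  move=> i; have [|x xI e] := (height1P (P i)).1; last by exists x.
  by apply/N1/PN; exists i.
exists p; split=> [i|i k /pideal_eq e|i]; try by case: (pP i).
by apply/Pinj/primeIdeal_eq; rewrite (pP i).2 (pP k).2.
Qed.

End PrincipalIdeals.

(** * Complete local rings *)

Section CompleteLocal.
Variables (R : idomainType) (m : ideal R).
Hypotheses (locR : local_ring m) (complR : adic_complete m).

Lemma ideal_expS (I : ideal R) n : ideal_exp I n.+1 = ideal_mul I (ideal_exp I n).
Proof. by []. Qed.

Lemma ideal_expW (I : ideal R) n : {subset ideal_exp I n.+1 <= ideal_exp I n}.
Proof. by rewrite ideal_expS; apply: ideal_mul_sub => a b _; exact: idealMl. Qed.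

Lemma ideal_exp_le (I : ideal R) i j :
  (i <= j)%N -> {subset ideal_exp I j <= ideal_exp I i}.
Proof.
elim: j => [|j IH]; first by rewrite leqn0 => /eqP ->.
rewrite leq_eqVlt => /orP[/eqP -> //|]; rewrite ltnS => /IH sub x /ideal_expW; exact: sub.
Qed.

Lemma mem_ideal_exp1 (I : ideal R) x : x \in I -> x \in ideal_exp I 1.
Proof. by move=> xI; rewrite -[x]mulr1 ideal_expS mem_ideal_mul ?in_ideal_top. Qed.

Lemma mem_ideal_expX (I : ideal R) x n : x \in I -> x ^+ n \in ideal_exp I n.
Proof.
move=> xI; elim: n => [|n IH]; first exact: in_ideal_top.
by rewrite exprS ideal_expS mem_ideal_mul.
Qed.

Lemma adic_limit (u : nat -> R) : (forall n, u n.+1 - u n \in ideal_exp m n) ->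
  exists l, forall n, u n - l \in ideal_exp m n.
Proof.
move=> uS.
have uC n k : u (n + k)%N - u n \in ideal_exp m n.
  elim: k => [|k IH]; first by rewrite addn0 subrr; exact: ideal0.
  have -> : u (n + k.+1)%N - u n = (u (n + k).+1 - u (n + k)%N) + (u (n + k)%N - u n).
    by rewrite addnS; ring.
  by apply: idealD => //; apply: ideal_exp_le (uS _); rewrite leq_addr.
have [n|l lP] := complR.2 u.
  exists n => i j ni nj.
  have -> : u i - u j = (u (n + (i - n))%N - u n) - (u (n + (j - n))%N - u n).
    by rewrite !subnKC //; ring.
  exact: idealB.
exists l => n; have [N NP] := lP n.
have -> : u n - l = (u (n + N)%N - l) - (u (n + N)%N - u n) by ring.
by apply: idealB => //; apply: NP; exact: leq_addl.
Qed.

Lemma adic_eq0 x : (forall n, x \in ideal_exp m n) -> x = 0.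
Proof. exact: complR.1. Qed.

(** The geometric series converges, so 1 - z is invertible for z in m. *)
Lemma unit_1sub z : z \in m -> 1 - z \is a GRing.unit.
Proof.
move=> zm; have [|l lP] := @adic_limit (fun n => \sum_(i < n) z ^+ i).
  by move=> n; rewrite big_ord_recr /= addrAC subrr add0r; exact: mem_ideal_expX.
apply/unitrP; exists l; rewrite mulrC; split; apply/eqP; rewrite -subr_eq0;
  apply/eqP/adic_eq0 => n.
all: rewrite (_ : _ - 1 = - ((1 - z) * (\sum_(i < n) z ^+ i - l)) - z ^+ n);
  first by apply: idealB (mem_ideal_expX _ zm); apply/idealN/idealMl.
all: have/eqP := subrX1 z n; rewrite subr_eq => /eqP ->; ring.
Qed.

Fact msum0 (x : R) : (fun y => exists a b, a \in m /\ y = a + b * x) 0.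
Proof. by exists 0, 0; rewrite ideal0 mul0r addr0. Qed.

Fact msumL (x a y z : R) : (fun y => exists a b, a \in m /\ y = a + b * x) y ->
  (fun y => exists a b, a \in m /\ y = a + b * x) z ->
  (fun y => exists a b, a \in m /\ y = a + b * x) (a * y + z).
Proof.
move=> [c [d [cm ->]]] [c' [d' [c'm ->]]]; exists (a * c + c'), (a * d + d').
by split; [apply: idealD => //; exact: idealMl | ring].
Qed.

(** For x outside m the ideal m + R x is the whole ring, so a multiple of x has
    the form 1 - a with a in m; completeness then makes x a unit. *)
Lemma mem_local x : x \in m <-> x \isn't a GRing.unit.
Proof.
have [[m1 mmax] _] := locR; split=> [xm|xU].
  by apply: contra m1 => xU; rewrite -(mulVr xU); exact: idealMl.
pose I : ideal R := @mk_submod R R^o _ (msum0 x) (@msumL x).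
have memI y : y \in I <-> exists a b, a \in m /\ y = a + b * x.
  exact (@in_mk_submod R R^o _ _ _ y).
have mI : {subset m <= I}.
  by move=> a am; apply/memI; exists a, 0; rewrite mul0r addr0.
have xI : x \in I by apply/memI; exists 0, 1; rewrite ideal0 mul1r add0r.
have [/memI[a [b [am e]]]|I1] := boolP ((1 : R) \in I).
  have /unit_1sub : a \in m := am.
  have -> : 1 - a = b * x by rewrite {1}e addrAC subrr add0r.
  by rewrite unitrM (negPf xU) andbF.
by rewrite -(mmax I mI I1).
Qed.

Lemma notin_local x : x \notin m <-> x \is a GRing.unit.
Proof.
split=> [/negP h|xU]; first by apply: contrapT => /negP /mem_local.
by apply/negP => /mem_local; rewrite xU.
Qed.

(** Newton iteration with the fixed slope 2v; each step gains one power of m. *)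
Lemma sqrt_lift (D v : R) : (2%:R * v : R) \is a GRing.unit -> v ^+ 2 - D \in m ->
  exists s, s ^+ 2 = D.
Proof.
move=> vU Dm; pose y := (2%:R * v)^-1; have yV : 2%:R * v * y = 1 by rewrite mulrV.
pose x n := iter n (fun x => x - (x ^+ 2 - D) * y) v.
have xP n : x n - v \in m /\ x n ^+ 2 - D \in ideal_exp m n.+1.
  elim: n => [|n [xv xD]]; first by rewrite subrr; split; [exact: ideal0 | exact: mem_ideal_exp1].
  have xDm : x n ^+ 2 - D \in m.
    by have := ideal_exp_le (isT : 1 <= n.+1)%N xD; move: (x n ^+ 2 - D); apply: ideal_mul_sub => a b am _; exact: idealMr.
  have xS : x n.+1 = x n - (x n ^+ 2 - D) * y by [].
  split.
    have -> : x n.+1 - v = (x n - v) - (x n ^+ 2 - D) * y by rewrite xS; ring.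
    by apply: idealB => //; exact: idealMr.
  have -> : x n.+1 ^+ 2 - D = (- (2%:R * y) * (x n - v)) * (x n ^+ 2 - D)
      + ((x n ^+ 2 - D) * y ^+ 2) * (x n ^+ 2 - D).
    rewrite xS; transitivity ((x n ^+ 2 - D) * (2%:R * v * y - 2%:R * x n * y) +
      ((x n ^+ 2 - D) * y ^+ 2) * (x n ^+ 2 - D)); last by ring.
    by rewrite yV; ring.
  rewrite [ideal_exp _ _]ideal_expS -/(ideal_exp _ n.+1).
  by apply: idealD; apply: mem_ideal_mul => //; [apply: idealMl | apply: idealMr].
have [|l lP] := @adic_limit x.
  move=> n; have -> : x n.+1 - x n = - (y * (x n ^+ 2 - D)) by rewrite /x /=; ring.
  by apply/idealN/idealMl; apply: ideal_expW; exact: (xP n).2.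
exists l; apply/eqP; rewrite -subr_eq0; apply/eqP/adic_eq0 => n.
have -> : l ^+ 2 - D = (x n ^+ 2 - D) - (x n + l) * (x n - l) by ring.
by apply: idealB; [apply: ideal_expW; exact: (xP n).2 | apply: idealMl].
Qed.

End CompleteLocal.

(** * Lengths of modules *)

Section Length.
Variables (A : pzRingType) (M : lmodType A) (k : nat) (F : nat -> submodClosed M).

(** For a filtration with simple factors, the number of factors that meet a
    submodule increases strictly with the submodule: this bounds every chain. *)
Lemma mlength_filtration :
  (forall x, x \in F 0%N -> x = 0) -> (forall x, x \in F k) ->
  (forall i, (i < k)%N -> psub (F i) (F i.+1)) ->
  (forall i x y, (i < k)%N -> x \in F i.+1 -> y \in F i.+1 -> y \notin F i ->
     exists r, x - r *: y \in F i) ->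
  mlength M = k.
Proof.
move=> F0 Fk Fpsub Fsimple.
have Fchain : submod_chain M k by exists F.
pose meets (N : submodClosed M) i := exists x, [/\ x \in N, x \in F i.+1 & x \notin F i].
pose len N := (\sum_(i < k) `[< meets N i >])%N.
have len_le (N N' : submodClosed M) : {subset N <= N'} -> (len N <= len N')%N.
  move=> NN'; apply: leq_sum => i _; case: asboolP => // -[x [xN xF xF']].
  by rewrite asboolT //; exists x; split=> //; exact: NN'.
have len_lt (N N' : submodClosed M) : psub N N' -> (len N < len N')%N.
  move=> [NN' nN'N]; rewrite ltnNge; apply/negP => le; apply: nN'N.
  have meetsE (i : 'I_k) : meets N' i -> meets N i.
    move=> N'i; apply: contrapT => nNi; move: le; apply/negP; rewrite -ltnNge.
    rewrite /len (bigD1 i) //= [X in (_ < X)%N](bigD1 i) //= asboolF // asboolT //.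
    rewrite add0n add1n ltnS; apply: leq_sum => j _; case: asboolP => // -[x [xN xF xF']].
    by rewrite asboolT //; exists x; split=> //; exact: NN'.
  have key i : (i <= k)%N -> forall x, x \in N' -> x \in F i -> x \in N.
    elim: i => [_ x _ /F0 ->|i IH ik x xN' xF]; first exact: rpred0.
    have [xFi|xFi] := boolP (x \in F i); first exact: IH (ltnW ik) _ xN' xFi.
    have [|y [yN yF yFi]] := meetsE (Ordinal ik); first by exists x.
    have [r rP] := Fsimple i x y ik xF yF yFi.
    rewrite -(subrK (r *: y) x); apply: rpredD; last exact: rpredZ.
    by apply: IH (ltnW ik) _ _ rP; rewrite -scaleNr; apply: rpredD => //; apply/rpredZ/NN'.
  by move=> x xN'; exact: key (leqnn k) _ xN' (Fk x).
have bound n : submod_chain M n -> (n <= k)%N.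
  move=> [c cS]; have : (n <= len (c n))%N.
    elim: n cS => // n IH cS; apply: leq_ltn_trans (len_lt _ _ (cS n (ltnSn n))).
    by apply: IH => i /ltnW; exact: cS.
  move/leq_trans; apply; rewrite /len -[X in (_ <= X)%N](card_ord k) -sum1_card.
  by apply: leq_sum => i _; case: asboolP.
rewrite /mlength; case: xgetP => [n _ [nchain nmax]|none].
  by apply/eqP; rewrite eqn_leq bound //= nmax.
by case: (none k); split.
Qed.

End Length.

Section LocalLength.
Variables (R : idomainType) (p : primeIdeal R) (M : lmodType R).
Variables (k : nat) (L : nat -> submodClosed M).
Hypothesis Lsat : forall i (s : R) x, s \notin (p : ideal R) -> s *: x \in L i -> x \in L i.

Definition mloc_sub_set i : set (mloc p M) :=
  fun q => exists x s, x \in L i /\ q = mk_mloc x s.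

Fact mloc_sub0 i : mloc_sub_set i 0.
Proof. by exists 0, (pcompl1 p); split=> //; exact: rpred0. Qed.

Fact mloc_subL i (c : loc p) q r :
  mloc_sub_set i q -> mloc_sub_set i r -> mloc_sub_set i (c *: q + r).
Proof.
move=> [x [s [xL ->]]] [y [t [yL ->]]].
rewrite [c *: _](mloc_scaleE _ _ (loc_numden c)) [_ + _]mloc_addE.
exists (val t *: (loc_num c *: x) + val (pcompl_mul (loc_den c) s) *: y).
by eexists; split; [apply: rpredD; do ?apply: rpredZ | reflexivity].
Qed.

Definition mloc_sub i : submodClosed (mloc p M) :=
  mk_submod (@mloc_sub0 i) (@mloc_subL i).

Lemma in_mloc_sub i x s : mk_mloc x s \in mloc_sub i <-> x \in L i.
Proof.
have [h1 h2] := @in_mk_submod _ _ _ (@mloc_sub0 i) (@mloc_subL i) (mk_mloc x s).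
split=> [/h1[y [t [yL /mk_mloc_eq[u up e]]]]|xL]; last by apply: h2; exists x, s.
by apply: (Lsat (valP t)); apply: (Lsat up); rewrite e; do 2!apply: rpredZ.
Qed.

(** A filtration by p-saturated submodules whose factors become simple after
    localization computes the length at p. *)
Lemma mlength_mloc :
  (forall x, x \in L 0%N -> exists2 s : R, s \notin (p : ideal R) & s *: x = 0) ->
  (forall x, x \in L k) ->
  (forall i, (i < k)%N -> psub (L i) (L i.+1)) ->
  (forall i x y, (i < k)%N -> x \in L i.+1 -> y \in L i.+1 -> y \notin L i ->
     exists s r : R, s \notin (p : ideal R) /\ s *: x - r *: y \in L i) ->
  mlength (mloc p M) = k.
Proof.
move=> L0 Lk Lpsub Lsimple; apply: (mlength_filtration (F := mloc_sub)).
- move=> q; have [x [s ->]] := mlocP q => /in_mloc_sub/L0[t tp tx0].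
  by apply/mk_mloc_eq; exists t; rewrite // !scaler0 scalerA mulrC -scalerA tx0 scaler0.
- by move=> q; have [x [s ->]] := mlocP q; apply/in_mloc_sub.
- move=> i /Lpsub[sub nsub]; split=> [q|sub'].
    by have [x [s ->]] := mlocP q => /in_mloc_sub xL; apply/in_mloc_sub/sub.
  by apply: nsub => x xL; apply/(in_mloc_sub _ _ (pcompl1 p))/sub'/in_mloc_sub.
move=> i q r ik; have [x [s ->]] := mlocP q; have [y [t ->]] := mlocP r.
move=> /in_mloc_sub xL /in_mloc_sub yL yLi.
have {}yLi : y \notin L i by apply: contra yLi => h; apply/in_mloc_sub.
have [e [a [ep h]]] := Lsimple i x y ik xL yL yLi.
have dp : val s * e \notin (p : ideal R) by apply: prime_idealM ep; exact: (valP s).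
pose d : pcompl p := exist (fun s : R => s \notin (p : ideal R)) _ dp.
pose c : loc p := loc_frac (a * val t) dp.
exists c.
have -> : c *: mk_mloc y t = mk_mloc ((a * val t) *: y) (pcompl_mul d t).
  exact: (@mloc_scaleE _ _ _ c _ d).
have -> : - mk_mloc ((a * val t) *: y) (pcompl_mul d t) =
    mk_mloc (- ((a * val t) *: y)) (pcompl_mul d t) by exact: mloc_oppE.
rewrite [_ + _]mloc_addE; apply/in_mloc_sub; rewrite !pcompl_mulE -[val d]/(val s * e).
rewrite (_ : _ + _ = (val s * val t) *: (e *: x - a *: y)); first exact: rpredZ.
rewrite scalerBr !scalerA scalerN scalerA.
by congr (_ *: _ - _ *: _); ring.
Qed.

End LocalLength.

(** * The module R/x + R/y *)

Section TwoGenerators.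
Variables (R : idomainType) (M : lmodType R) (f1 f2 : M) (x y : R).
Hypotheses (ufdR : ufd R) (x0 : x != 0) (y0 : y != 0).
Hypothesis fgen : forall z, exists a b, z = a *: f1 + b *: f2.
Hypothesis frel : forall a b, a *: f1 + b *: f2 = 0 <-> dvd x a /\ dvd y b.

Section AtPrime.
Variables (p : primeIdeal R) (pi : R).
Hypotheses (piI : irreducible_elt pi) (pE : p = pideal pi :> ideal R).

Definition layer_set (e e' : nat) : set M :=
  fun z => exists a b, [/\ dvd (pi ^+ e) a, dvd (pi ^+ e') b & z = a *: f1 + b *: f2].

Fact layer0 e e' : layer_set e e' 0.
Proof. by exists 0, 0; rewrite !scale0r addr0; split=> //; exact: dvd0. Qed.

Fact layerL e e' c z z' :
  layer_set e e' z -> layer_set e e' z' -> layer_set e e' (c *: z + z').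
Proof.
move=> [a [b [pa pb ->]]] [a' [b' [pa' pb' ->]]]; exists (c * a + a'), (c * b + b').
split; try by apply: dvd_add => //; exact: dvd_mull.
by rewrite scalerDr !scalerA !scalerDl addrACA.
Qed.

Definition layer e e' : submodClosed M := mk_submod (@layer0 e e') (@layerL e e').

Lemma in_layer e e' a b : (e <= vp pi x)%N -> (e' <= vp pi y)%N ->
  a *: f1 + b *: f2 \in layer e e' <-> dvd (pi ^+ e) a /\ dvd (pi ^+ e') b.
Proof.
move=> ex ey.
have [h1 h2] := @in_mk_submod _ _ _ (@layer0 e e') (@layerL e e') (a *: f1 + b *: f2).
split=> [/h1[a' [b' [pa pb e1]]]|[pa pb]]; last by apply: h2; exists a, b.
have /frel[xa yb] : (a - a') *: f1 + (b - b') *: f2 = 0.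
  by rewrite !scalerBl addrACA -opprD e1 subrr.
rewrite -[a](subrK a') -[b](subrK b').
have px := (vp_geP ufdR _ piI x0).2 ex; have py := (vp_geP ufdR _ piI y0).2 ey.
by split; apply: dvd_add => //; [apply: dvd_trans xa | apply: dvd_trans yb].
Qed.

(** Lowering the pair of exponents (e, e') from (vp pi x, vp pi y) to (0, 0) one
    unit at a time, the first exponent before the second, the layers give a
    filtration of R/x + R/y whose factors are simple at p. *)
Lemma mlength_two_generators : mlength (mloc p M) = (vp pi x + vp pi y)%N.
Proof.
set k := vp pi x; set l := vp pi y.
have npP s : s \notin (p : ideal R) <-> ~ dvd pi s by exact (notin_prime pE s).
have pi0 := irr_neq0 piI.
pose e i := (k - i)%N; pose e' i := (l - (i - k))%N.
have eP i : (e i <= k)%N by exact: leq_subr.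
have e'P i : (e' i <= l)%N by exact: leq_subr.
have inL i a b : a *: f1 + b *: f2 \in layer (e i) (e' i) <->
    dvd (pi ^+ e i) a /\ dvd (pi ^+ e' i) b by apply: in_layer.
(* each step lowers exactly one of the two exponents, by one *)
have eS i : (i < k + l)%N ->
    (e i = (e i.+1).+1 /\ e' i = e' i.+1) \/ (e i = e i.+1 /\ e' i = (e' i.+1).+1).
  rewrite /e /e' => ikl; have [ik|ki] := ltnP i k; [left|right].
    by rewrite subnSK // (eqP (ltnW ik : i - k == 0)%N) (eqP (ik : i.+1 - k == 0)%N).
  rewrite (eqP (ki : k - i == 0)%N) (eqP (leqW ki : k - i.+1 == 0)%N); split=> //.
  by rewrite subSn // subnSK // ltn_subLR.
apply: (mlength_mloc (L := fun i => layer (e i) (e' i))) => [i s z|z|z|i|i z z'].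
- move=> /npP nps; have [a [b ->]] := fgen z.
  rewrite scalerDr !scalerA => /inL[pa pb]; apply/inL.
  by split; [apply: irr_exp_dvd_mul pa | apply: irr_exp_dvd_mul pb].
- have [a [b ->]] := fgen z => /inL; rewrite /e /e' subn0 sub0n subn0 => -[[a' ->] [b' ->]].
  have [x' xE px'] := vp_split ufdR piI x0; have [y' yE py'] := vp_split ufdR piI y0.
  exists (x' * y'); first by apply: prime_idealM; apply/npP.
  rewrite scalerDr !scalerA; apply/frel; split; rewrite ?[X in dvd X _]xE ?[X in dvd X _]yE.
    by exists (y' * a'); rewrite -/k; ring.
  by exists (x' * b'); rewrite -/l; ring.
- have [a [b ->]] := fgen z; apply/inL.
  rewrite /e /e' addKn subnn (eqP (leq_addr l k : k - (k + l) == 0)%N) expr0.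
  by split; apply: unit_dvd; rewrite unitr1.
- move=> ikl; split=> [z|sub].
    have [a [b ->]] := fgen z => /inL[pa pb]; apply/inL.
    by case: (eS i ikl) => -[E E']; rewrite E in pa; rewrite E' in pb; split;
      rewrite // ?E ?E'; [apply: dvd_exp_le pa | apply: dvd_exp_le pb].
  have nS n : ~ dvd (pi ^+ n.+1) (pi ^+ n).
    rewrite -[X in dvd _ X]mulr1 exprSr dvd_mul2l ?expf_neq0 // => /dvd_unit.
    by rewrite unitr1 (negPf (irr_nunit piI)) => /(_ isT).
  case: (eS i ikl) => -[E E'].
    have /sub/inL[] : pi ^+ e i.+1 *: f1 + 0 *: f2 \in layer (e i.+1) (e' i.+1).
      by apply/inL; split; [exact: dvd_refl | exact: dvd0].
    by rewrite E => /nS.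
  have /sub/inL[_] : 0 *: f1 + pi ^+ e' i.+1 *: f2 \in layer (e i.+1) (e' i.+1).
    by apply/inL; split; [exact: dvd0 | exact: dvd_refl].
  by rewrite E' => /nS.
move=> ikl; have [a [b ->]] := fgen z; have [c [d ->]] := fgen z'.
move=> /inL[[a' ->] [b' ->]] /inL[[c' ->] [d' ->]] /negP nL.
have expand s r u v u' v' : s *: (u *: f1 + v *: f2) - r *: (u' *: f1 + v' *: f2) =
    (s * u - r * u') *: f1 + (s * v - r * v') *: f2.
  by rewrite !scalerDr !scalerA opprD addrACA -!scalerBl.
case: (eS i ikl) => -[E E'].
  exists c', a'; split.
    apply/npP => -[c2 c2E]; apply: nL; apply/inL; rewrite E E' c2E.
    by split; [exists c2; rewrite exprS mulrA | exists d'].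
  rewrite expand; apply/inL; split.
    by rewrite (_ : _ - _ = 0); [exact: dvd0 | ring].
  by rewrite E'; exists (c' * b' - a' * d'); ring.
exists d', b'; split.
  apply/npP => -[d2 d2E]; apply: nL; apply/inL; rewrite E E' d2E.
  by split; [exists c' | exists d2; rewrite exprS mulrA].
rewrite expand; apply/inL; split.
  by rewrite E; exists (d' * a' - b' * c'); ring.
by rewrite (_ : _ - _ = 0); [exact: dvd0 | ring].
Qed.

End AtPrime.

(** The length at a height-one prime is the valuation of x * y, so the product
    that defines the characteristic ideal is the factorization of x * y. *)
Lemma char_ideal_two_generators (I : ideal R) :
  is_char_ideal M I <-> I = pideal (x * y).
Proof.
have xy0 : x * y != 0 by rewrite mulf_neq0.
have lenE (q : primeIdeal R) pi : irreducible_elt pi -> q = pideal pi :> ideal R ->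
    mlength (mloc q M) = vp pi (x * y).
  by move=> piI qE; rewrite (mlength_two_generators piI qE) vpM.
have suppE (q : primeIdeal R) : height q 1 /\ x * y \in (q : ideal R) <->
    height q 1 /\ mlength (mloc q M) <> 0%N.
  split=> -[q1 h]; split=> //; have [pi piI qE] := (height1P ufdR q).1 q1.
    move: h; rewrite (lenE q pi) // qE => /in_pideal /(vp_gt0P ufdR piI xy0).
    by move=> h e; rewrite e in h.
  rewrite qE; apply/in_pideal/(vp_gt0P ufdR piI xy0).
  by move: h; rewrite (lenE q pi) // => /eqP; rewrite lt0n.
have charE r (p : 'I_r -> primeIdeal R) :
    enumerates (fun q => height q 1 /\ mlength (mloc q M) <> 0%N) p ->
    \big[@ideal_mul R/ideal_top R]_(i < r) ideal_exp (p i) (mlength (mloc (p i) M)) =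
    pideal (x * y).
  move=> pN; have [|w [wI wN wE]] := enumerate_generators ufdR _ pN; first by move=> q [].
  rewrite (ideal_prod_pideal _ wE); apply/pideal_eq.
  have -> : (fun i => mlength (mloc (p i) M)) = (fun i => vp (w i) (x * y)).
    by apply/funext => i; rewrite (lenE _ (w i)).
  apply: pprod_factor => // q qI qxy.
  have [|i pq] := (pN.2 (irr_primeIdeal ufdR qI)).1.
    by apply/suppE; split; [exact: irr_prime_height | apply/in_pideal].
  by exists i; apply/pideal_eq; rewrite -wE pq.
split=> [[r [p [pN ->]]]|->]; first exact: charE.
have [r [p pN]] := enumerate_prime_divisors ufdR xy0.
have pN' := enumerates_ext suppE pN.
by exists r, p; split=> //; rewrite charE.
Qed.

End TwoGenerators.

(** * Frames of a two-dimensional space *)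

Section Frames.
Variables (K : fieldType) (V : vectType K).

Record frame := Frame {
  fe1 : V; fe2 : V; fk1 : V -> K; fk2 : V -> K;
  frameE : forall v, v = fk1 v *: fe1 + fk2 v *: fe2;
  frameK1 : forall x y, fk1 (x *: fe1 + y *: fe2) = x;
  frameK2 : forall x y, fk2 (x *: fe1 + y *: fe2) = y
}.

Section FrameTheory.
Variable F : frame.
Local Notation e1 := (fe1 F).
Local Notation e2 := (fe2 F).
Local Notation k1 := (fk1 F).
Local Notation k2 := (fk2 F).

Lemma fk_eq u v : k1 u = k1 v -> k2 u = k2 v -> u = v.
Proof. by move=> h1 h2; rewrite (frameE F u) h1 h2 -frameE. Qed.

Lemma frame_lin a u v : a *: u + v = (a * k1 u + k1 v) *: e1 + (a * k2 u + k2 v) *: e2.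
Proof.
by rewrite {1}(frameE F u) {1}(frameE F v) scalerDr !scalerA !scalerDl addrACA.
Qed.

Lemma fk1L a u v : k1 (a *: u + v) = a * k1 u + k1 v.
Proof. by rewrite frame_lin frameK1. Qed.

Lemma fk2L a u v : k2 (a *: u + v) = a * k2 u + k2 v.
Proof. by rewrite frame_lin frameK2. Qed.

Lemma fk10 : k1 0 = 0.
Proof. by have := frameK1 F 0 0; rewrite !scale0r addr0. Qed.

Lemma fk20 : k2 0 = 0.
Proof. by have := frameK2 F 0 0; rewrite !scale0r addr0. Qed.

Lemma fk1Z a u : k1 (a *: u) = a * k1 u.
Proof. by rewrite -[a *: u]addr0 fk1L fk10 addr0. Qed.

Lemma fk2Z a u : k2 (a *: u) = a * k2 u.
Proof. by rewrite -[a *: u]addr0 fk2L fk20 addr0. Qed.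

Lemma fk1D u v : k1 (u + v) = k1 u + k1 v.
Proof. by rewrite -[u]scale1r fk1L mul1r scale1r. Qed.

Lemma fk2D u v : k2 (u + v) = k2 u + k2 v.
Proof. by rewrite -[u]scale1r fk2L mul1r scale1r. Qed.

Lemma fk1e1 : k1 e1 = 1.
Proof. by have := frameK1 F 1 0; rewrite scale1r scale0r ?addr0 ?add0r. Qed.

Lemma fk2e1 : k2 e1 = 0.
Proof. by have := frameK2 F 1 0; rewrite scale1r scale0r ?addr0 ?add0r. Qed.

Lemma fk1e2 : k1 e2 = 0.
Proof. by have := frameK1 F 0 1; rewrite scale1r scale0r ?addr0 ?add0r. Qed.

Lemma fk2e2 : k2 e2 = 1.
Proof. by have := frameK2 F 0 1; rewrite scale1r scale0r ?addr0 ?add0r. Qed.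

Lemma fe1_neq0 : e1 != 0.
Proof. by apply/eqP => h; have := fk1e1; rewrite h fk10 => /esym/eqP; rewrite oner_eq0. Qed.

Lemma frame_swap_subproof v : v = k2 v *: e2 + k1 v *: e1.
Proof. by rewrite addrC -frameE. Qed.

Definition frame_swap : frame := @Frame e2 e1 k2 k1 frame_swap_subproof
  (fun x y => etrans (congr1 k2 (addrC _ _)) (frameK2 F y x))
  (fun x y => etrans (congr1 k1 (addrC _ _)) (frameK1 F y x)).

Lemma frame_scale_exists (x y : K) : x != 0 -> y != 0 ->
  exists F' : frame, [/\ fe1 F' = x *: e1, fe2 F' = y *: e2,
    forall v, fk1 F' v = k1 v / x & forall v, fk2 F' v = k2 v / y].
Proof.
move=> x0 y0.
have h v : v = (k1 v / x) *: (x *: e1) + (k2 v / y) *: (y *: e2).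
  by rewrite !scalerA !divfK // -frameE.
have h1 a b : k1 (a *: (x *: e1) + b *: (y *: e2)) / x = a.
  by rewrite !scalerA frameK1 mulfK.
have h2 a b : k2 (a *: (x *: e1) + b *: (y *: e2)) / y = b.
  by rewrite !scalerA frameK2 mulfK.
by exists (Frame h h1 h2).
Qed.

(** The left-hand side is the trace in the basis b: it is computed by expanding
    the values of f in the frame and the vectors of the frame in b. *)
Lemma sum_coord_frame n (b : n.-tuple V) (f : 'End(V)) : basis_of fullv b ->
  \sum_i coord b i (f b`_i) = k1 (f e1) + k2 (f e2).
Proof.
move=> bB.
have lin (phi : V -> K) : (forall a u v, phi (a *: u + v) = a * phi u + phi v) ->
    forall u, \sum_i coord b i u * phi (f b`_i) = phi (f u).
  move=> phiL u; have phi0 : phi 0 = 0.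
    by have := phiL (-1) 0 0; rewrite scaler0 addr0 mulN1r addNr.
  rewrite {2}(coord_basis bB (memvf u)) linear_sum.
  apply: (big_ind2 (fun x v => x = phi v)) => [|x1 v1 x2 v2 -> ->|i _].
  - by rewrite phi0.
  - by rewrite -[v1]scale1r phiL mul1r scale1r.
  - by rewrite linearZ /=; have := phiL (coord b i u) (f b`_i) 0; rewrite !addr0 phi0 addr0 => ->.
rewrite -(lin k1 fk1L e1) -(lin k2 fk2L e2) -big_split /=; apply: eq_bigr => i _.
by rewrite {1}(frameE F (f b`_i)) linearD !linearZ /= mulrC [X in _ + X]mulrC.
Qed.

End FrameTheory.

Lemma frame_of_free (u v : V) : \dim (fullv : {vspace V}) = 2%N ->
  free [:: u; v] -> exists F : frame, fe1 F = u /\ fe2 F = v.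
Proof.
move=> dim2 fr; pose b := [tuple u; v].
have bB : basis_of fullv b by rewrite basisEfree fr subvf dim2.
have h w : w = coord b 0 w *: u + coord b 1 w *: v.
  rewrite {1}(coord_basis bB (memvf w)) !big_ord_recl big_ord0 addr0.
  by rewrite (_ : lift ord0 ord0 = 1) //; exact: val_inj.
have inj x y x' y' : x *: u + y *: v = x' *: u + y' *: v -> x = x' /\ y = y'.
  move=> e; have /freeP fb := fr.
  have := fb (fun i => if i == 0 then x - x' else y - y').
  rewrite !big_ord_recl big_ord0 /= addr0 !scalerBl addrACA -opprD e subrr.
  move=> /(_ erefl) k; split; apply/eqP; rewrite -subr_eq0; apply/eqP.
    exact: (k 0).
  exact: (k 1).
have h1 x y : coord b 0 (x *: u + y *: v) = x by have [] := inj _ _ _ _ (h (x *: u + y *: v)).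
have h2 x y : coord b 1 (x *: u + y *: v) = y by have [] := inj _ _ _ _ (h (x *: u + y *: v)).
by exists (Frame h h1 h2).
Qed.

Lemma frame_exists : \dim (fullv : {vspace V}) = 2%N -> inhabited frame.
Proof.
move=> dim2; have := vbasisP (fullv : {vspace V}); case/andP => _.
have := size_tuple (vbasis (fullv : {vspace V})); rewrite [RHS]dim2.
case: (tval _) => [//|u [//|v [|//]]] _ fr.
by have [F _] := frame_of_free dim2 fr.
Qed.

(** An endomorphism with trace l1 + l2 and discriminant (l1 - l2)^2 <> 0 is
    diagonalizable with eigenvalues l1, l2: by Cayley-Hamilton the image of
    f - l2 consists of eigenvectors for l1, and it is nonzero. *)
Lemma eigenframe (F : frame) (f : 'End(V)) (l1 l2 : K) :
  \dim (fullv : {vspace V}) = 2%N -> (2%:R : K) != 0 -> l1 != l2 ->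
  let t g := fk1 F (g (fe1 F)) + fk2 F (g (fe2 F)) in
  l1 + l2 = t f -> (l1 - l2) ^+ 2 = 2%:R * t (f \o f)%VF - t f ^+ 2 ->
  exists F' : frame, f (fe1 F') = l1 *: fe1 F' /\ f (fe2 F') = l2 *: fe2 F'.
Proof.
move=> dim2 two0 l12 t; rewrite /t !comp_lfunE => {t}.
set e1 := fe1 F; set e2 := fe2 F; set k1 := fk1 F; set k2 := fk2 F.
set a := k1 (f e1); set d := k2 (f e2); set c := k2 (f e1); set b := k1 (f e2).
have fe1E : f e1 = a *: e1 + c *: e2 by exact: frameE.
have fe2E : f e2 = b *: e1 + d *: e2 by exact: frameE.
have lin x y : f (x *: e1 + y *: e2) = (x * a + y * b) *: e1 + (x * c + y * d) *: e2.
  by rewrite linearD !linearZ /= fe1E fe2E !scalerDr !scalerA !scalerDl addrACA.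
rewrite {1}fe1E {1}fe2E !lin /k1 /k2 frameK1 frameK2 => tE DE.
have aE : a = k1 (f e1) by []. have dE0 : d = k2 (f e2) by [].
clearbody a b c d.
have dE : l1 * l2 = a * d - b * c.
  have e4 : 4%:R * (l1 * l2 - (a * d - b * c)) = 0.
    have -> : 4%:R * (l1 * l2 - (a * d - b * c)) =
      (l1 + l2) ^+ 2 - (l1 - l2) ^+ 2 - 4%:R * (a * d - b * c) by ring.
    by rewrite DE tE; ring.
  have two4 : (4%:R : K) = 2%:R * 2%:R by ring.
  by apply/eqP; rewrite -subr_eq0; move/eqP: e4; rewrite two4 !mulf_eq0 (negPf two0).
have CH v : f (f v) = (l1 + l2) *: f v - (l1 * l2) *: v.
  suff CH' x y : f (f (x *: e1 + y *: e2)) =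
      (l1 + l2) *: f (x *: e1 + y *: e2) - (l1 * l2) *: (x *: e1 + y *: e2).
    by rewrite (frameE F v); exact: CH'.
  rewrite !lin -scaleNr; apply: (@fk_eq F).
    by rewrite frameK1 [RHS]fk1L fk1Z !frameK1 tE dE; ring.
  by rewrite frameK2 [RHS]fk2L fk2Z !frameK2 tE dE; ring.
have eig l l' : l + l' = l1 + l2 -> l * l' = l1 * l2 -> l != l' ->
    exists2 v, v != 0 & f v = l *: v.
  move=> lD lM ll'.
  have eigv v : f (f v - l' *: v) = l *: (f v - l' *: v).
    rewrite linearB linearZ /= CH -lD -lM scalerBr scalerA scalerDl.
    by rewrite addrAC -[X in X - _ = _]addrA subrr addr0.
  have [z1|nz1] := eqVneq (f e1 - l' *: e1) 0; last by exists (f e1 - l' *: e1).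
  have [z2|nz2] := eqVneq (f e2 - l' *: e2) 0; last by exists (f e2 - l' *: e2).
  case/negP: ll'; have a1 : a = l'.
    by move/eqP: z1; rewrite subr_eq0 aE => /eqP ->; rewrite /k1 fk1Z fk1e1 mulr1.
  have d1 : d = l'.
    by move/eqP: z2; rewrite subr_eq0 dE0 => /eqP ->; rewrite /k2 fk2Z fk2e2 mulr1.
  by apply/eqP/(addIr l'); rewrite lD tE a1 d1.
have [|||v1 v10 v1E] := eig l1 l2 => //.
have [|||v2 v20 v2E] := eig l2 l1; rewrite 1?addrC 1?mulrC 1?eq_sym //.
suff fr : free [:: v1; v2].
  by have [F' [E1 E2]] := frame_of_free dim2 fr; exists F'; rewrite E1 E2.
have dl : l1 - l2 != 0 by rewrite subr_eq0.
have indep x y : x *: v1 + y *: v2 = 0 -> x = 0.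
  move=> e; have : (l1 - l2) *: (x *: v1) = 0.
    have e' : l1 *: (x *: v1) = - (l2 *: (y *: v2)).
      apply/eqP; rewrite -addr_eq0; apply/eqP; have := congr1 f e.
      by rewrite linearD !linearZ /= v1E v2E linear0 => <-.
    have e'' : l2 *: (x *: v1) = - (l2 *: (y *: v2)).
      by apply/eqP; rewrite -addr_eq0 -scalerDr e scaler0.
    by rewrite scalerBl e' e'' subrr.
  by move=> /eqP; rewrite !scaler_eq0 (negPf dl) (negPf v10) orbF => /eqP.
apply/(@freeP _ _ 2 [tuple v1; v2]) => k; rewrite !big_ord_recl big_ord0 /= addr0 => e.
have k0 := indep _ _ e.
have k1' : k 1 = 0.
  move: e; rewrite (_ : lift ord0 ord0 = 1); last exact: val_inj.
  by rewrite k0 scale0r add0r => /eqP; rewrite scaler_eq0 (negPf v20) orbF => /eqP.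
move=> i; case: (unliftP ord0 i) => [j ->|-> //].
by rewrite (_ : lift ord0 j = 1) //; apply: val_inj; rewrite [j]ord1.
Qed.

End Frames.

Lemma trace_frame (R : idomainType) (V : vectType {fraction R}) (F : frame V) (f : 'End(V)) :
  trace_end f = fk1 F (f (fe1 F)) + fk2 F (f (fe2 F)).
Proof.
rewrite -(sum_coord_frame F f (vbasisP _)) /trace_end /mxtrace; apply: eq_bigr => i _.
by rewrite /passmx.mxof mxE /= passmx.vecof_delta mxE.
Qed.

(** * Divisibility in the field of fractions *)

Section Fractions.
Variable R : idomainType.
Local Notation K := {fraction R}.
Implicit Types (x y z : K) (r s : R).

Lemma frac_numden z : exists n d : R, d != 0 /\ z = n%:F / d%:F.
Proof.
elim/quotW: z => q; exists (frac q).1, (frac q).2.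
have d0 : (frac q).2 != 0 by exact: denom_ratioP.
have dF0 : ((frac q).2)%:F != 0 by rewrite tofrac_eq0.
split=> //; apply: (mulIf dF0); rewrite divfK //.
unlock FracField.tofrac; rewrite -[LHS]FracField.pi_mul; apply/eqmodP => /=.
rewrite FracField.equivfE /FracField.mulf !numden_Ratio ?oner_neq0 ?mulr1 //.
by rewrite mulrC.
Qed.

Lemma common_denominator n (k : 'I_n -> K) : exists2 s : R, s != 0 &
  exists r : 'I_n -> R, forall i, (r i)%:F = s%:F * k i.
Proof.
have /choice[nd ndP] : forall i, exists p : R * R, p.2 != 0 /\ k i = p.1%:F / p.2%:F.
  by move=> i; have [a [d [d0 e]]] := frac_numden (k i); exists (a, d).
exists (\prod_i (nd i).2); first by apply/prodf_neq0 => i _; case: (ndP i).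
exists (fun i => (nd i).1 * \prod_(j | j != i) (nd j).2) => i.
have [d0 ->] := ndP i; rewrite [X in _ = X%:F * _](bigD1 i) //= !tofracM.
by rewrite [RHS]mulrAC; congr (_ * _); rewrite mulrC divfK ?tofrac_eq0.
Qed.

(** z lies in the fractional ideal R x. *)
Definition fdvd x z : Prop := exists r, z = r%:F * x.

Lemma fdvd_refl x : fdvd x x.
Proof. by exists 1; rewrite tofrac1 mul1r. Qed.

Lemma fdvd0 x : fdvd x 0.
Proof. by exists 0; rewrite tofrac0 mul0r. Qed.

Lemma fdvdL x r z z' : fdvd x z -> fdvd x z' -> fdvd x (r%:F * z + z').
Proof.
by move=> [a ->] [b ->]; exists (r * a + b); rewrite tofracD tofracM mulrDl mulrA.
Qed.

Lemma fdvdM x r z : fdvd x z -> fdvd x (r%:F * z).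
Proof. by move=> [a ->]; exists (r * a); rewrite tofracM mulrA. Qed.

Lemma fdvd_trans x y z : fdvd x y -> fdvd y z -> fdvd x z.
Proof. by move=> [a ->] [b ->]; exists (b * a); rewrite tofracM mulrA. Qed.

Lemma fdvd_tofrac r s : fdvd r%:F s%:F <-> dvd r s.
Proof.
split=> -[c e]; exists c; last by rewrite e tofracM.
by apply/eqP; rewrite -tofrac_eq tofracM e.
Qed.

Lemma fdvd_mul2l y x z : y != 0 -> fdvd (y * x) (y * z) <-> fdvd x z.
Proof.
move=> y0; split=> -[c e]; exists c; last by rewrite e mulrCA.
by apply: (mulfI y0); rewrite e mulrCA.
Qed.

Lemma fdvd_unit_eq x z : fdvd x z -> fdvd z x -> x != 0 ->
  exists2 u, u \is a GRing.unit & z = u%:F * x.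
Proof.
move=> [a zE] [b xE] x0; exists a => //; apply/unitrP; exists b.
have e : b * a = 1.
  by apply/eqP; rewrite -tofrac_eq; apply/eqP/(mulIf x0); rewrite tofracM -mulrA -zE -xE tofrac1 mul1r.
by rewrite [a * b]mulrC e.
Qed.

(** If z = n / d, then d divides n c(g) for all g, hence divides n. *)
Lemma primitive_fdvd (G : Type) (c : G -> R) z : ufd R -> primitive c ->
  (forall g, fdvd 1 (z * (c g)%:F)) -> fdvd 1 z.
Proof.
move=> ufdR cP zc; have [n [d [d0 zE]]] := frac_numden z.
have dF0 : d%:F != 0 :> K by rewrite tofrac_eq0.
have [|r nE] := primitive_dvd ufdR (x := n) cP d0.
  move=> g; have [r e] := zc g; exists r; apply/eqP.
  rewrite -tofrac_eq; apply/eqP; rewrite !tofracM -[r%:F]mulr1 -e zE.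
  by rewrite mulrAC divfK.
by exists r; rewrite zE nE tofracM mulfK // mulr1.
Qed.

End Fractions.

(** * Coordinates of stable free lattices *)

Section Lattices.
Variables (R : idomainType) (V : vectType {fraction R}) (G : groupType).
Variable rho : G -> 'End(V).
Local Notation K := {fraction R}.
Implicit Types (F : frame V) (T : sflattice rho).

Lemma rmodZ (r : R) (v : V) : r *: (v : rmod V) = (r%:F *: v : V) :> V.
Proof. by []. Qed.

Definition in_box F (x y : K) (v : V) : Prop := fdvd x (fk1 F v) /\ fdvd y (fk2 F v).

Definition is_box F (T : submodClosed (rmod V)) (x y : K) : Prop :=
  forall v : V, (v : rmod V) \in T <-> in_box F x y v.

Lemma in_box1 F x y a : in_box F x y (a *: fe1 F) <-> fdvd x a.
Proof.
rewrite /in_box fk1Z fk2Z fk1e1 fk2e1 mulr0 mulr1.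
by split=> [[]//|h]; split=> //; exact: fdvd0.
Qed.

Lemma in_box2 F x y a : in_box F x y (a *: fe2 F) <-> fdvd y a.
Proof.
rewrite /in_box fk1Z fk2Z fk1e2 fk2e2 mulr0 mulr1.
by split=> [[]//|h]; split=> //; exact: fdvd0.
Qed.

Fact box0 F x y : in_box F x y (0 : rmod V).
Proof. by rewrite /in_box fk10 fk20; split; exact: fdvd0. Qed.

Fact boxL F x y (r : R) (u v : rmod V) :
  in_box F x y u -> in_box F x y v -> in_box F x y (r *: u + v).
Proof.
by move=> [u1 u2] [v1 v2]; split; rewrite ?fk1L ?fk2L; exact: fdvdL.
Qed.

Definition box F x y : submodClosed (rmod V) :=
  @mk_submod R (rmod V) (in_box F x y) (@box0 F x y) (@boxL F x y).

Lemma box_is_box F x y : is_box F (box F x y) x y.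
Proof. by move=> v; exact (@in_mk_submod R (rmod V) _ _ _ v). Qed.

Definition box_gen F x y (i : 'I_2) : rmod V :=
  if i == 0 then x *: fe1 F else y *: fe2 F.

Lemma box_gens F (T : submodClosed (rmod V)) x y : is_box F T x y -> forall v : rmod V, v \in T <->
  exists c : 'I_2 -> R, v = \sum_i c i *: box_gen F x y i.
Proof.
move=> TB v; rewrite TB; split=> [[[r1 e1] [r2 e2]]|[c ->]].
  exists (fun i => if i == 0 then r1 else r2); rewrite !big_ord_recl big_ord0 /= addr0.
  by rewrite !rmodZ !scalerA -e1 -e2 -frameE.
rewrite !big_ord_recl big_ord0 /= addr0 !rmodZ !scalerA /in_box frameK1 frameK2.
by split; apply: fdvdM; exact: fdvd_refl.
Qed.

Lemma box_lattice F (T : submodClosed (rmod V)) x y : x != 0 -> y != 0 -> is_box F T x y -> is_lattice T.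
Proof.
move=> x0 y0 TB; split.
  by exists 2%N, (box_gen F x y); exact: box_gens TB.
move=> v; exists 2%N, (fun i => if i == 0 then fk1 F v / x else fk2 F v / y).
exists (box_gen F x y); split=> [i|].
  by rewrite /box_gen; case: ifP => _; apply/TB; [apply/in_box1 | apply/in_box2]; exact: fdvd_refl.
by rewrite !big_ord_recl big_ord0 /= addr0 !scalerA !divfK // -frameE.
Qed.

Lemma box_free F (T : submodClosed (rmod V)) x y : x != 0 -> y != 0 -> is_box F T x y -> free_submod T.
Proof.
move=> x0 y0 TB; exists 2%N, (box_gen F x y).
split=> [|c]; first exact: box_gens TB.
rewrite !big_ord_recl big_ord0 /= addr0 !rmodZ !scalerA => e.
have c0 : c 0 = 0.
  have := congr1 (fk1 F) e; rewrite frameK1 fk10 => /eqP.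
  by rewrite mulf_eq0 (negPf x0) orbF tofrac_eq0 => /eqP.
have c1 : c (lift ord0 ord0) = 0.
  have := congr1 (fk2 F) e; rewrite frameK2 fk20 => /eqP.
  by rewrite mulf_eq0 (negPf y0) orbF tofrac_eq0 => /eqP.
by move=> i; case: (unliftP ord0 i) => [j ->|->] //; rewrite [j]ord1.
Qed.

Lemma sub_box F (T T' : submodClosed (rmod V)) x y x' y' :
  is_box F T x y -> is_box F T' x' y' ->
  {subset T <= T'} <-> fdvd x' x /\ fdvd y' y.
Proof.
move=> TB TB'; split=> [sub|[xx yy] v /TB[h1 h2]]; last first.
  by apply/TB'; split; [exact: fdvd_trans h1 | exact: fdvd_trans h2].
split.
  apply/(in_box1 F x' y')/TB'/sub/TB/in_box1; exact: fdvd_refl.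
apply/(in_box2 F x' y')/TB'/sub/TB/in_box2; exact: fdvd_refl.
Qed.

Lemma homothety_box F (T S : sflattice rho) (x y x' y' : K) : x != 0 ->
  is_box F T x y -> is_box F S x' y' ->
  homothety_class T S <-> exists2 z : K, z != 0 &
    [/\ fdvd x' (z * x), fdvd (z * x) x', fdvd y' (z * y) & fdvd (z * y) y'].
Proof.
move=> x0 TB SB; split=> -[z z0 zP]; exists z => //.
  have zT (v : V) : (v : rmod V) \in sfl_mod T -> (z *: v : rmod V) \in sfl_mod S.
    by move=> vT; apply/zP; exists v.
  have zS (v : V) : (v : rmod V) \in sfl_mod S -> (z^-1 *: v : rmod V) \in sfl_mod T.
    by move=> /zP[t tT ->]; rewrite scalerA mulVf // scale1r.
  split.
  - apply/(in_box1 F x' y')/SB; rewrite -scalerA; apply/zT/TB/in_box1; exact: fdvd_refl.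
  - rewrite -(fdvd_mul2l _ _ (invr_neq0 z0)) mulKf //.
    apply/(in_box1 F x y)/TB; rewrite -scalerA; apply/zS/SB/in_box1; exact: fdvd_refl.
  - apply/(in_box2 F x' y')/SB; rewrite -scalerA; apply/zT/TB/in_box2; exact: fdvd_refl.
  - rewrite -(fdvd_mul2l _ _ (invr_neq0 z0)) mulKf //.
    apply/(in_box2 F x y)/TB; rewrite -scalerA; apply/zS/SB/in_box2; exact: fdvd_refl.
case: zP => h1 h2 h3 h4 v; rewrite SB; split=> [[v1 v2]|[t /TB[t1 t2] ->]].
  exists (z^-1 *: v); last by rewrite scalerA mulfV // scale1r.
  apply/TB; rewrite /in_box fk1Z fk2Z; split.
    by rewrite -(fdvd_mul2l _ _ z0) mulVKf //; exact: fdvd_trans v1.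
  by rewrite -(fdvd_mul2l _ _ z0) mulVKf //; exact: fdvd_trans v2.
rewrite /in_box fk1Z fk2Z; split.
  by apply: fdvd_trans h1 _; apply/fdvd_mul2l.
by apply: fdvd_trans h3 _; apply/fdvd_mul2l.
Qed.

(** An R-basis of a lattice is a K-basis of the space, so it has two elements. *)
Lemma free_lattice_gens (T : submodClosed (rmod V)) :
  \dim (fullv : {vspace V}) = 2%N -> is_lattice T -> free_submod T ->
  exists b0 b1 : V,
    (forall v : V, (v : rmod V) \in T <-> exists r s : R, v = r%:F *: b0 + s%:F *: b1) /\
    (forall v : V, exists x y : K, v = x *: b0 + y *: b1).
Proof.
move=> dim2 [_ Tspan] [n [b [bspan bfree]]].
pose B : n.-tuple V := [tuple (b i : V) | i < n].
have BE (i : 'I_n) : B`_i = b i by rewrite -tnth_nth tnth_mktuple.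
have BV : (<<B>> = fullv)%VS.
  apply/eqP; rewrite eqEsubv subvf; apply/subvP => v _.
  have [k [c [t [tT ->]]]] := Tspan v; apply: memv_suml => i _; apply: memvZ.
  have [r ->] := (bspan _).1 (tT i).
  apply: (big_ind (fun v : V => v \in <<B>>%VS)) => [|u w|j _]; [exact: mem0v | exact: memvD |].
  by rewrite rmodZ; apply/memvZ/memv_span; rewrite -BE mem_nth // size_tuple.
have BF : free B.
  apply/freeP => k k0 i; have [s s0 [r rE]] := common_denominator k.
  have sF0 : s%:F != 0 :> K by rewrite tofrac_eq0.
  have r0 : \sum_i r i *: b i = 0.
    transitivity (s%:F *: (\sum_i k i *: B`_i)); last by rewrite k0 scaler0.
    by rewrite scaler_sumr; apply: eq_bigr => j _; rewrite rmodZ rE scalerA BE.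
  have := rE i; rewrite (bfree r r0 i) tofrac0 => /esym/eqP.
  by rewrite mulf_eq0 (negPf sF0) => /eqP.
have n2 : n = 2%N.
  by have /eqP := BF; rewrite BV dim2 size_tuple.
have Bb : basis_of fullv B by rewrite /basis_of BV eqxx.
subst n; exists (b 0), (b 1); split=> v.
  rewrite bspan; split=> [[c ->]|[r [s ->]]].
    exists (c 0), (c 1); rewrite !big_ord_recl big_ord0 addr0 !rmodZ.
    by rewrite (_ : lift ord0 ord0 = 1) //; exact: val_inj.
  exists (fun i => if i == 0 then r else s); rewrite !big_ord_recl big_ord0 addr0 /= !rmodZ.
  by rewrite (_ : lift ord0 ord0 = 1) //; exact: val_inj.
exists (coord B 0 v), (coord B 1 v).
rewrite {1}(coord_basis Bb (memvf v)) !big_ord_recl big_ord0 addr0.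
rewrite (_ : lift ord0 ord0 = 1) ; last exact: val_inj.
by rewrite !BE.
Qed.

(** The p i j are the entries of a projector of R^2; A and B are the coordinates
    of the two basis vectors along its image and along its kernel. If one of
    1 - p00, p01, 1 - p11, p10 is a unit, it solves one of the relations for A.
    Otherwise p is congruent to the identity modulo the maximal ideal, hence
    invertible, and then its kernel is zero. *)
Lemma local_generator (A0 A1 B0 B1 : K) (p00 p01 p10 p11 : R) :
  (forall x y : R, x + y \is a GRing.unit -> x \is a GRing.unit \/ y \is a GRing.unit) ->
  A0 = p00%:F * A0 + p01%:F * A1 -> A1 = p10%:F * A0 + p11%:F * A1 ->
  0 = p00%:F * B0 + p01%:F * B1 -> 0 = p10%:F * B0 + p11%:F * B1 ->
  ~ (B0 = 0 /\ B1 = 0) -> fdvd A0 A1 \/ fdvd A1 A0.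
Proof.
move=> locU eA0 eA1 eB0 eB1 nB.
have uF (u : R) : u \is a GRing.unit -> u%:F != 0 :> K.
  by move=> uU; rewrite tofrac_eq0; apply: contraTneq uU => ->; rewrite unitr0.
have solve (u s : R) (x y : K) : u \is a GRing.unit -> u%:F * x = s%:F * y -> fdvd y x.
  move=> uU e; exists (u^-1 * s); apply: (mulfI (uF u uU)).
  by rewrite e mulrA -tofracM mulVKr.
have e0 : (1 - p00)%:F * A0 = p01%:F * A1.
  by rewrite tofracB tofrac1 mulrBl mul1r {1}eA0 addrAC subrr add0r.
have e1 : (1 - p11)%:F * A1 = p10%:F * A0.
  by rewrite tofracB tofrac1 mulrBl mul1r {1}eA1 addrK.
have [u|n00] := boolP (1 - p00 \is a GRing.unit); first by right; exact: solve e0.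
have [u|n01] := boolP (p01 \is a GRing.unit); first by left; apply: solve (esym e0).
have [u|n11] := boolP (1 - p11 \is a GRing.unit); first by left; exact: solve e1.
have [u|n10] := boolP (p10 \is a GRing.unit); first by right; apply: solve (esym e1).
exfalso; apply: nB.
have u00 : p00 \is a GRing.unit.
  have [|//|] := locU p00 (1 - p00); first by rewrite addrC subrK unitr1.
  by rewrite (negPf n00).
have u11 : p11 \is a GRing.unit.
  have [|//|] := locU p11 (1 - p11); first by rewrite addrC subrK unitr1.
  by rewrite (negPf n11).
have uD : p00 * p11 - p01 * p10 \is a GRing.unit.
  have [||//] := locU (p01 * p10) (p00 * p11 - p01 * p10).
    by rewrite addrC subrK unitrM u00.
  by rewrite unitrM (negPf n01).
have := uF _ uD; rewrite tofracB !tofracM => D0.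
split; apply: (mulfI D0); rewrite mulr0.
  transitivity (p11%:F * (p00%:F * B0 + p01%:F * B1) - p01%:F * (p10%:F * B0 + p11%:F * B1)).
    by ring.
  by rewrite -eB0 -eB1 !mulr0 subrr.
transitivity (p00%:F * (p10%:F * B0 + p11%:F * B1) - p10%:F * (p00%:F * B0 + p01%:F * B1)).
  by ring.
by rewrite -eB0 -eB1 !mulr0 subrr.
Qed.

(** A free lattice stable under an endomorphism with eigenvalues l1, l2 in R
    such that l1 - l2 is a unit is the sum of its intersections with the two
    eigenlines, and over a local ring these are free of rank one. *)
Lemma box_of_eigenframe F (f : 'End(V)) (l1 l2 : R) (T : submodClosed (rmod V)) :
  (forall x y : R, x + y \is a GRing.unit -> x \is a GRing.unit \/ y \is a GRing.unit) ->
  \dim (fullv : {vspace V}) = 2%N ->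
  f (fe1 F) = l1%:F *: fe1 F -> f (fe2 F) = l2%:F *: fe2 F -> l1 - l2 \is a GRing.unit ->
  is_lattice T -> free_submod T ->
  (forall v : V, (v : rmod V) \in T -> (f v : rmod V) \in T) ->
  exists x y : K, [/\ x != 0, y != 0 & is_box F T x y].
Proof.
move=> locU dim2 fE1 fE2 lU Tlat Tfree Tf.
have [b0 [b1 [Tb Vb]]] := free_lattice_gens dim2 Tlat Tfree.
have TD (u v : V) : (u : rmod V) \in T -> (v : rmod V) \in T -> (u + v : rmod V) \in T.
  exact: (@rpredD _ T).
have TZ (r : R) (v : V) : (v : rmod V) \in T -> (r%:F *: v : rmod V) \in T.
  exact: (@rpredZ _ _ T).
have fE v : f v = (l1%:F * fk1 F v) *: fe1 F + (l2%:F * fk2 F v) *: fe2 F.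
  by rewrite {1}(frameE F v) linearD !linearZ /= fE1 fE2 !scalerA mulrC [_ * l2%:F]mulrC.
have P1 v : (v : rmod V) \in T -> (fk1 F v *: fe1 F : rmod V) \in T.
  move=> vT; have -> : fk1 F v *: fe1 F = ((l1 - l2)^-1)%:F *: (f v + (- l2)%:F *: v).
    apply: (@fk_eq _ _ F); rewrite !(fk1Z, fk2Z, fk1D, fk2D) fE ?frameK1 ?frameK2 ?fk1e1 ?fk2e1.
      by rewrite -mulrDl -tofracD mulrA -tofracM mulVr // tofrac1 mul1r mulr1.
    by rewrite -mulrDl -tofracD subrr tofrac0 mul0r !mulr0.
  by apply/TZ/TD; [exact: Tf | exact: TZ].
have P2 v : (v : rmod V) \in T -> (fk2 F v *: fe2 F : rmod V) \in T.
  move=> vT; have -> : fk2 F v *: fe2 F = v + (-1)%:F *: (fk1 F v *: fe1 F).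
    by rewrite tofracN tofrac1 scaleN1r {2}(frameE F v) addrAC subrr add0r.
  by apply: TD => //; apply/TZ/P1.
have b0T : (b0 : rmod V) \in T by apply/Tb; exists 1, 0; rewrite tofrac1 tofrac0 scale1r scale0r addr0.
have b1T : (b1 : rmod V) \in T by apply/Tb; exists 0, 1; rewrite tofrac1 tofrac0 scale1r scale0r add0r.
have /Tb[p00 [p01 e0]] := P1 _ b0T; have /Tb[p10 [p11 e1]] := P1 _ b1T.
have /Tb[q00 [q01 h0]] := P2 _ b0T; have /Tb[q10 [q11 h1]] := P2 _ b1T.
have k1e0 := congr1 (fk1 F) e0; have k1e1 := congr1 (fk1 F) e1.
have k2e0 := congr1 (fk2 F) e0; have k2e1 := congr1 (fk2 F) e1.
have k1h0 := congr1 (fk1 F) h0; have k1h1 := congr1 (fk1 F) h1.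
have k2h0 := congr1 (fk2 F) h0; have k2h1 := congr1 (fk2 F) h1.
rewrite !(fk1Z, fk2Z, fk1D, fk2D, fk1e1, fk1e2, fk2e1, fk2e2, mulr0, mulr1) in
  k1e0 k1e1 k2e0 k2e1 k1h0 k1h1 k2h0 k2h1.
have [x0 [y0 e2V]] := Vb (fe2 F); have [x1 [y1 e1V]] := Vb (fe1 F).
have nB : ~ (fk2 F b0 = 0 /\ fk2 F b1 = 0).
  move=> [z0 z1]; have := fk2e2 F; rewrite e2V fk2D !fk2Z z0 z1 !mulr0 addr0.
  by move/esym/eqP; rewrite oner_eq0.
have nA : ~ (fk1 F b0 = 0 /\ fk1 F b1 = 0).
  move=> [z0 z1]; have := fk1e1 F; rewrite e1V fk1D !fk1Z z0 z1 !mulr0 addr0.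
  by move/esym/eqP; rewrite oner_eq0.
have pick (k : V -> K) : fdvd (k b0) (k b1) \/ fdvd (k b1) (k b0) ->
    ~ (k b0 = 0 /\ k b1 = 0) ->
    exists b, [/\ (b : rmod V) \in T, k b != 0, fdvd (k b) (k b0) & fdvd (k b) (k b1)].
  move=> [d|d] n; [exists b0 | exists b1]; split=> //; try exact: fdvd_refl.
    by apply/eqP => z; apply: n; split=> //; case: d => r ->; rewrite z mulr0.
  by apply/eqP => z; apply: n; split=> //; case: d => r ->; rewrite z mulr0.
have [b [bT kb0 bd0 bd1]] := pick _ (local_generator locU k1e0 k1e1 k2e0 k2e1 nB) nA.
have [c [cT kc0 cd0 cd1]] := pick _ (local_generator locU k2h0 k2h1 k1h0 k1h1 nA) nB.
exists (fk1 F b), (fk2 F c); split=> // v; split=> [/Tb[r [s ->]]|[[r e] [s h]]].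
  by rewrite /in_box fk1D fk2D !fk1Z !fk2Z; split; apply: fdvdL => //; exact: fdvdM.
by rewrite (frameE F v) e h -!scalerA; apply: TD; apply: TZ; [exact: P1 | exact: P2].
Qed.

End Lattices.

(** * Normal forms of the representation *)

(** A basis in which g0 is diagonal, with eigenvalues that differ by a unit, the
    entries of rho lie in R, and the contents of the off-diagonal entries are
    normalized to h for b and to 1 for c. Only the product of the two contents
    is intrinsic: e2 may be scaled. *)
Record normal_form (R : idomainType) (V : vectType {fraction R}) (G : groupType)
    (rho : G -> 'End(V)) := NormalForm {
  nF : frame V;
  na : G -> R; nb : G -> R; nc : G -> R; nd : G -> R;
  nE1 : forall g, rho g (fe1 nF) = (na g)%:F *: fe1 nF + (nc g)%:F *: fe2 nF;
  nE2 : forall g, rho g (fe2 nF) = (nb g)%:F *: fe1 nF + (nd g)%:F *: fe2 nF;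
  nh : R; nb' : G -> R;
  nh0 : nh != 0;
  nbE : forall g, nb g = nh * nb' g;
  nb'P : primitive nb';
  ncP : primitive nc;
  ng0 : G;
  nb_g0 : nb ng0 = 0;
  nc_g0 : nc ng0 = 0;
  nU_g0 : na ng0 - nd ng0 \is a GRing.unit
}.

Section NormalFormTheory.
Variables (R : idomainType) (V : vectType {fraction R}) (G : groupType).
Variable rho : G -> 'End(V).
Local Notation K := {fraction R}.
Hypothesis ufdR : ufd R.
Hypothesis locU : forall x y : R,
  x + y \is a GRing.unit -> x \is a GRing.unit \/ y \is a GRing.unit.
Hypothesis two_unit : (2%:R : R) \is a GRing.unit.
Hypothesis dim2 : \dim (fullv : {vspace V}) = 2%N.
Hypothesis repr_rho : is_representation rho.
Variable N : normal_form rho.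
Local Notation F := (nF N).
Local Notation a := (na N).
Local Notation b := (nb N).
Local Notation c := (nc N).
Local Notation d := (nd N).
Local Notation h := (nh N).
Local Notation g0 := (ng0 N).

Lemma nf_fk1 g v : fk1 F (rho g v) = (a g)%:F * fk1 F v + (b g)%:F * fk2 F v.
Proof.
rewrite {1}(frameE F v) linearD !linearZ /= fk1D !fk1Z nE1 nE2 !frameK1.
by rewrite mulrC [X in _ + X]mulrC.
Qed.

Lemma nf_fk2 g v : fk2 F (rho g v) = (c g)%:F * fk1 F v + (d g)%:F * fk2 F v.
Proof.
rewrite {1}(frameE F v) linearD !linearZ /= fk2D !fk2Z nE1 nE2 !frameK2.
by rewrite mulrC [X in _ + X]mulrC.
Qed.

Lemma nf_trace g : trace_end (rho g) = (a g + d g)%:F.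
Proof. by rewrite (trace_frame F) nE1 nE2 frameK1 frameK2 tofracD. Qed.

Lemma naM g g' : a (g * g')%g = a g * a g' + b g * c g'.
Proof.
apply/eqP; rewrite -tofrac_eq; apply/eqP; have := congr1 (fk1 F) (nE1 N (g * g')%g).
rewrite frameK1 => <-; rewrite repr_rho.2 comp_lfunE nf_fk1 nE1 frameK1 frameK2.
by rewrite tofracD !tofracM.
Qed.

Lemma ndM g g' : d (g * g')%g = c g * b g' + d g * d g'.
Proof.
apply/eqP; rewrite -tofrac_eq; apply/eqP; have := congr1 (fk2 F) (nE2 N (g * g')%g).
rewrite frameK2 => <-; rewrite repr_rho.2 comp_lfunE nf_fk2 nE2 frameK1 frameK2.
by rewrite tofracD !tofracM.
Qed.

Lemma na1 : a 1%g = 1.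
Proof.
apply/eqP; rewrite -tofrac_eq tofrac1; apply/eqP; have := congr1 (fk1 F) (nE1 N 1%g).
by rewrite frameK1 => <-; rewrite repr_rho.1 id_lfunE fk1e1.
Qed.

Lemma nd1 : d 1%g = 1.
Proof.
apply/eqP; rewrite -tofrac_eq tofrac1; apply/eqP; have := congr1 (fk2 F) (nE2 N 1%g).
by rewrite frameK2 => <-; rewrite repr_rho.1 id_lfunE fk2e2.
Qed.

(** * The ideal of reducibility *)

Definition nf_J : ideal R := family_ideal (fun gg : G * G => b gg.1 * c gg.2).

Lemma nf_J_mem g g' : b g * c g' \in nf_J.
Proof. exact: (mem_family_ideal (fun gg : G * G => b gg.1 * c gg.2) (g, g')). Qed.

Lemma nf_J_sub (I : ideal R) : {subset nf_J <= I} <-> forall g g', b g * c g' \in I.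
Proof.
split=> [sub g g'|bc]; first exact/sub/nf_J_mem.
by apply/family_ideal_sub => -[g g']; exact: bc.
Qed.

Lemma nf_J_h : {subset nf_J <= pideal h}.
Proof.
by apply/nf_J_sub => g g'; apply/in_pideal; exists (nb' N g * c g'); rewrite nbE; ring.
Qed.

(** Gauss's lemma: h is the content of the family b(g) c(g'). *)
Lemma nf_J_content p : irreducible_elt p ->
  exists u, h * u \in nf_J /\ ~ dvd p u.
Proof.
move=> pI; have [g ng] := nb'P N pI; have [g' ng'] := ncP N pI.
exists (nb' N g * c g'); split; first by rewrite mulrA -nbE; exact: nf_J_mem.
by move/(irr_prime ufdR pI) => [].
Qed.

Lemma nf_J_irr p : irreducible_elt p -> {subset nf_J <= pideal p} <-> dvd p h.
Proof.
move=> pI; split=> [sub|ph x /nf_J_h /in_pideal hx]; last exact/in_pideal/(dvd_trans ph).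
have [u [huJ npu]] := nf_J_content pI.
by have /in_pideal/(irr_prime ufdR pI)[] := sub _ huJ.
Qed.

(** Two functions that are multiplicative modulo I and whose sum is the trace
    are, modulo I, the diagonal entries: their values at g0 are the two roots
    of a polynomial with roots differing by a unit, and comparing the trace at
    g and at g0 g gives a linear system with unit determinant. *)
Lemma nf_chars (I : ideal R) (t t' : G -> R) :
  (forall g g', t (g * g')%g - t g * t g' \in I) ->
  (forall g g', t' (g * g')%g - t' g * t' g' \in I) ->
  (forall g, t g + t' g - (a g + d g) \in I) ->
  t g0 - d g0 \in I ->
  forall g, t g - d g \in I /\ t' g - a g \in I.
Proof.
move=> tM t'M tr t0.
have t'0 : t' g0 - a g0 \in I.
  rewrite (_ : _ - _ = (t g0 + t' g0 - (a g0 + d g0)) - (t g0 - d g0)); last by ring.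
  exact: idealB.
have ag g : a (g0 * g)%g = a g0 * a g by rewrite naM nb_g0 mul0r addr0.
have dg g : d (g0 * g)%g = d g0 * d g by rewrite ndM nc_g0 mul0r add0r.
have td g : t g - d g \in I.
  have E : (a g0 - d g0) * (t g - d g) \in I.
    rewrite (_ : _ * _ = a g0 * (t g + t' g - (a g + d g))
      - (t (g0 * g)%g + t' (g0 * g)%g - (a (g0 * g)%g + d (g0 * g)%g))
      + (t (g0 * g)%g - t g0 * t g) + (t' (g0 * g)%g - t' g0 * t' g)
      + t g * (t g0 - d g0) + t' g * (t' g0 - a g0)); last by rewrite ag dg; ring.
    apply: idealD; last exact: idealMl.
    apply: idealD; last exact: idealMl.
    apply: idealD; last exact: t'M.
    apply: idealD; last exact: tM.
    by apply: idealB; [exact: idealMl | exact: tr].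
  by rewrite -[_ - _](mulKr (nU_g0 N)); exact: idealMl.
move=> g; split=> //.
rewrite (_ : _ - _ = (t g + t' g - (a g + d g)) - (t g - d g)); last by ring.
exact: idealB.
Qed.

(** The product c(g') b(g) is the defect of multiplicativity of d. *)
Lemma nf_chars_J (I : ideal R) (t : G -> R) :
  (forall g g', t (g * g')%g - t g * t g' \in I) ->
  (forall g, t g - d g \in I) -> forall g g', b g * c g' \in I.
Proof.
move=> tM td g g'.
rewrite (_ : _ * _ = t (g' * g)%g - t g' * t g - (t (g' * g)%g - d (g' * g)%g)
   + t g * (t g' - d g') + d g' * (t g - d g)); last by rewrite ndM; ring.
do 2?[apply: idealD; last exact: idealMl].
exact: idealB.
Qed.

(** The traces at g0 and at g0 ^ 2 give 2 (t - a)(t - d) = 0 modulo I at g0. The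
    two factors differ by a unit, so that one of them is a unit and the other
    one vanishes modulo I. *)
Lemma nf_root (I : ideal R) (t t' : G -> R) :
  (forall g g', t (g * g')%g - t g * t g' \in I) ->
  (forall g g', t' (g * g')%g - t' g * t' g' \in I) ->
  (forall g, t g + t' g - (a g + d g) \in I) ->
  t g0 - d g0 \in I \/ t' g0 - d g0 \in I.
Proof.
move=> tM t'M tr.
have agg : a (g0 * g0)%g = a g0 * a g0 by rewrite naM nb_g0 mul0r addr0.
have dgg : d (g0 * g0)%g = d g0 * d g0 by rewrite ndM nc_g0 mul0r add0r.
have E : 2%:R * ((t g0 - a g0) * (t g0 - d g0)) \in I.
  rewrite (_ : _ * _ = (2%:R * t g0 - (t g0 + t' g0 + (a g0 + d g0))) *
        (t g0 + t' g0 - (a g0 + d g0))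
      + (t (g0 * g0)%g + t' (g0 * g0)%g - (a (g0 * g0)%g + d (g0 * g0)%g))
      - (t (g0 * g0)%g - t g0 * t g0) - (t' (g0 * g0)%g - t' g0 * t' g0));
    last by rewrite agg dgg; ring.
  by do 2?[apply: idealB => //]; apply: idealD => //; exact: idealMl.
have E' : (t g0 - a g0) * (t g0 - d g0) \in I.
  by rewrite -[_ * _](mulKr two_unit); exact: idealMl.
have [|u|u] := locU (x := t g0 - d g0) (y := - (t g0 - a g0)).
- by rewrite (_ : _ + _ = a g0 - d g0); [exact: nU_g0 | ring].
- right; rewrite (_ : _ - _ = (t g0 + t' g0 - (a g0 + d g0)) - (t g0 - a g0)); last by ring.
  by apply: idealB => //; rewrite -[_ - a g0](mulrK u); exact: idealMr.
left; rewrite unitrN in u.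
by rewrite -[_ - _](mulKr u); exact: idealMl.
Qed.

Lemma nf_split (I : ideal R) (theta theta' : G -> rquot I) :
  is_character theta -> is_character theta' -> trace_mod rho theta theta' ->
  (forall g g', b g * c g' \in I) /\
  ((forall g, repr (theta g) - d g \in I) \/ (forall g, repr (theta g) - a g \in I)).
Proof.
have lift (chi : G -> rquot I) : is_character chi ->
    forall g g', repr (chi (g * g')%g) - repr (chi g) * repr (chi g') \in I.
  by move=> [_ chiM] g g'; apply/rpi_rel; rewrite -rpiM !rpi_repr.
move=> /lift tM /lift t'M tr0.
have tr g : repr (theta g) + repr (theta' g) - (a g + d g) \in I.
  have [t tE e] := tr0 g; apply/rpi_eq; rewrite rpiD !rpi_repr -e.
  by congr (rpi I _); apply/eqP; rewrite -tofrac_eq tE nf_trace.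
have tr' g : repr (theta' g) + repr (theta g) - (a g + d g) \in I.
  by rewrite [_ + repr (theta g)]addrC.
have [t0|t'0] := nf_root tM t'M tr.
  have td := nf_chars tM t'M tr t0; split; last by left=> g; case: (td g).
  by apply: nf_chars_J tM _ => g; case: (td g).
have td := nf_chars t'M tM tr' t'0; split; last by right=> g; case: (td g).
by apply: nf_chars_J t'M _ => g; case: (td g).
Qed.

Lemma nf_reducibility : is_reducibility_ideal rho nf_J.
Proof.
move=> I; split=> [/nf_J_sub bc|[theta [theta' [ch ch' tr]]]]; last first.
  by apply/nf_J_sub; have [] := nf_split ch ch' tr.
exists (fun g => rpi I (d g)), (fun g => rpi I (a g)); split.
- split=> [|g g']; first by rewrite nd1.
  rewrite rpiM; apply/rpi_eq; rewrite ndM addrK.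
  by rewrite mulrC.
- split=> [|g g']; first by rewrite na1.
  by rewrite rpiM; apply/rpi_eq; rewrite naM addrC addKr.
move=> g; exists (a g + d g); first by rewrite nf_trace.
by rewrite rpiD addrC.
Qed.

Lemma reducibility_ideal_unique (J : ideal R) : is_reducibility_ideal rho J -> J = nf_J.
Proof.
move=> JP; apply: submodP => x; apply/idP/idP; move: x.
  by apply/JP/nf_reducibility.
by apply/nf_reducibility/JP.
Qed.

End NormalFormTheory.

Lemma inj_surj_bijective (A B : Type) (f : A -> B) :
  injective f -> (forall y, exists x, f x = y) -> bijective f.
Proof.
move=> finj /choice[g fg]; exists g => // x; apply: finj; exact: fg.
Qed.

Section QuotientFacts.
Variables (A : pzRingType) (M : lmodType A).

Lemma mqpiZ (S : submodClosed M) a x : a *: mqpi S x = mqpi S (a *: x).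
Proof. exact: mquot_scaleE. Qed.

Lemma mqpi_eq0 (S : submodClosed M) x : mqpi S x = 0 <-> x \in S.
Proof.
have mqpi0 : mqpi S 0 = 0 by apply: (addIr (mqpi S 0)); rewrite -mqpiD !add0r.
by rewrite -mqpi0 mqpi_eq subr0.
Qed.

Lemma in_comap (S T : submodClosed M) (x : submod_type T) :
  x \in comap S T <-> val x \in S.
Proof. exact (@in_mk_submod A (submod_type T) _ _ _ x). Qed.

Lemma val_submodL (T : submodClosed M) a b (x y : submod_type T) :
  val (a *: x + b *: y) = a *: val x + b *: val y.
Proof. by rewrite linearD !linearZ. Qed.

End QuotientFacts.

(** R/I(theta) is itself a quotient of R/J(theta). *)
Lemma gquotient_of_iso (R : idomainType) (G : groupType) (J I : ideal R) (theta : G -> rquot J) (M : gmodule R G) :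
  {subset J <= I} -> gisomorphic M (char_module I theta) ->
  is_gquotient M (char_module J theta).
Proof.
move=> JI [f [flin fG] [f' fK fK']]; exists (fun y : char_module J theta => f' (rpi I (repr y))).
  have lift (y : R) : rpi I (repr (rpi J y)) = rpi I y by apply/rpi_eq/JI/repr_rpi.
  split=> [s y y'|g y].
    have [[x ->] [x' ->]] := (rpi_surj y, rpi_surj y').
    have -> : s *: rpi J x + rpi J x' = rpi J (s * x + x').
      by rewrite rpiD; congr (_ + _); exact: mqpiZ.
    apply: (can_inj fK); rewrite flin !fK' !lift rpiD; congr (_ + _).
    by apply/esym; exact: mqpiZ.
  have [x ->] := rpi_surj y.
  have -> : gmod_act g (rpi J x : char_module J theta) = rpi J (repr (theta g) * x).
    exact: rpiM.
  apply: (can_inj fK); rewrite fG !fK' !lift.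
  by apply/esym; exact: rpiM.
move=> z; exists (rpi J (repr (f z))).
have -> : rpi I (repr (rpi J (repr (f z)))) = rpi I (repr (f z)) by apply/rpi_eq/JI/repr_rpi.
by rewrite rpi_repr fK.
Qed.

(** * Stable free lattices and divisors *)

Section Classification.
Variables (R : idomainType) (V : vectType {fraction R}) (G : groupType).
Variable rho : G -> 'End(V).
Local Notation K := {fraction R}.
Hypothesis ufdR : ufd R.
Hypothesis locU : forall x y : R,
  x + y \is a GRing.unit -> x \is a GRing.unit \/ y \is a GRing.unit.
Hypothesis dim2 : \dim (fullv : {vspace V}) = 2%N.
Variable N : normal_form rho.
Local Notation F := (nF N).
Local Notation a := (na N).
Local Notation b := (nb N).
Local Notation c := (nc N).
Local Notation d := (nd N).
Local Notation h := (nh N).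
Local Notation g0 := (ng0 N).
Implicit Types (T S : sflattice rho) (x y z : K) (w u r s : R).

(** T is the homothetic of R e1 + w^-1 R e2 by x, where w divides h. *)
Definition lat_at T x w : Prop :=
  [/\ x != 0, dvd w h & is_box F (sfl_mod T) x (x / w%:F)].

Lemma divisor_neq0 w : dvd w h -> w%:F != 0 :> K.
Proof. by move=> wh; rewrite tofrac_eq0; apply: dvd_neq0 wh (nh0 N). Qed.

Lemma unit_neq0 u : u \is a GRing.unit -> u%:F != 0 :> K.
Proof. by move=> uU; rewrite tofrac_eq0; apply: contraTneq uU => ->; rewrite unitr0. Qed.

(** Stability forces w c(g) and b(g) / w to lie in R; as c and b / h are
    primitive, this says that w lies in R and divides h. *)
Lemma lat_at_exists T : exists x w, lat_at T x w.
Proof.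
have rho1 : rho g0 (fe1 F) = (a g0)%:F *: fe1 F by rewrite nE1 nc_g0 tofrac0 scale0r addr0.
have rho2 : rho g0 (fe2 F) = (d g0)%:F *: fe2 F by rewrite nE2 nb_g0 tofrac0 scale0r add0r.
have [x [y [x0 y0 TB]]] := box_of_eigenframe locU dim2 rho1 rho2 (nU_g0 N)
  (sfl_lattice T) (sfl_free T) (@sfl_stable _ _ _ _ T g0).
have xT : (x *: fe1 F : rmod V) \in sfl_mod T by apply/TB/in_box1; exact: fdvd_refl.
have yT : (y *: fe2 F : rmod V) \in sfl_mod T by apply/TB/in_box2; exact: fdvd_refl.
have [w wE] : fdvd 1 (x / y).
  apply: (primitive_fdvd ufdR (ncP N)) => g.
  have /TB[_] := sfl_stable g xT; rewrite nf_fk2 fk1Z fk2Z fk1e1 fk2e1 mulr1 !mulr0 addr0.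
  move=> [r e]; exists r; apply: (mulIf y0); rewrite mulr1 -e.
  by rewrite mulrAC divfK // mulrC.
rewrite mulr1 in wE.
have w0 : w != 0 by rewrite -tofrac_eq0 -wE mulf_neq0 ?invr_eq0.
have xE : x = w%:F * y by rewrite -wE divfK.
have yE : x / w%:F = y by rewrite xE mulrAC mulfV ?mul1r ?tofrac_eq0.
exists x, w; split=> //; last by rewrite yE.
apply: (primitive_dvd ufdR (nb'P N) w0) => g; rewrite -nbE.
have /TB[] := sfl_stable g yT; rewrite nf_fk1 fk1Z fk2Z fk1e2 fk2e2 mulr1 !mulr0 add0r.
move=> [r e] _; exists r; apply/eqP; rewrite -tofrac_eq; apply/eqP/(mulIf y0).
by rewrite e xE tofracM mulrA.
Qed.

Lemma box_stable x w : x != 0 -> dvd w h -> is_stable rho (box F x (x / w%:F)).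
Proof.
move=> x0 wh g v /box_is_box[v1 v2]; apply/box_is_box.
have w0 := divisor_neq0 wh; have [h' hE] := wh.
have xE : x = w%:F * (x / w%:F) by rewrite mulrC divfK.
rewrite /in_box nf_fk1 nf_fk2; split; apply: fdvdL => //.
- case: v2 => r ->; exists (nb' N g * h' * r); rewrite nbE hE !tofracM [in RHS]xE; ring.
- by apply: fdvd_trans v1; exists w.
exact: fdvdM.
Qed.

Lemma lat_at_build x w : x != 0 -> dvd w h -> exists T, lat_at T x w.
Proof.
move=> x0 wh; have y0 : x / w%:F != 0 by rewrite mulf_neq0 ?invr_eq0 ?divisor_neq0.
exists (SFLattice (box_lattice x0 y0 (@box_is_box _ _ F _ _)) (box_stable x0 wh)
  (box_free x0 y0 (@box_is_box _ _ F _ _))).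
by split=> //=; exact: box_is_box.
Qed.

Lemma lat_at_subset T T' x w x' w' : lat_at T x w -> lat_at T' x' w' ->
  {subset sfl_mod T <= sfl_mod T'} <-> fdvd x' x /\ fdvd (x' / w'%:F) (x / w%:F).
Proof. by move=> [_ _ TB] [_ _ TB']; exact: sub_box. Qed.

Lemma lat_at_homothety T S x w y (z : R) : lat_at T x w -> lat_at S y z ->
  homothety_class T S <-> associated w z.
Proof.
move=> [x0 wh TB] [y0 zh SB]; rewrite (homothety_box x0 TB SB).
have w0 := divisor_neq0 wh; have z0 := divisor_neq0 zh.
split=> [[k k0 [h1 h2 h3 h4]]|[u uU zE]].
  have [u uU e1] := fdvd_unit_eq h1 h2 y0.
  have yz0 := mulf_neq0 y0 (invr_neq0 z0).
  have [v vU e2] := fdvd_unit_eq h3 h4 yz0.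
  exists (u^-1 * v); first by rewrite unitrM unitrV uU.
  have /eqP : u%:F * y / w%:F = v%:F * y / z%:F by rewrite -e1 -!mulrA e2 mulrA.
  rewrite (eqr_div _ _ w0 z0) => /eqP e3; apply: (mulrI uU); rewrite !mulrA mulrV ?mul1r //.
  by apply/eqP; rewrite -tofrac_eq !tofracM; apply/eqP/(mulIf y0); rewrite mulrAC e3 mulrAC.
have u0 := unit_neq0 uU.
exists (y / x); first exact: mulf_neq0 y0 (invr_neq0 x0).
have e1 : y / x * x = y := divfK x0 y.
have e2 : y / x * (x / w%:F) = u%:F * (y / z%:F).
  rewrite mulrA e1 zE tofracM invfM mulrCA; congr (_ * _).
  by rewrite mulrA (mulfV u0) mul1r.
rewrite e1 e2; split; try exact: fdvd_refl.
  by exists u.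
by exists u^-1; rewrite mulrA -tofracM mulVr // tofrac1 mul1r.
Qed.

Lemma lat_at_assoc T x w (z : R) : lat_at T x w -> associated w z -> lat_at T x z.
Proof.
move=> Tw wz; have [x0 wh TB] := Tw.
have zh : dvd z h by apply: dvd_trans (assoc_dvd (assoc_sym wz)) wh.
split=> // v; rewrite TB /in_box; have [u uU zE] := wz.
have u0 := unit_neq0 uU.
have e : x / w%:F = u%:F * (x / z%:F).
  rewrite zE tofracM invfM mulrCA; congr (_ * _).
  by rewrite mulrA (mulfV u0) mul1r.
have d1 : fdvd (x / z%:F) (x / w%:F) by exists u.
have d2 : fdvd (x / w%:F) (x / z%:F).
  by exists u^-1; rewrite e mulrA -tofracM mulVr // tofrac1 mul1r.
by split=> -[v1 v2]; split=> //; [exact: fdvd_trans d1 v2 | exact: fdvd_trans d2 v2].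
Qed.

(** * Quotients of lattices *)

(** T'/T is R/r + R/s, generated by the classes of x' e1 and (x' / w') e2. *)
Lemma lat_quotient_char T T' x w x' w' r s (I : ideal R) :
  lat_at T x w -> lat_at T' x' w' -> {subset sfl_mod T <= sfl_mod T'} ->
  x = r%:F * x' -> x / w%:F = s%:F * (x' / w'%:F) ->
  is_char_ideal (subquot (sfl_mod T') (sfl_mod T)) I <-> I = pideal (r * s).
Proof.
move=> [x0 wh TB] [x'0 w'h TB'] sub xE yE.
have w0 := divisor_neq0 wh; have w'0 := divisor_neq0 w'h.
have y0 := mulf_neq0 x0 (invr_neq0 w0).
have y'0 := mulf_neq0 x'0 (invr_neq0 w'0).
have r0 : r != 0 by apply: contraNneq x0 => r0; rewrite xE r0 tofrac0 mul0r.
have s0 : s != 0 by apply: contraNneq y0 => s0; rewrite yE s0 tofrac0 mul0r.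
have p1 : (x' *: fe1 F : rmod V) \in sfl_mod T' by apply/TB'/in_box1; exact: fdvd_refl.
have p2 : ((x' / w'%:F) *: fe2 F : rmod V) \in sfl_mod T'.
  by apply/TB'/in_box2; exact: fdvd_refl.
pose z1 : submod_type (sfl_mod T') := exist _ (x' *: fe1 F : rmod V) p1.
pose z2 : submod_type (sfl_mod T') := exist _ ((x' / w'%:F) *: fe2 F : rmod V) p2.
have combE m n : val (m *: z1 + n *: z2) =
    (m%:F * x') *: fe1 F + (n%:F * (x' / w'%:F)) *: fe2 F :> V.
  by rewrite -(scalerA m%:F) -(scalerA n%:F); exact: (val_submodL m n z1 z2).
apply: (@char_ideal_two_generators _ _ (mqpi (comap (sfl_mod T) (sfl_mod T')) z1)
   (mqpi (comap (sfl_mod T) (sfl_mod T')) z2)) => // [q|m n].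
  have /TB'[[m em] [n en]] := valP (repr q); exists m, n.
  rewrite !mqpiZ -mqpiD -[LHS]mqpi_repr; congr mqpi; apply: val_inj.
  by rewrite combE -em -en -frameE.
rewrite !mqpiZ -mqpiD mqpi_eq0 in_comap combE TB /in_box frameK1 frameK2 yE xE.
by rewrite !(mulrC _ x') !(mulrC _ (x' / _)) !fdvd_mul2l // !fdvd_tofrac.
Qed.

Lemma lat_ratio x w x' w' r s : x' != 0 -> dvd w h -> dvd w' h ->
  x = r%:F * x' -> x / w%:F = s%:F * (x' / w'%:F) <-> r * w' = s * w.
Proof.
move=> x'0 wh w'h ->; have w0 := divisor_neq0 wh; have w'0 := divisor_neq0 w'h.
rewrite [X in _ = X <-> _]mulrA; split=> [/eqP|/eqP e].
  rewrite (eqr_div _ _ w0 w'0) => /eqP e; apply/eqP; rewrite -tofrac_eq !tofracM.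
  by apply/eqP/(mulIf x'0); rewrite mulrAC e mulrAC.
apply/eqP; rewrite (eqr_div _ _ w0 w'0); move: e; rewrite -tofrac_eq !tofracM => /eqP e.
by rewrite mulrAC e mulrAC.
Qed.

(** The characteristic ideal of T'/T is (r s) with r w' = s w; when r s is
    irreducible, r or s is a unit, and up to units w' / w is s or the inverse
    of r. *)
Lemma lat_adj w w' : dvd w h -> dvd w' h ->
  (exists T T' x x', [/\ lat_at T x w, lat_at T' x' w', {subset sfl_mod T <= sfl_mod T'} &
     exists2 p : primeIdeal R, height p 1 & is_char_ideal (subquot (sfl_mod T') (sfl_mod T)) p]) <->
  exists2 pi, irreducible_elt pi & associated w' (pi * w) \/ associated w (pi * w').
Proof.
move=> wh w'h; split=> [[T [T' [x [x' [Tw T'w' sub [p p1]]]]]]|[pi piI]].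
  have [[r xE] [s yE]] := (lat_at_subset Tw T'w').1 sub.
  move/(lat_quotient_char p Tw T'w' sub xE yE) => pE.
  have [x'0 _ _] := T'w'; have := (lat_ratio s x'0 wh w'h xE).1 yE => rs.
  have [pi piI] := (height1P ufdR p).1 p1; rewrite pE => /pideal_eq/assoc_sym pirs.
  have [_ _ /(_ r s erefl)[rU|sU]] := irr_assoc piI pirs; [exists s | exists r].
  - by apply: irr_assoc piI (assoc_trans pirs _); exists r^-1; rewrite ?unitrV ?mulKr.
  - by left; exists r.
  - by apply: irr_assoc piI (assoc_trans pirs _); exists s^-1; rewrite ?unitrV // mulrC mulrK.
  - by right; exists s.
have step r s : irreducible_elt (r * s) -> r * w' = s * w ->
    exists T T' x x', [/\ lat_at T x w, lat_at T' x' w', {subset sfl_mod T <= sfl_mod T'} &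
     exists2 p : primeIdeal R, height p 1 & is_char_ideal (subquot (sfl_mod T') (sfl_mod T)) p].
  move=> rsI rs.
  have r0 : r%:F != 0 :> K.
    by rewrite tofrac_eq0; apply: contraNneq (irr_neq0 rsI) => ->; rewrite mul0r.
  have [T Tw] := lat_at_build r0 wh; have [T' T'w'] := lat_at_build (oner_neq0 K) w'h.
  have xE : r%:F = r%:F * 1 :> K by rewrite mulr1.
  have yE := (lat_ratio s (oner_neq0 K) wh w'h xE).2 rs.
  have sub : {subset sfl_mod T <= sfl_mod T'}.
    by apply/(lat_at_subset Tw T'w'); split; [exists r | exists s].
  exists T, T', r%:F, 1; split=> //; exists (irr_primeIdeal ufdR rsI).
    exact: irr_prime_height.
  exact/(lat_quotient_char _ Tw T'w' sub xE yE).
case=> -[u uU e].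
  apply: (step 1 (u^-1 * pi)).
    by rewrite mul1r; apply: irr_assoc piI _; exists u^-1; rewrite ?unitrV.
  by rewrite -mulrA e mulKr // mul1r.
apply: (step (u^-1 * pi) 1).
  by rewrite mulr1; apply: irr_assoc piI _; exists u^-1; rewrite ?unitrV.
by rewrite -mulrA e mulKr // mul1r.
Qed.

(** On a quotient of R/J(theta) the element g0 acts by the eigenvalue d(g0); the
    generator x' e1 of T' is an eigenvector for a(g0), so it dies in T'/T. *)
Lemma gquotient_fdvd (J : ideal R) (theta : G -> rquot J) T T' x w x' w' :
  (forall g, repr (theta g) - d g \in J) -> lat_at T x w -> lat_at T' x' w' ->
  is_gquotient (lattice_quotient T' T) (char_module J theta) -> fdvd x x'.
Proof.
move=> thE [x0 wh TB] [x'0 w'h TB'] [f [flin fG] fsurj].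
have p1 : (x' *: fe1 F : rmod V) \in sfl_mod T' by apply/TB'/in_box1; exact: fdvd_refl.
pose z1 : submod_type (sfl_mod T') := exist _ (x' *: fe1 F : rmod V) p1.
pose q1 : subquot (sfl_mod T') (sfl_mod T) := mqpi _ z1.
have [y fy] := fsurj q1.
have actE : gmod_act g0 (y : char_module J theta) = d g0 *: (y : rquot J).
  have [y' ->] := rpi_surj y.
  transitivity (rpi J (repr (theta g0)) * rpi J y') => //.
  have -> : rpi J (repr (theta g0)) = rpi J (d g0) by apply/rpi_eq; exact: thE.
  by rewrite rpiM; apply/esym; exact: mqpiZ.
have := fG g0 y; rewrite actE fy.
have -> : f (d g0 *: (y : rquot J)) = d g0 *: q1.
  have := flin (d g0) y 0; rewrite addr0 => ->.
  have f0 : f 0 = 0 by have := flin (-1) 0 0; rewrite scaler0 addr0 scaleN1r addNr.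
  by rewrite f0 addr0 -fy.
rewrite mqpiZ => /esym/mqpi_eq/in_comap.
set v := repr q1; have vz : val v - x' *: fe1 F \in sfl_mod T.
  have /in_comap : v - z1 \in comap (sfl_mod T) (sfl_mod T') by apply/mqpi_eq; rewrite mqpi_repr.
  by rewrite raddfB.
move=> e.
have e' : (rho g0 (val v) - (d g0)%:F *: (x' *: fe1 F) : rmod V) \in sfl_mod T.
  by have := e; rewrite raddfB.
have /TB[] : (((a g0)%:F * x' - (d g0)%:F * x') *: fe1 F : rmod V) \in sfl_mod T.
  have -> : ((a g0)%:F * x' - (d g0)%:F * x') *: fe1 F = (rho g0 (val v)
      - (d g0)%:F *: (x' *: fe1 F)) + (-1)%:F *: rho g0 (val v - x' *: fe1 F) :> V.
    have -> : rho g0 (val v - x' *: fe1 F) = rho g0 (val v) - ((a g0)%:F * x') *: fe1 F :> V.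
      by rewrite linearB linearZ /= nE1 nc_g0 tofrac0 scale0r addr0 scalerA mulrC.
    by rewrite tofracN tofrac1 scaleN1r opprB scalerBl scalerA [RHS]addrC [RHS]addrA subrK.
  have vzT := sfl_stable g0 vz.
  by apply: (@rpredD _ (sfl_mod T)) e' _; exact: (@rpredZ _ _ (sfl_mod T) (-1) _ vzT).
rewrite fk1Z fk1e1 mulr1 -mulrBl -tofracB => h1 _.
have -> : x' = ((a g0 - d g0)^-1)%:F * ((a g0 - d g0)%:F * x').
  by rewrite mulrA -tofracM mulVr ?nU_g0 // tofrac1 mul1r.
exact: fdvdM.
Qed.

(** When T and T' have the same intersection with K e1, the e2-coordinate
    identifies T'/T with R/(w'/w), on which g acts by d(g): the contribution
    c(g) of e1 to the e2-coordinate is absorbed by w', a multiple of w'/w. *)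
Lemma lat_quotient_iso (J : ideal R) (theta : G -> rquot J) T T' x w x' w' r :
  (forall g, repr (theta g) - d g \in J) -> lat_at T x w -> lat_at T' x' w' ->
  {subset sfl_mod T <= sfl_mod T'} -> fdvd x x' -> w' = r * w ->
  {subset J <= pideal r} ->
  gisomorphic (lattice_quotient T' T) (char_module (pideal r) theta).
Proof.
move=> thE Tw T'w' sub xx' w'E Jr; have [x0 wh TB] := Tw; have [x'0 w'h TB'] := T'w'.
have [xx _] := (lat_at_subset Tw T'w').1 sub.
have w0 := divisor_neq0 wh; have w'0 := divisor_neq0 w'h.
have y'0 := mulf_neq0 x'0 (invr_neq0 w'0).
have [u uU xE] := fdvd_unit_eq xx xx' x'0.
have yE : x / w%:F = (u * r)%:F * (x' / w'%:F).
  by apply/(lat_ratio _ x'0 wh w'h xE); rewrite w'E mulrA.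
have /choice[cf cfE] : forall z : submod_type (sfl_mod T'),
    exists s, fk2 F (val z : V) = s%:F * (x' / w'%:F).
  by move=> z; have /TB'[_ [s]] := valP z; exists s.
have cfL s (z z' : submod_type (sfl_mod T')) : cf (s *: z + z') = s * cf z + cf z'.
  apply/eqP; rewrite -tofrac_eq; apply/eqP/(mulIf y'0); rewrite -cfE.
  have -> : val (s *: z + z') = s%:F *: (val z : V) + (val z' : V) :> V.
    by have := val_submodL s 1 z z'; rewrite !scale1r.
  by rewrite fk2L !cfE tofracD tofracM mulrDl; congr (_ + _); exact: mulrA.
have cfT (z : submod_type (sfl_mod T')) : cf z \in pideal r <-> val z \in sfl_mod T.
  rewrite in_pideal TB /in_box cfE yE.
  have k1z : fdvd x (fk1 F (val z : V)).
    by apply: fdvd_trans xx' _; have /TB'[] := valP z.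
  rewrite !(mulrC _ (x' / _)) (fdvd_mul2l _ _ y'0) fdvd_tofrac.
  split=> [rz|[_]]; last by apply: dvd_trans; exists u.
  split=> //; apply: dvd_trans rz; exists u^-1; by rewrite mulKr.
pose phi (q : lattice_quotient T' T) : char_module (pideal r) theta := rpi (pideal r) (cf (repr q)).
have phiE (z : submod_type (sfl_mod T')) : phi (mqpi _ z) = rpi (pideal r) (cf z).
  apply/rpi_eq.
  have e : cf (repr (mqpi (comap (sfl_mod T) (sfl_mod T')) z)) =
      1 * cf (repr (mqpi (comap (sfl_mod T) (sfl_mod T')) z) - z) + cf z.
    by rewrite -cfL scale1r subrK.
  rewrite e mul1r addrK; apply/cfT/in_comap/mqpi_eq; exact: mqpi_repr.
have qE (q : lattice_quotient T' T) : q = mqpi _ (repr q) by rewrite mqpi_repr.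
have cfB (z z' : submod_type (sfl_mod T')) : cf (z - z') = cf z - cf z'.
  by rewrite addrC -scaleN1r cfL mulN1r addrC.
exists phi; last first.
  apply: inj_surj_bijective => [q q' /rpi_eq|y].
    by rewrite -cfB => /cfT h; rewrite (qE q) (qE q'); apply/mqpi_eq/in_comap.
  have [s ->] := rpi_surj y.
  have p2 : ((s%:F * (x' / w'%:F)) *: fe2 F : rmod V) \in sfl_mod T'.
    by apply/TB'/in_box2; exists s.
  pose z2 : submod_type (sfl_mod T') := exist _ ((s%:F * (x' / w'%:F)) *: fe2 F : rmod V) p2.
  exists (mqpi _ z2); rewrite phiE; congr rpi.
  apply/eqP; rewrite -tofrac_eq; apply/eqP/(mulIf y'0); rewrite -cfE /=.
  by rewrite fk2Z fk2e2 mulr1.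
split=> [s q q'|g q].
  rewrite (qE q) (qE q'); set z := repr q; set z' := repr q'.
  have -> : s *: mqpi _ z + mqpi _ z' = mqpi (comap (sfl_mod T) (sfl_mod T')) (s *: z + z').
    by rewrite mqpiD -mqpiZ.
  by rewrite !phiE cfL rpiD; congr (_ + _); apply/esym; exact: mqpiZ.
rewrite [gmod_act g q]/(mqpi _ (stable_act g (repr q))) phiE.
transitivity (rpi (pideal r) (repr (theta g)) * rpi (pideal r) (cf (repr q))) => //.
set z := repr q; rewrite rpiM; apply/rpi_eq.
have /TB'[[al alE] _] := valP z.
have -> : cf (stable_act g z) = c g * al * w' + d g * cf z.
  apply/eqP; rewrite -tofrac_eq; apply/eqP/(mulIf y'0); rewrite -cfE /= nf_fk2 alE cfE.
  rewrite tofracD !tofracM mulrDl -!mulrA; congr (_ * (_ * _) + _).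
  by rewrite mulrCA mulfV ?mulr1.
have -> : c g * al * w' + d g * cf z - repr (theta g) * cf z =
   c g * al * w' - cf z * (repr (theta g) - d g) by ring.
apply: idealB; first by apply: idealMl; apply/in_pideal; exists w; rewrite w'E mulrC.
by apply: idealMl; exact: Jr.
Qed.

End Classification.

(** * The rectangle *)

Section Rectangle.
Variables (R : idomainType) (V : vectType {fraction R}) (G : groupType).
Variable rho : G -> 'End(V).
Local Notation K := {fraction R}.
Hypothesis ufdR : ufd R.
Hypothesis locU : forall x y : R,
  x + y \is a GRing.unit -> x \is a GRing.unit \/ y \is a GRing.unit.
Hypothesis dim2 : \dim (fullv : {vspace V}) = 2%N.
Variable N : normal_form rho.
Local Notation h := (nh N).

(** X is the class of the lattice R e1 + w^-1 R e2. *)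
Definition vertex_at (X : vertex (Cfr rho)) (w : R) : Prop :=
  forall S, sval X S <-> exists y, lat_at N S y w.

Lemma homothety_vertex_at (T : sflattice rho) x w : lat_at N T x w ->
  forall S, homothety_class T S <-> exists y, lat_at N S y w.
Proof.
move=> Tw S; split=> [TS|[y Sw]]; last first.
  by apply/(lat_at_homothety Tw Sw); exact: assoc_refl.
have [y [z Sz]] := lat_at_exists ufdR locU dim2 N S.
exists y; apply: (lat_at_assoc Sz); apply: assoc_sym.
exact/(lat_at_homothety Tw Sz).
Qed.

Lemma vertex_at_exists w : dvd w h -> exists X, vertex_at X w.
Proof.
move=> wh; have [T Tw] := lat_at_build (oner_neq0 K) wh.
exists (exist _ (homothety_class T) (ex_intro _ T erefl)) => S.
exact: homothety_vertex_at Tw S.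
Qed.

Lemma vertex_has_divisor X : exists2 w, dvd w h & vertex_at X w.
Proof.
case: X => X [T XE]; have [x [w Tw]] := lat_at_exists ufdR locU dim2 N T.
exists w; first by case: Tw.
by move=> S /=; rewrite XE; exact: homothety_vertex_at Tw S.
Qed.

Lemma vertex_at_eq X Y w : vertex_at X w -> vertex_at Y w -> X = Y.
Proof.
move=> Xw Yw; case: X Y Xw Yw => [X XP] [Y YP] Xw Yw.
have e : X = Y by apply/funext => S; apply/propext; exact: iff_trans (Xw S) (iff_sym (Yw S)).
by subst Y; rewrite (Prop_irrelevance XP YP).
Qed.

Lemma vertex_at_assoc X w z : dvd w h -> vertex_at X w -> vertex_at X z -> associated w z.
Proof.
move=> wh Xw Xz; have [T Tw] := lat_at_build (oner_neq0 K) wh.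
have [y Tz] : exists y, lat_at N T y z by apply/Xz/Xw; exists 1.
apply/(lat_at_homothety Tw Tz)/(homothety_vertex_at Tw).
by exists 1.
Qed.

Lemma vertex_atW X w z : associated w z -> vertex_at X w -> vertex_at X z.
Proof.
move=> wz Xw S; rewrite (Xw S).
by split=> -[y Sy]; exists y; apply: lat_at_assoc Sy _ => //; exact: assoc_sym.
Qed.

Variables (r : nat) (p : 'I_r -> R) (n : 'I_r -> nat).
Hypothesis pI : forall i, irreducible_elt (p i).
Hypothesis pN : forall i k, associated (p i) (p k) -> i = k.
Hypothesis p_h : forall q, irreducible_elt q -> dvd q h -> exists i, associated q (p i).
Hypothesis nE : forall i, n i = vp (p i) h.

Lemma pprod_h : associated (pprod p n) h.
Proof.
have -> : n = fun i => vp (p i) h by exact/funext.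
exact: (pprod_factor ufdR pI pN (nh0 N) p_h).
Qed.

Lemma rect_dvd (j : rect_vertex n) : dvd (pprod p (val j)) h.
Proof.
apply: dvd_trans (assoc_dvd pprod_h); apply/dvd_pprod => // i.
by have /forallP := valP j.
Qed.

Lemma divisor_rect w : dvd w h -> exists j : rect_vertex n, associated (pprod p (val j)) w.
Proof.
move=> wh; have w0 := dvd_neq0 wh (nh0 N).
have jP : [forall i, [ffun i => vp (p i) w] i <= n i]%N.
  by apply/forallP => i; rewrite ffunE nE; apply: vp_dvd => //; exact: nh0.
exists (exist _ [ffun i => vp (p i) w] jP) => /=.
have -> : pprod p [ffun i => vp (p i) w] = pprod p (fun i => vp (p i) w).
  by apply: eq_bigr => i _; rewrite ffunE.
by apply: pprod_factor => // q qI qw; apply: p_h => //; exact: dvd_trans qw wh.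
Qed.

(** The irreducible quotient divides h, hence is associated with some p s. *)
Lemma rect_step (j j' : rect_vertex n) :
  (exists2 q, irreducible_elt q & associated (pprod p (val j')) (q * pprod p (val j))) <->
  exists s, val j' s = (val j s).+1 /\ forall i, i != s -> val j' i = val j i.
Proof.
split=> [[q qI qj]|[s [e1 e2]]]; last first.
  by exists (p s) => //; rewrite (pprodS p e1 e2); exact: assoc_refl.
have [s qs] : exists s, associated q (p s).
  apply: p_h => //; apply: dvd_trans (rect_dvd j').
  apply: dvd_trans (assoc_dvd (assoc_sym qj)).
  by exists (pprod p (val j)); rewrite mulrC.
have vE i : val j' i = (vp (p i) q + val j i)%N.
  rewrite -(vp_pprod_at ufdR pI pN i (val j')).
  rewrite (vp_assoc ufdR (pI i) _ qj) ?pprod_neq0 //.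
  by rewrite vpM ?pprod_neq0 ?irr_neq0 // vp_pprod_at.
exists s; split=> [|i si]; rewrite vE vp_irr //.
  by rewrite asboolT // ; exact: assoc_sym.
rewrite asboolF // => pq; move: si; rewrite (pN (assoc_trans pq qs)).
by rewrite eqxx.
Qed.

Lemma rect_adjP (j j' : rect_vertex n) : @adj (rect n) j j' <->
  (exists s, val j' s = (val j s).+1 /\ forall i, i != s -> val j' i = val j i) \/
  (exists s, val j s = (val j' s).+1 /\ forall i, i != s -> val j i = val j' i).
Proof.
split=> [[s [d1 e]]|[[s [e1 e2]]|[s [e1 e2]]]].
- have [le|lt] := leqP (val j s) (val j' s).
    by left; exists s; split=> //; move: d1; rewrite distnEl // => d1; rewrite -(subnK le) d1.
  right; exists s; split=> [|i /e //]; have le := ltnW lt.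
  by move: d1; rewrite distnEr // => d1; rewrite -(subnK le) d1.
- by exists s; split=> //; rewrite e1 distnEl ?leqnSn // subSnn.
by exists s; split=> [|i /e2 //]; rewrite e1 distnEr ?leqnSn // subSnn.
Qed.

Lemma Cfr_adjP X Y w z : dvd w h -> dvd z h -> vertex_at X w -> vertex_at Y z ->
  @adj (Cfr rho) X Y <->
  (exists2 q, irreducible_elt q & associated z (q * w)) \/
  (exists2 q, irreducible_elt q & associated w (q * z)).
Proof.
move=> wh zh Xw Yz; split=> [[T [T' [XT YT' sub ch]]]|qq].
  have [x Tw] := (Xw T).1 XT; have [x' T'z] := (Yz T').1 YT'.
  have [|q qI [qz|qw]] := (lat_adj ufdR wh zh).1; first by exists T, T', x, x'.
    by left; exists q.
  by right; exists q.
have [|T [T' [x [x' [Tw T'z sub ch]]]]] := (lat_adj ufdR wh zh).2.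
  by case: qq => -[q qI qq]; exists q => //; [left | right].
exists T, T'; split=> //; first by apply/Xw; exists x.
by apply/Yz; exists x'.
Qed.

Lemma rect_iso : exists Phi : graph_iso (Cfr rho) (rect n),
  forall j, vertex_at (iso_inv Phi j) (pprod p (val j)).
Proof.
have /choice[g gP] : forall j : rect_vertex n, exists X, vertex_at X (pprod p (val j)).
  by move=> j; apply: vertex_at_exists; exact: rect_dvd.
have /choice[f fP] : forall X, exists j, g j = X.
  move=> X; have [w wh Xw] := vertex_has_divisor X; have [j jw] := divisor_rect wh.
  by exists j; apply: vertex_at_eq Xw; exact: vertex_atW jw (gP j).
have ginj : injective g.
  move=> j j' e; apply/val_inj/ffunP; apply: (pprod_inj ufdR pI pN).
  by apply: vertex_at_assoc (gP j) _; [exact: rect_dvd | rewrite e; exact: gP].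
have fK : cancel f g by exact: fP.
have gK : cancel g f by move=> j; apply: ginj; rewrite fK.
have gadj j j' : @adj (Cfr rho) (g j) (g j') <-> @adj (rect n) j j'.
  rewrite (Cfr_adjP (rect_dvd j) (rect_dvd j') (gP j) (gP j')).
  by rewrite rect_adjP !rect_step.
have fadj X Y : @adj (Cfr rho) X Y <-> @adj (rect n) (f X) (f Y).
  by rewrite -gadj !fK.
by exists (@GraphIso (Cfr rho) (rect n) f g fK gK fadj).
Qed.

Variables (J : ideal R) (theta : G -> rquot J).
Hypothesis thetaE : forall g, repr (theta g) - nd N g \in J.
Hypothesis J_h : {subset J <= pideal h}.

(** By the eigenvector argument x / x' is a unit, so the inclusion of T in T'
    only concerns the e2-coordinate and says that w divides w'. *)
Lemma gquotient_rect (T T' : sflattice rho) x x' (j j' : rect_vertex n) :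
  lat_at N T x (pprod p (val j)) -> lat_at N T' x' (pprod p (val j')) ->
  {subset sfl_mod T <= sfl_mod T'} ->
  is_gquotient (lattice_quotient T' T) (char_module J theta) ->
  rect_le j j' /\ fdvd x x'.
Proof.
move=> Tj T'j' sub /(gquotient_fdvd thetaE Tj T'j') xx'; split=> //.
have [[s xE] [t yE]] := (lat_at_subset Tj T'j').1 sub.
have [x0 wh _] := Tj; have [x'0 w'h _] := T'j'.
have st := (lat_ratio t x'0 wh w'h xE).1 yE.
have sU : s \is a GRing.unit.
  have [u uU] := fdvd_unit_eq xx' (ex_intro _ s xE) x0.
  move=> x'E; have : (s * u)%:F = 1%:F :> K.
    apply: (mulIf x0); rewrite tofracM -mulrA -x'E -xE tofrac1 mul1r.
    by [].
  by move/eqP; rewrite tofrac_eq => /eqP su; apply/unitrP; exists u; rewrite mulrC.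
apply/(dvd_pprod ufdR pI pN); exists (s^-1 * t).
by rewrite -mulrA -st mulKr.
Qed.

Lemma rect_quotient_iso (T T' : sflattice rho) x x' (j j' : rect_vertex n) :
  lat_at N T x (pprod p (val j)) -> lat_at N T' x' (pprod p (val j')) ->
  {subset sfl_mod T <= sfl_mod T'} -> fdvd x x' -> rect_le j j' ->
  let w := pprod p (fun i => val j' i - val j i)%N in
  {subset J <= pideal w} /\
  gisomorphic (lattice_quotient T' T) (char_module (pideal w) theta).
Proof.
move=> Tj T'j' sub xx' jj' w; have wE := pprod_split p jj'.
have Jw : {subset J <= pideal w}.
  move=> y /J_h/in_pideal hy; apply/in_pideal; apply: dvd_trans hy.
  apply: dvd_trans (rect_dvd j'); rewrite wE.
  by exists (pprod p (val j)); rewrite mulrC.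
by split=> //; exact: lat_quotient_iso thetaE Tj T'j' sub xx' wE Jw.
Qed.

Lemma rect_le_reps (j j' : rect_vertex n) : rect_le j j' ->
  exists (T T' : sflattice rho) x x', [/\ lat_at N T x (pprod p (val j)),
    lat_at N T' x' (pprod p (val j')), {subset sfl_mod T <= sfl_mod T'} &
    is_gquotient (lattice_quotient T' T) (char_module J theta)].
Proof.
move=> jj'; have one0 := oner_neq0 K.
have [T Tj] := lat_at_build one0 (rect_dvd j).
have [T' T'j'] := lat_at_build one0 (rect_dvd j').
have xE : 1 = 1%:F * 1 :> K by rewrite tofrac1 mulr1.
have sub : {subset sfl_mod T <= sfl_mod T'}.
  apply/(lat_at_subset Tj T'j'); split; first exact: fdvd_refl.
  exists (pprod p (fun i => val j' i - val j i)%N).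
  apply/(lat_ratio _ one0 (rect_dvd j) (rect_dvd j') xE).
  by rewrite mul1r; exact: pprod_split.
exists T, T', 1, 1; split=> //.
have [Jw iso] := rect_quotient_iso Tj T'j' sub (fdvd_refl _) jj'.
exact: gquotient_of_iso Jw iso.
Qed.

End Rectangle.

(** * Existence of normal forms *)

Section Existence.
Variables (R : idomainType) (V : vectType {fraction R}) (G : groupType).
Variable rho : G -> 'End(V).
Local Notation K := {fraction R}.
Hypothesis ufdR : ufd R.
Hypothesis locU : forall x y : R,
  x + y \is a GRing.unit -> x \is a GRing.unit \/ y \is a GRing.unit.
Hypothesis two_unit : (2%:R : R) \is a GRing.unit.
Hypothesis dim2 : \dim (fullv : {vspace V}) = 2%N.
Hypothesis repr_rho : is_representation rho.
Hypothesis irr_rho : irreducible_rep rho.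

(** Otherwise K e1 would be a stable line. *)
Lemma irreducible_offdiag (F : frame V) : exists g, fk2 F (rho g (fe1 F)) != 0.
Proof.
apply: contrapT => h.
have z g : fk2 F (rho g (fe1 F)) = 0 by apply/eqP/negPn/negP => n; apply: h; exists g.
have e10 := fe1_neq0 F.
have [g|e|e] := irr_rho.2 <[fe1 F]>%VS.
- rewrite limg_line -memvE; apply/vlineP; exists (fk1 F (rho g (fe1 F))).
  by rewrite {1}(frameE F (rho g (fe1 F))) z scale0r addr0.
- by have := dim_vline (fe1 F); rewrite e dimv0 e10.
by have := dim_vline (fe1 F); rewrite e dim2 e10.
Qed.

(** Scale e1 and e2 so that a given stable lattice becomes R e1 + R e2, and then
    scale e2 by the content of the entries c(g). *)
Lemma normal_form_exists (F : frame V) (g0 : G) (l1 l2 : R) (T : sflattice rho) :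
  rho g0 (fe1 F) = l1%:F *: fe1 F -> rho g0 (fe2 F) = l2%:F *: fe2 F ->
  l1 - l2 \is a GRing.unit ->
  exists N : normal_form rho, [/\ ng0 N = g0, na N g0 = l1 & nd N g0 = l2].
Proof.
move=> rho1 rho2 lU.
have [x [y [x0 y0 TB]]] := box_of_eigenframe locU dim2 rho1 rho2 lU
  (sfl_lattice T) (sfl_free T) (@sfl_stable _ _ _ _ T g0).
have [F1 [E1 E2 k1E k2E]] := frame_scale_exists F x0 y0.
have TB1 : is_box F1 (sfl_mod T) 1 1.
  move=> v; rewrite TB /in_box k1E k2E.
  by rewrite -{1}(mulr1 x) -{1}(mulr1 y) -{1}(divfK x0 (fk1 F v)) -{1}(divfK y0 (fk2 F v))
    [fk1 F v / x * x]mulrC [fk2 F v / y * y]mulrC !fdvd_mul2l.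
have e1T : (fe1 F1 : rmod V) \in sfl_mod T.
  by apply/TB1; rewrite /in_box fk1e1 fk2e1; split; [exact: fdvd_refl | exact: fdvd0].
have e2T : (fe2 F1 : rmod V) \in sfl_mod T.
  by apply/TB1; rewrite /in_box fk1e2 fk2e2; split; [exact: fdvd0 | exact: fdvd_refl].
have /choice[ac acE] : forall g, exists r : R * R,
    rho g (fe1 F1) = r.1%:F *: fe1 F1 + r.2%:F *: fe2 F1.
  move=> g; have /TB1[[r rE] [s sE]] := sfl_stable g e1T; exists (r, s) => /=.
  by rewrite {1}(frameE F1 (rho g (fe1 F1))) rE sE !mulr1.
have /choice[bd bdE] : forall g, exists r : R * R,
    rho g (fe2 F1) = r.1%:F *: fe1 F1 + r.2%:F *: fe2 F1.
  move=> g; have /TB1[[r rE] [s sE]] := sfl_stable g e2T; exists (r, s) => /=.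
  by rewrite {1}(frameE F1 (rho g (fe2 F1))) rE sE !mulr1.
have [gc cn0] := irreducible_offdiag F1.
rewrite acE frameK2 tofrac_eq0 in cn0.
have [gb bn0] := irreducible_offdiag (frame_swap F1).
rewrite /= bdE frameK1 tofrac_eq0 in bn0.
have [y1 [c' [y10 cE c'P]]] := content ufdR (c := fun g => (ac g).2) cn0.
have y1F0 : y1%:F != 0 :> K by rewrite tofrac_eq0.
have yb0 : y1 * (bd gb).1 != 0 by rewrite mulf_neq0.
have [h [b' [h0 bE b'P]]] := content ufdR (c := fun g => y1 * (bd g).1) yb0.
have [F2 [H1 H2 m1E m2E]] := frame_scale_exists F1 (oner_neq0 K) y1F0.
rewrite scale1r in H1.
have N1 g : rho g (fe1 F2) = (ac g).1%:F *: fe1 F2 + (c' g)%:F *: fe2 F2.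
  by rewrite H1 H2 acE cE scalerA tofracM mulrC.
have N2 g : rho g (fe2 F2) = (y1 * (bd g).1)%:F *: fe1 F2 + (bd g).2%:F *: fe2 F2.
  by rewrite H1 H2 linearZ /= bdE scalerDr !scalerA tofracM [y1%:F * (bd g).2%:F]mulrC.
have f1 : rho g0 (fe1 F2) = l1%:F *: fe1 F2.
  by rewrite H1 E1 linearZ /= rho1 !scalerA mulrC.
have f2 : rho g0 (fe2 F2) = l2%:F *: fe2 F2.
  by rewrite H2 E2 !linearZ /= rho2 !scalerA [_ * l2%:F]mulrC [l2%:F * _]mulrA.
have inj (r s : R) : r%:F = s%:F :> K -> r = s.
  by move=> /eqP; rewrite tofrac_eq => /eqP.
have A0 : (ac g0).1 = l1.
  by apply: inj; have := congr1 (fk1 F2) (N1 g0); rewrite f1 frameK1 fk1Z fk1e1 mulr1.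
have C0 : c' g0 = 0.
  apply: inj; have := congr1 (fk2 F2) (N1 g0).
  by rewrite f1 frameK2 fk2Z fk2e1 mulr0 tofrac0.
have B0 : y1 * (bd g0).1 = 0.
  apply: inj; have := congr1 (fk1 F2) (N2 g0).
  by rewrite f2 frameK1 fk1Z fk1e2 mulr0 tofrac0.
have D0 : (bd g0).2 = l2.
  by apply: inj; have := congr1 (fk2 F2) (N2 g0); rewrite f2 frameK2 fk2Z fk2e2 mulr1.
have U0 : (ac g0).1 - (bd g0).2 \is a GRing.unit by rewrite A0 D0.
by exists (NormalForm N1 N2 h0 bE b'P c'P B0 C0 U0).
Qed.

(** The two orders of the eigenvectors give two normal forms; one of them has
    theta as its second diagonal entry. *)
Lemma adapted_normal_form (F : frame V) (g0 : G) (l1 l2 : R) (T : sflattice rho) :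
  rho g0 (fe1 F) = l1%:F *: fe1 F -> rho g0 (fe2 F) = l2%:F *: fe2 F ->
  l1 - l2 \is a GRing.unit ->
  forall (J : ideal R) (theta theta' : G -> rquot J),
    is_character theta -> is_character theta' -> trace_mod rho theta theta' ->
    exists N : normal_form rho, forall g, repr (theta g) - nd N g \in J.
Proof.
move=> rho1 rho2 lU J theta theta' ch ch' tr.
have [N [Ng Na Nd]] := normal_form_exists T rho1 rho2 lU.
have [_ [thd|tha]] := nf_split locU two_unit repr_rho N ch ch' tr; first by exists N.
have lU' : l2 - l1 \is a GRing.unit by rewrite -unitrN opprB.
have [N' [Ng' Na' Nd']] := @normal_form_exists (frame_swap F) g0 l2 l1 T rho2 rho1 lU'.
have [_ [thd|tha']] := nf_split locU two_unit repr_rho N' ch ch' tr; first by exists N'.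
exists N' => g; apply: ideal1_top.
have lJ : l1 - l2 \in J.
  rewrite (_ : l1 - l2 = (repr (theta g0) - l2) - (repr (theta g0) - l1)); last by ring.
  by apply: idealB; [rewrite -Na'; exact: tha' | rewrite -Na; exact: tha].
by rewrite -(mulVr lU); exact: idealMl.
Qed.

End Existence.

(** The residual characters differ at some g0, where the discriminant
    2 tr(g0^2) - tr(g0)^2 of the characteristic polynomial is then a nonzero
    square modulo the maximal ideal, hence a unit square. *)
Lemma residual_eigenframe (R : idomainType) (m : ideal R)
    (V : vectType {fraction R}) (G : groupType) (rho : G -> 'End(V))
    (psi psi' : G -> rquot m) :
  local_ring m -> adic_complete m -> (2%:R : R) \is a GRing.unit ->
  \dim (fullv : {vspace V}) = 2%N -> is_representation rho ->
  is_character psi -> is_character psi' -> trace_mod rho psi psi' -> psi <> psi' ->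
  exists (F : frame V) g0 (l1 l2 : R), [/\ rho g0 (fe1 F) = l1%:F *: fe1 F,
    rho g0 (fe2 F) = l2%:F *: fe2 F & l1 - l2 \is a GRing.unit].
Proof.
move=> locR complR two_unit dim2 [_ rhoM] [_ psiM] [_ psi'M] tr npsi.
have [g0 ng0] : exists g, psi g <> psi' g.
  by apply: contrapT => h; apply: npsi; apply/funext => g; apply: contrapT => n; apply: h; exists g.
set p := repr (psi g0); set p' := repr (psi' g0).
have vU : p - p' \is a GRing.unit.
  apply/(notin_local locR complR)/negP => pm; apply: ng0.
  by rewrite -(rpi_repr (psi g0)) -(rpi_repr (psi' g0)); apply/rpi_eq.
have [t tE te] := tr g0; have [t2 t2E t2e] := tr (g0 * g0)%g.
have tm : t - (p + p') \in m by apply/rpi_eq; rewrite te rpiD !rpi_repr.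
have t2m : t2 - (p ^+ 2 + p' ^+ 2) \in m.
  by apply/rpi_eq; rewrite t2e rpiD !expr2 -!rpiM !rpi_repr psiM psi'M.
pose D := 2%:R * t2 - t ^+ 2.
have Dm : (p - p') ^+ 2 - D \in m.
  rewrite (_ : _ - D = (t + (p + p')) * (t - (p + p')) - 2%:R * (t2 - (p ^+ 2 + p' ^+ 2)));
    last by rewrite /D; ring.
  by apply: idealB; exact: idealMl.
have [s sE] : exists s, s ^+ 2 = D.
  by apply: (sqrt_lift complR _ Dm); rewrite unitrM two_unit.
have sU : s \is a GRing.unit.
  apply/(notin_local locR complR)/negP => sm.
  have : (p - p') ^+ 2 \in m.
    by rewrite -(subrK D (_ ^+ 2)); apply: idealD => //; rewrite -sE expr2; exact: idealMl.
  by move/(mem_local locR complR)/negP; apply; rewrite expr2 unitrM vU.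
pose l1 := (t + s) / 2%:R; pose l2 := (t - s) / 2%:R.
have l12 : l1 - l2 = s.
  rewrite /l1 /l2 -mulrBl (_ : t + s - (t - s) = s * 2%:R); last by ring.
  by rewrite mulrK.
have lD : l1 + l2 = t.
  rewrite /l1 /l2 -mulrDl (_ : t + s + (t - s) = t * 2%:R); last by ring.
  by rewrite mulrK.
have [F] := frame_exists dim2.
have two0 : (2%:R : {fraction R}) != 0.
  rewrite -[2%:R](rmorph_nat (@FracField.tofrac R)) tofrac_eq0.
  by apply: contraTneq two_unit => ->; rewrite unitr0.
have nl : l1%:F != l2%:F :> {fraction R}.
  by rewrite tofrac_eq -subr_eq0 l12; apply: contraTneq sU => ->; rewrite unitr0.
have [||F' [e1 e2]] := @eigenframe _ V F (rho g0) l1%:F l2%:F dim2 two0 nl.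
- by rewrite -trace_frame -tE -tofracD lD.
- rewrite -!trace_frame -rhoM -tE -t2E -tofracB l12 -!tofracXn sE /D tofracB tofracM.
  by rewrite rmorph_nat.
by exists F', g0, l1, l2; rewrite l12.
Qed.

(** * The ideal of reducibility at height-one primes *)

Section Support.
Variables (R : idomainType) (V : vectType {fraction R}) (G : groupType).
Variable rho : G -> 'End(V).
Hypothesis ufdR : ufd R.
Variable N : normal_form rho.
Local Notation J := (nf_J N).
Local Notation h := (nh N).

Lemma nf_support (q : primeIdeal R) :
  ht1_support J q <-> height q 1 /\ h \in (q : ideal R).
Proof.
split=> [qJ|[q1 hq]].
  have q1 : height q 1 by case: qJ.
  have [pi piI qE] := (height1P ufdR q).1 q1; split=> //.
  by move/(ht1_supportP ufdR piI qE): qJ; rewrite qE => /(nf_J_irr ufdR N piI) ?; apply/in_pideal.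
have [pi piI qE] := (height1P ufdR q).1 q1.
apply/(ht1_supportP ufdR piI qE); rewrite qE; apply/(nf_J_irr ufdR N piI)/in_pideal.
by rewrite -qE.
Qed.

Lemma nf_ord_loc (q : primeIdeal R) pi n : irreducible_elt pi ->
  q = pideal pi :> ideal R -> ord_loc q J n <-> n = vp pi h.
Proof.
move=> piI qE; have [u [huJ npu]] := nf_J_content ufdR N piI.
exact: (ord_locP ufdR piI qE n (nh0 N) (@nf_J_h _ _ _ _ N) huJ npu).
Qed.

Lemma nf_enumerates : exists (r : nat) (p : 'I_r -> primeIdeal R) (n : 'I_r -> nat),
  enumerates (ht1_support J) p /\ forall i, ord_loc (p i) J (n i).
Proof.
have [r [p pP]] := enumerate_prime_divisors ufdR (nh0 N).
have pJ : enumerates (ht1_support J) p.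
  by apply: enumerates_ext pP => q; rewrite nf_support.
have [w [wI _ wE]] := enumerate_generators ufdR (fun q (qJ : ht1_support J q) => qJ.1) pJ.
exists r, p, (fun i => vp (w i) h); split=> // i.
exact/(nf_ord_loc _ (wI i) (wE i)).
Qed.

Section Enumerated.
Variables (r : nat) (p : 'I_r -> primeIdeal R) (n : 'I_r -> nat).
Hypothesis pJ : enumerates (ht1_support J) p.
Hypothesis nJ : forall i, ord_loc (p i) J (n i).

Lemma nf_generators : exists w : 'I_r -> R,
  [/\ forall i, irreducible_elt (w i), forall i k, associated (w i) (w k) -> i = k,
      forall i, p i = pideal (w i) :> ideal R,
      forall q, irreducible_elt q -> dvd q h -> exists i, associated q (w i) &
      forall i, n i = vp (w i) h].
Proof.
have [w [wI wN wE]] := enumerate_generators ufdR (fun q (qJ : ht1_support J q) => qJ.1) pJ.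
exists w; split=> // [q qI qh|i]; last exact/(nf_ord_loc _ (wI i) (wE i)).
have [|i pq] := (pJ.2 (irr_primeIdeal ufdR qI)).1.
  by apply/nf_support; split; [exact: irr_prime_height | apply/in_pideal].
by exists i; apply/pideal_eq; rewrite -wE pq.
Qed.

End Enumerated.
End Support.

(** * Structure of the graph of stable free lattices *)

(** The enumeration may be empty; the rectangle is then a point. *)
Lemma Cfr_rectangle (R : idomainType) (V : vectType {fraction R}) (G : groupType)
    (rho : G -> 'End(V)) (N : normal_form rho) (theta : G -> rquot (nf_J N)) :
  ufd R ->
  (forall x y : R, x + y \is a GRing.unit -> x \is a GRing.unit \/ y \is a GRing.unit) ->
  \dim (fullv : {vspace V}) = 2%N ->
  (forall g, repr (theta g) - nd N g \in nf_J N) ->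
  forall (r : nat) (p : 'I_r -> primeIdeal R) (n : 'I_r -> nat),
    enumerates (ht1_support (nf_J N)) p ->
    (forall i, ord_loc (p i) (nf_J N) (n i)) ->
    exists Phi : graph_iso (Cfr rho) (rect n),
    forall j j' : vertex (rect n),
      let reps (T T' : sflattice rho) :=
        [/\ sval (iso_inv Phi j) T, sval (iso_inv Phi j') T',
            {subset sfl_mod T <= sfl_mod T'} &
            is_gquotient (lattice_quotient T' T) (char_module (nf_J N) theta)] in
      (rect_le j j' <-> exists T T' : sflattice rho, reps T T') /\
      forall T T' : sflattice rho, reps T T' ->
        let I := \big[@ideal_mul R/ideal_top R]_(i < r)
                   ideal_exp (p i) (val j' i - val j i)%N in
        {subset nf_J N <= I} /\
        gisomorphic (lattice_quotient T' T) (char_module I theta).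
Proof.
move=> ufdR locU dim2 thE r p n pJ nJ.
have [w [wI wN wE wh nE]] := nf_generators ufdR pJ nJ.
have [Phi PhiP] := rect_iso ufdR locU dim2 wI wN wh nE.
exists Phi => j j' reps; split; first split.
- move=> /(rect_le_reps ufdR wI wN wh nE thE (@nf_J_h _ _ _ _ N)).
  move=> [T [T' [x [x' [Tj T'j' sub quo]]]]]; exists T, T'; split=> //.
    by apply/PhiP; exists x.
  by apply/PhiP; exists x'.
- move=> [T [T' [/PhiP[x Tj] /PhiP[x' T'j'] sub quo]]].
  by have [] := gquotient_rect ufdR wI wN thE Tj T'j' sub quo.
move=> T T' [/PhiP[x Tj] /PhiP[x' T'j'] sub quo] I.
have [jj' xx'] := gquotient_rect ufdR wI wN thE Tj T'j' sub quo.
have -> : I = pideal (pprod w (fun i => val j' i - val j i)%N) by exact: ideal_prod_pideal.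
exact: (rect_quotient_iso ufdR wI wN wh nE thE (@nf_J_h _ _ _ _ N) Tj T'j' sub xx' jj').
Qed.

Theorem theorem1p1 (R : idomainType) (m : ideal R)
    (V : vectType {fraction R}) (G : groupType) (rho : G -> 'End(V))
    (psi psi' : G -> rquot m) :
  noetherian R ->
  local_ring m ->
  ufd R ->
  adic_complete m ->
  (2%:R : rquot m) <> 0 ->
  \dim (fullv : {vspace V}) = 2%N ->
  is_representation rho ->
  irreducible_rep rho ->
  inhabited (sflattice rho) ->
  is_character psi ->
  is_character psi' ->
  trace_mod rho psi psi' ->
  psi <> psi' ->
  (exists (r : nat) (a : 'I_r -> nat), inhabited (graph_iso (Cfr rho) (rect a)))
  /\
  (exists J : ideal R, is_reducibility_ideal rho J)
  /\
  forall (J : ideal R) (theta theta' : G -> rquot J),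
    is_reducibility_ideal rho J ->
    is_character theta ->
    is_character theta' ->
    trace_mod rho theta theta' ->
    ((forall p, ~ ht1_support J p) ->
       exists x : vertex (Cfr rho), forall y, y = x)
    /\
    (exists (r : nat) (p : 'I_r -> primeIdeal R) (n : 'I_r -> nat),
       enumerates (ht1_support J) p /\ forall i, ord_loc (p i) J (n i))
    /\
    ((exists p, ht1_support J p) ->
     forall (r : nat) (p : 'I_r -> primeIdeal R) (n : 'I_r -> nat),
       enumerates (ht1_support J) p ->
       (forall i, ord_loc (p i) J (n i)) ->
       exists Phi : graph_iso (Cfr rho) (rect n),
       forall j j' : vertex (rect n),
         let reps (T T' : sflattice rho) :=
           [/\ sval (iso_inv Phi j) T, sval (iso_inv Phi j') T',
               {subset sfl_mod T <= sfl_mod T'} &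
               is_gquotient (lattice_quotient T' T) (char_module J theta)] in
         (rect_le j j' <-> exists T T' : sflattice rho, reps T T') /\
         forall T T' : sflattice rho, reps T T' ->
           let I := \big[@ideal_mul R/ideal_top R]_(i < r)
                      ideal_exp (p i) (val j' i - val j i)%N in
           {subset J <= I} /\
           gisomorphic (lattice_quotient T' T) (char_module I theta)).
Proof.
move=> _ locR ufdR complR two0 dim2 rhoR irr [T0] ch ch' tr npsi.
have two_unit : (2%:R : R) \is a GRing.unit.
  apply/(notin_local locR complR)/negP => two_m; apply: two0.
  have -> : 2%:R = rpi m 2%:R by rewrite mulr2n rpiD.
  exact/mqpi_eq0.
have locU (x y : R) : x + y \is a GRing.unit -> x \is a GRing.unit \/ y \is a GRing.unit.
  move=> xyU; have [xU|/(mem_local locR complR) xm] := boolP (x \is a GRing.unit); first by left.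
  right; apply: contraLR xyU => /(mem_local locR complR) ym.
  by apply/(mem_local locR complR); exact: idealD.
have [F [g0 [l1 [l2 [rho1 rho2 lU]]]]] :=
  residual_eigenframe locR complR two_unit dim2 rhoR ch ch' tr npsi.
have adapted (J : ideal R) (theta theta' : G -> rquot J) : is_reducibility_ideal rho J ->
    is_character theta -> is_character theta' -> trace_mod rho theta theta' ->
    exists N : normal_form rho, J = nf_J N /\ forall g, repr (theta g) - nd N g \in J.
  move=> JP th th' trth.
  have [N thE] := adapted_normal_form ufdR locU two_unit dim2 rhoR irr T0 rho1 rho2 lU th th' trth.
  by exists N; split=> //; exact: (reducibility_ideal_unique locU two_unit rhoR N JP).
have [N0 _] := normal_form_exists ufdR locU dim2 irr T0 rho1 rho2 lU.
have J0P := nf_reducibility locU two_unit rhoR N0.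
split; last split; first last.
- move=> J theta theta' JP th th' trth.
  have [N [JE thE]] := adapted J theta theta' JP th th' trth.
  subst J; split; last split; first last.
  + by move=> _; exact: (Cfr_rectangle ufdR locU dim2 thE).
  + exact: (nf_enumerates ufdR N).
  have [r [p [n [pJ nJ]]]] := nf_enumerates ufdR N.
  have [Phi _] := Cfr_rectangle ufdR locU dim2 thE pJ nJ.
  move=> J0; exists (exist _ (homothety_class T0) (ex_intro _ T0 erefl)) => y.
  rewrite -[y](iso_funK Phi) -[RHS](iso_funK Phi); congr iso_inv.
  apply/val_inj/ffunP => i; case: (J0 (p i)).
  by apply/pJ.2; exists i.
- by exists (nf_J N0).
have [theta [theta' [th th' trth]]] := (J0P (nf_J N0)).1 (fun x xJ => xJ).
suff rectangle (J : ideal R) (eta eta' : G -> rquot J) : is_reducibility_ideal rho J ->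
    is_character eta -> is_character eta' -> trace_mod rho eta eta' ->
    exists (r : nat) (a : 'I_r -> nat), inhabited (graph_iso (Cfr rho) (rect a)).
  exact: rectangle J0P th th' trth.
move=> JP et et' tret; have [N [JE etE]] := adapted J eta eta' JP et et' tret.
subst J; have [r [p [n [pJ nJ]]]] := nf_enumerates ufdR N.
have [Phi _] := Cfr_rectangle ufdR locU dim2 etE pJ nJ.
by exists r, n.
Qed.
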